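(* Let $-\frac1n<\alpha<0$ and let $f=(1-\alpha\varphi)^{1/\alpha}\in\mathcal{C}^+_\alpha(\mathbb{R}^n)$ have essentially continuous base $\varphi$ and satisfy $0<\int_{\mathbb{R}^n}f\,dx<+\infty$. Then the measure $\mu_\alpha(f,\cdot)=(\nabla\varphi)_\sharp(f^{1-\alpha}dx)$ has finite first moment, its barycenter is the origin, and its support is not contained in any hyperplane.
   Context: $\mathrm{Conv}(\mathbb{R}^n)$ is the set of proper, convex, lower semi-continuous $\varphi:\mathbb{R}^n\to\mathbb{R}\cup\{+\infty\}$; $\varphi$ is coercive if $\liminf_{|x|\to\infty}\varphi(x)/|x|>0$. For $\alpha<0$, $\mathcal{C}^+_\alpha(\mathbb{R}^n)$ is the set of $f=(1-\alpha\varphi)^{1/\alpha}$ with $\varphi\in\mathrm{Conv}(\mathbb{R}^n)$ nonnegative and coercive (convention: $f=0$ where $\varphi=+\infty$). A convex function is essentially continuous if it is lower semi-continuous and the set of points of $\partial(\mathrm{dom}\,\varphi)$ where it is discontinuous has $\mathcal{H}^{n-1}$-measure zero. $\mu_\alpha(f,\eta)=\int_{\{x:\nabla\varphi(x)\in\eta\}}f(x)^{1-\alpha}dx$ for Borel $\eta\subset\mathbb{R}^n$. *)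

(* Defs.v *)
From HB Require Import structures.
From mathcomp Require Import all_boot all_order all_algebra.
From mathcomp Require Import all_classical all_reals all_analysis.
Set Implicit Arguments. Unset Strict Implicit. Unset Printing Implicit Defensive.
Import Order.TTheory GRing.Theory Num.Theory.
Import numFieldNormedType.Exports.
Local Open Scope classical_set_scope.
Local Open Scope ring_scope.

Definition dotv (R : realType) (n : nat) (u v : 'rV[R]_n) : R :=
  \sum_(i < n) u 0 i * v 0 i.

Definition enorm (R : realType) (n : nat) (x : 'rV[R]_n) : R :=
  Num.sqrt (dotv x x).

Definition box (R : realType) (n : nat) (a b : 'rV[R]_n) : set 'rV[R]_n :=
  [set x | forall i, a 0 i <= x 0 i /\ x 0 i < b 0 i].

(* volume of a (nonempty) box, +oo on non-boxes, 0 on the empty set *)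
Definition box_content (R : realType) (n : nat) (A : set 'rV[R]_n) : \bar R :=
  if `[< A = set0 >] then 0%E else
  ereal_inf [set (\prod_(i < n) (ab.2 0 i - ab.1 0 i))%:E |
             ab in [set ab : 'rV[R]_n * 'rV[R]_n |
                    (forall i, ab.1 0 i <= ab.2 0 i) /\ A = box ab.1 ab.2]].

Lemma box_content0 (R : realType) (n : nat) : box_content (set0 : set 'rV[R]_n) = 0%E.
Proof. by rewrite /box_content asboolT. Qed.

Lemma box_content_ge0 (R : realType) (n : nat) (A : set 'rV[R]_n) :
  (0 <= box_content A)%E.
Proof.
rewrite /box_content; case: ifP => _ //.
apply: le_ereal_inf_tmp => _ [ab [able _] <-].
rewrite lee_fin; apply: prodr_ge0 => i _; rewrite subr_ge0; exact: able.
Qed.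

(* R^n with the discrete sigma-algebra, used only to run the outer-measure
   construction mu_ext (covers by arbitrary sets; non-boxes have content +oo,
   so this is the usual infimum over countable covers by boxes). *)
Definition boxT (R : realType) (n : nat) := 'rV[R]_n.
HB.instance Definition _ (R : realType) (n : nat) := Pointed.on (boxT R n).
HB.instance Definition _ (R : realType) (n : nat) :=
  @isMeasurable.Build default_measure_display (boxT R n) discrete_measurable
    discrete_measurable0 discrete_measurableC discrete_measurableU.

Definition leb_outer (R : realType) (n : nat) : set (boxT R n) -> \bar R :=
  @mu_ext _ (boxT R n) R (@box_content R n).
Arguments leb_outer : clear implicits.

HB.instance Definition _ (R : realType) (n : nat) :=
  isOuterMeasure.Build R (boxT R n) (leb_outer R n)
    (@mu_ext0 _ (boxT R n) R (@box_content R n) (@box_content0 R n)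
       (@box_content_ge0 R n))
    (@mu_ext_ge0 _ (boxT R n) R (@box_content R n) (@box_content_ge0 R n))
    (@le_mu_ext _ (boxT R n) R (@box_content R n))
    (@mu_ext_sigma_subadditive _ (boxT R n) R (@box_content R n)
       (@box_content_ge0 R n)).

Notation lebT R n := (caratheodory_type (leb_outer R n)).
Definition lebn (R : realType) (n : nat) : set (lebT R n) -> \bar R :=
  leb_outer R n.
Arguments lebn : clear implicits.

Notation borelT R n := (g_sigma_algebraType (@open 'rV[R]_n)).

Definition ediam (R : realType) (n : nat) (C : set 'rV[R]_n) : \bar R :=
  ereal_sup ([set 0%E] `|`
    [set r | exists x y, C x /\ C y /\ r = (enorm (x - y))%:E]).

Definition hterm (R : realType) (n : nat) (s : R) (C : set 'rV[R]_n) : \bar R :=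
  if `[< C = set0 >] then 0%E else ((fine (ediam C)) `^ s)%:E.

Definition hausdorff_delta (R : realType) (n : nat) (s delta : R)
    (A : set 'rV[R]_n) : \bar R :=
  ereal_inf [set (\sum_(k <oo) hterm s (C k))%E |
    C in [set C : nat -> set 'rV[R]_n |
          A `<=` \bigcup_k C k /\ forall k, (ediam (C k) <= delta%:E)%E]].

(* s-dimensional Hausdorff measure, without the normalising constant
   omega_s / 2^s (irrelevant for null sets) *)
Definition hausdorff (R : realType) (n : nat) (s : R) (A : set 'rV[R]_n) : \bar R :=
  ereal_sup [set hausdorff_delta s delta A | delta in [set d : R | 0 < d]].

Definition edom (R : realType) (n : nat) (phi : 'rV[R]_n -> \bar R) :=
  [set x | (phi x < +oo)%E].

Definition proper_fun (R : realType) (n : nat) (phi : 'rV[R]_n -> \bar R) :=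
  (forall x, phi x != -oo%E) /\ exists x, (phi x < +oo)%E.

Definition convex_efun (R : realType) (n : nat) (phi : 'rV[R]_n -> \bar R) :=
  forall (x y : 'rV[R]_n) (t : R), 0 < t -> t < 1 ->
    (phi ((1 - t) *: x + t *: y)%R <= ((1 - t)%R)%:E * phi x + t%:E * phi y)%E.

Definition Conv (R : realType) (n : nat) (phi : 'rV[R]_n -> \bar R) :=
  proper_fun phi /\ convex_efun phi /\ lower_semicontinuous phi.

(* liminf_{|x| -> oo} phi(x)/|x| > 0 *)
Definition coercive (R : realType) (n : nat) (phi : 'rV[R]_n -> \bar R) :=
  exists c : R, 0 < c /\ exists M : R, forall x, M <= enorm x ->
    ((c * enorm x)%:E <= phi x)%E.

Definition essentially_continuous (R : realType) (n : nat)
    (phi : 'rV[R]_n -> \bar R) :=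
  lower_semicontinuous phi /\
  hausdorff (n%:R - 1)
    [set x | (closure (edom phi) `\` interior (edom phi)) x /\
             ~ {for x, continuous phi}] = 0%E.

Definition falpha (R : realType) (n : nat) (alpha : R)
    (phi : 'rV[R]_n -> \bar R) (x : 'rV[R]_n) : R :=
  if phi x is r%:E then (1 - alpha * r) `^ alpha^-1 else 0.

Definition gdiff (R : realType) (n : nat) (phi : 'rV[R]_n -> \bar R)
    (x : 'rV[R]_n) : Prop :=
  interior (edom phi) x /\ differentiable (fun y => fine (phi y)) x.

Definition grad (R : realType) (n : nat) (phi : 'rV[R]_n -> \bar R)
    (x : 'rV[R]_n) : 'rV[R]_n :=
  \row_i ('d (fun y => fine (phi y)) x (delta_mx 0 i : 'rV[R]_n)).

Definition mu_alpha (R : realType) (n : nat) (alpha : R)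
    (phi : 'rV[R]_n -> \bar R) (eta : set (borelT R n)) : \bar R :=
  \int[lebn R n]_(x in [set x : lebT R n | gdiff phi x /\ eta (grad phi x)])
     ((falpha alpha phi x) `^ (1 - alpha))%:E.

Definition msupport (R : realType) (n : nat) (mu : set (borelT R n) -> \bar R) :
  set 'rV[R]_n :=
  [set y | forall U : set 'rV[R]_n, open U -> U y -> (0 < mu U)%E].

(* Main.v *)
(** Write f for the function and Q_k v for its difference quotient along v / k. Since f is
    unimodal on lines, translation invariance of Lebesgue measure bounds the integral of
    |Q_k v| near a ball of radius r by C r^(n-1). The discontinuity set of f is covered by
    balls with small sum of r^(n-1); off these balls the compact superlevel sets of f lie in
    the interior of the domain, where f is locally Lipschitz, and the low values of f
    contribute little. So Q_k v converges in L^1 to the one-sided directional derivative,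
    extended by 0. Each Q_k v has integral 0, hence so does the limit. Adding the statements
    for v and - v, and using that convexity gives phi'(x; v) + phi'(x; - v) >= 0, shows that phi is
    differentiable almost everywhere in the interior of its domain, where the limit is
    - f^(1 - alpha) (grad phi . v): this is the barycenter identity. If the support lies in
    v . y = c, then the barycenter gives c = 0, the derivative along v vanishes almost
    everywhere, so f is invariant under translation by multiples of v, which contradicts
    its decay at infinity. *)
Require Import Defs.
From HB Require Import structures.
From mathcomp Require Import all_boot all_order all_algebra.
From mathcomp Require Import all_classical all_reals all_analysis.
From mathcomp Require Import measurable_realfun ring lra zify.
Set Implicit Arguments. Unset Strict Implicit. Unset Printing Implicit Defensive.
Import Order.TTheory GRing.Theory Num.Theory.
Import numFieldNormedType.Exports.
Local Open Scope classical_set_scope.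
Local Open Scope ring_scope.

(** * Lebesgue measure *)

(** Pointwise convergence of the quotients inside the domain is not enough: their mass could
    concentrate where f jumps on the boundary. A jump over a boundary piece of diameter r has mass
    of order r^(n-1), which is why nullity for the (n-1)-dimensional Hausdorff measure is the
    matching hypothesis. The bound C r^(n-1) is obtained by counting steps, without integrating by
    parts: along an orbit of the translation by v / k the upward increments of a unimodal function
    add up to at most its maximum, by invariance all steps have the same integral, and about r k
    steps fit into a ball of radius comparable to r. One step thus gets a 1 / (r k) share of the
    volume r^n, and the factor k of the quotient leaves r^(n-1). The same count, with k steps of
    length 1 / k and a global envelope of f, handles the low values; the envelope is integrable
    because alpha > - 1/n. Of Lebesgue measure the argument uses measurability of open sets,
    translation invariance, completeness and an upper bound for the volume of balls. *)

Lemma box_content_le (R : realType) (n : nat) (a b : 'rV[R]_n) :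
  (forall i, a 0 i <= b 0 i) ->
  (box_content (box a b) <= (\prod_(i < n) (b 0 i - a 0 i))%:E)%E.
Proof.
move=> ab; rewrite /box_content; case: ifPn => [_|_].
  by rewrite lee_fin prodr_ge0// => i _; rewrite subr_ge0.
by apply: ereal_inf_lbound; exists (a, b).
Qed.

(** A coordinate hyperplane cuts a box into two boxes with the same total volume; on a nonempty set
    that is not a box the right side is infinite. *)
Lemma box_content_splitD (R : realType) (n : nat) (i : 'I_n) (s : R)
    (A : set 'rV[R]_n) :
  (box_content (A `&` [set x | x 0 i < s]%R) +
   box_content (A `&` ~` [set x | x 0 i < s]%R) <= box_content A)%E.
Proof.
have [->|/eqP A0] := pselect (A = set0).
  by rewrite !set0I box_content0 adde0.
rewrite [leRHS]/box_content asboolF; last by move/eqP: A0.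
apply: le_ereal_inf_tmp => _ [[a b]] /= [ab Aab] <-.
(* Clamping [s] to the side of the box keeps both pieces boxes even when the hyperplane misses it;
   one of them is then degenerate. *)
pose c := Num.min (b 0 i) (Num.max (a 0 i) s).
have ac : a 0 i <= c by rewrite /c le_min ab le_max lexx.
have cb : c <= b 0 i by rewrite /c ge_min lexx.
pose b' : 'rV[R]_n := \row_j if j == i then c else b 0 j.
pose a' : 'rV[R]_n := \row_j if j == i then c else a 0 j.
have -> : A `&` [set x | x 0 i < s]%R = box a b'.
  rewrite Aab; apply/seteqP; split => x /=.
    move=> [abx xs] j; rewrite /b' mxE; case: eqVneq => [->|_]; last exact: abx.
    have [? ?] := abx i; split => //.
    by rewrite /c lt_min lt_max xs orbT andbT.
  move=> abx; split.
    move=> j; have := abx j; rewrite /b' mxE; case: eqVneq => [->|_] // [? xc].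
    by split => //; exact: lt_le_trans xc cb.
  have := abx i; rewrite /b' mxE eqxx => -[ax].
  by rewrite /c lt_min lt_max => /andP[_ /orP[|//]]; rewrite ltNge ax.
have -> : A `&` ~` [set x | x 0 i < s]%R = box a' b.
  rewrite Aab; apply/seteqP; split => x /=.
    move=> [abx /negP]; rewrite -leNgt => xs j.
    rewrite /a' mxE; case: eqVneq => [->|_]; last exact: abx.
    have [? ?] := abx i; split => //.
    by rewrite /c ge_min ge_max xs andbT; apply/orP; right.
  move=> abx; have [] := abx i; rewrite /a' mxE eqxx => cx xb; split.
    move=> j; have := abx j; rewrite /a' mxE; case: eqVneq => [->|_] // [? ?].
    by split => //; exact: le_trans ac cx.
  apply/negP; rewrite -leNgt.
  move: cx; rewrite /c ge_min leNgt xb /= ge_max => /andP[].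
  by [].
apply: (le_trans (leeD (@box_content_le _ _ a b' _) (@box_content_le _ _ a' b _))).
- by move=> j; rewrite /b' mxE; case: eqVneq => [->|].
- by move=> j; rewrite /a' mxE; case: eqVneq => [->|].
have prodE (u v : 'rV[R]_n) : \prod_j (v 0 j - u 0 j) =
    (v 0 i - u 0 i) * \prod_(j | j != i) (v 0 j - u 0 j) by rewrite (bigD1 i).
rewrite -EFinD lee_fin !prodE.
rewrite (eq_bigr (fun j => b 0 j - a 0 j)); last first.
  by move=> j /negbTE ji; rewrite mxE ji.
rewrite [in X in _ + X](eq_bigr (fun j => b 0 j - a 0 j)); last first.
  by move=> j /negbTE ji; rewrite mxE ji.
rewrite -mulrDl !mxE eqxx; apply: ler_pM => //.
- by rewrite addr_ge0 ?subr_ge0.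
- by apply: prodr_ge0 => j _; rewrite subr_ge0.
- by rewrite addrC addrA addrNK.
Qed.

(** Testing the content suffices, because a countable cover of [X] splits into covers of the parts
    inside and outside [H] with no greater total content. *)
Lemma leb_outer_caratheodory (R : realType) (n : nat) (H : set 'rV[R]_n) :
  (forall A, box_content (A `&` H) + box_content (A `&` ~` H) <= box_content A)%E ->
  (leb_outer R n).-caratheodory H.
Proof.
move=> HA; apply: le_caratheodory_measurable => X.
apply: le_ereal_inf_tmp => _ [F [mF XF] <-].
have c0 := @box_content_ge0 R n.
apply: (@le_trans _ _ (\sum_(k <oo) (box_content (F k `&` H) +
                                box_content (F k `&` ~` H)))%E); last first.
  by apply: lee_nneseries => // k _; rewrite adde_ge0.
rewrite nneseriesD//; apply: leeD.
  apply: ereal_inf_lbound; exists (fun k => F k `&` H) => //.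
  by split => // x [/XF[k _ Fkx] Hx]; exists k.
apply: ereal_inf_lbound; exists (fun k => F k `&` ~` H) => //.
by split => // x [/XF[k _ Fkx] Hx]; exists k.
Qed.

Lemma box_content_shift (R : realType) (n : nat) (a : 'rV[R]_n) (A : set 'rV[R]_n) :
  (box_content [set x | A (x + a)]%R <= box_content A)%E.
Proof.
have [->|/eqP A0] := pselect (A = set0).
  by rewrite (_ : [set x | _] = set0)// -subset0 => x.
rewrite [leRHS]/box_content asboolF; last by move/eqP: A0.
apply: le_ereal_inf_tmp => _ [[b c]] /= [bc Abc] <-.
have -> : [set x | A (x + a)]%R = box (b - a) (c - a).
  rewrite Abc; apply/seteqP; split => x /= h i; have := h i; rewrite !mxE.
    by rewrite lerBlDr ltrBrDr.
  by rewrite lerBlDr ltrBrDr.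
apply: le_trans (box_content_le _) _.
  by move=> i; rewrite !mxE lerD2r.
rewrite lee_fin le_eqVlt; apply/orP; left; apply/eqP/eq_bigr => i _.
by rewrite !mxE; ring.
Qed.

(** The inequality for all shifts, used for [a] and [- a], gives equality. It holds on every set,
    measurable or not, and for this reason translations also preserve measurability. *)
Lemma leb_outer_shift (R : realType) (n : nat) (a : 'rV[R]_n) (A : set 'rV[R]_n) :
  leb_outer R n [set x | A (x + a)]%R = leb_outer R n A.
Proof.
have le a' B : (leb_outer R n [set x | B (x + a')]%R <= leb_outer R n B)%E.
  apply: le_ereal_inf_tmp => _ [F [mF BF] <-].
  apply: (@le_trans _ _ (\sum_(k <oo) box_content [set x | F k (x + a')]%R)%E).
    apply: ereal_inf_lbound; exists (fun k => [set x | F k (x + a')]%R) => //.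
    by split => // x /BF[k _ Fk]; exists k.
  by apply: lee_nneseries => [k _ _|k _]; [exact: box_content_ge0|exact: box_content_shift].
apply/eqP; rewrite eq_le le /=.
apply: le_trans (le (- a) _); rewrite le_eqVlt; apply/orP; left; apply/eqP.
by congr (leb_outer _ _ _); apply/funext => x /=; rewrite addrNK.
Qed.

HB.instance Definition _ (R : realType) (n : nat) :=
  isMeasure.Build _ (lebT R n) R (lebn R n)
    (@caratheodory_measure0 R (boxT R n) (leb_outer R n))
    (@caratheodory_measure_ge0 R (boxT R n) (leb_outer R n))
    (@caratheodory_measure_sigma_additive R (boxT R n) (leb_outer R n)).

Lemma ball_rowP (R : realType) (n : nat) (x y : 'rV[R]_n) (r : R) :
  ball x r y <-> 0 < r /\ forall i, `|x 0 i - y 0 i| < r.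
Proof.
split => [[r0 xy]|[r0 xy]]; split => // i; first exact: xy.
by move=> j; rewrite (ord1 i); exact: xy.
Qed.

Lemma ball_normP (R : realType) (n : nat) (x y : 'rV[R]_n) (r : R) :
  ball x r y <-> `|x - y| < r.
Proof. by rewrite -ball_normE. Qed.

Lemma ler_norm_rV (R : realType) (n : nat) (x : 'rV[R]_n) (i : 'I_n) :
  `|x 0 i| <= `|x|.
Proof.
rewrite [leRHS]/Num.norm/= mx_normrE.
by have /bigmax_leP[_ /(_ (0, i) erefl)] :=
  lexx (\big[Num.max/0]_(ij : 'I_1 * 'I_n) `|x ij.1 ij.2|).
Qed.

Lemma norm_rV_le (R : realType) (n : nat) (x : 'rV[R]_n) (r : R) :
  0 <= r -> (forall i, `|x 0 i| <= r) -> `|x| <= r.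
Proof.
move=> r0 xr; rewrite /Num.norm/= mx_normrE; apply/bigmax_leP; split => // -[i j] _.
by rewrite (ord1 i); exact: xr.
Qed.

(** Balls are taken in the sup norm, hence are cubes of side [2 * r]. *)
Lemma lebn_ball_le (R : realType) (n : nat) (x : 'rV[R]_n) (r : R) : 0 <= r ->
  (lebn R n (ball x r) <= ((2 * r) ^+ n)%:E)%E.
Proof.
move=> r0; pose a : 'rV[R]_n := x - const_mx r; pose b : 'rV[R]_n := x + const_mx r.
have ab i : a 0 i <= b 0 i by rewrite !mxE; lra.
apply: (@le_trans _ _ (leb_outer R n (box a b))).
  apply: le_outer_measure => y xy i; move/ball_rowP : xy => [_ /(_ i)].
  by rewrite ltr_distlC !mxE => /andP[? ?]; split => //; apply/ltW.
apply: (@le_trans _ _ (box_content (box a b))).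
  (* A single box becomes a countable cover once it is padded by empty sets. *)
  pose F k : set 'rV[R]_n := if k is O then box a b else set0.
  have -> : box_content (box a b) = (\sum_(k <oo) box_content (F k))%E.
    rewrite nneseries_recl//; last by move=> k _; exact: box_content_ge0.
    rewrite eseries0 ?adde0// => -[|k] _ _//; exact: box_content0.
  by apply: ereal_inf_lbound; exists F => //; split => // y ?; exists 0%N.
apply: le_trans (box_content_le ab) _.
rewrite lee_fin le_eqVlt; apply/orP; left; apply/eqP.
rewrite (eq_bigr (fun=> 2 * r)); first by rewrite prodr_const card_ord.
by move=> i _; rewrite !mxE; ring.
Qed.

Lemma halfspace_measurable (R : realType) (n : nat) (i : 'I_n) (s : R) :
  measurable ([set x : lebT R n | x 0 i < s]%R).
Proof. by apply: leb_outer_caratheodory => A; exact: box_content_splitD. Qed.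

Lemma coord_measurable (R : realType) (n : nat) (i : 'I_n) :
  measurable_fun setT (fun x : lebT R n => x 0 i).
Proof.
apply: (measurability _ (measurable_realfun.RGenInftyO.measurableE R)) => _ [_ [s ->] <-].
rewrite setTI; have -> : (fun x : lebT R n => x 0 i) @^-1` `]-oo, s[%classic =
  [set x : lebT R n | x 0 i < s]%R by apply/seteqP; split => x /=; rewrite in_itv.
exact: halfspace_measurable.
Qed.

Lemma ball_measurable (R : realType) (n : nat) (x : 'rV[R]_n) (r : R) :
  measurable (ball x r : set (lebT R n)).
Proof.
have [r0|r0] := leP r 0.
  rewrite (_ : ball x r = set0); first exact: measurable0.
  by rewrite -subset0 => y /ball_rowP[]; rewrite ltNge r0.
rewrite (_ : ball x r = \bigcap_(i in [set: 'I_n])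
   ((fun y : lebT R n => y 0 i) @^-1` `]x 0 i - r, x 0 i + r[%classic)).
  apply: fin_bigcap_measurable => // i _; rewrite -[X in measurable X]setTI.
  exact: coord_measurable.
apply/seteqP; split => y /=.
  by move=> /ball_rowP[_ xy] i _ /=; rewrite in_itv/= -ltr_distl distrC.
move=> xy; apply/ball_rowP; split => // i; have := xy i I.
by rewrite /= in_itv/= -ltr_distl distrC.
Qed.

Lemma rat_ball_cover (R : realType) (n : nat) (O : set 'rV[R]_n) (x : 'rV[R]_n) :
  open O -> O x -> exists (q : 'rV[rat]_n) (k : nat),
    ball (map_mx ratr q : 'rV[R]_n) k.+1%:R^-1 x /\
    ball (map_mx ratr q : 'rV[R]_n) k.+1%:R^-1 `<=` O.
Proof.
move=> oO Ox; have /nbhs_ballP[e /= e0 xO] := open_nbhs_nbhs (conj oO Ox).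
have [k ke] : exists k, (k.+1%:R^-1 : R) < e / 2.
  exists (Num.truncn (e / 2)^-1); rewrite -[ltRHS]invrK ltf_pV2 ?posrE ?invr_gt0 ?divr_gt0//.
  by rewrite truncnS_gt.
have /(_ _)/cid P i : exists q : rat, `|x 0 i - ratr q| < k.+1%:R^-1.
  have [q] : exists q : rat, ratr q \in `]x 0 i - k.+1%:R^-1, x 0 i + k.+1%:R^-1[.
    by apply: rat_in_itvoo; rewrite ltrBlDr -addrA ltrDl addr_gt0.
  by rewrite in_itv/= -ltr_distl distrC => ?; exists q.
pose q : 'rV[rat]_n := \row_i sval (P i).
have qx : ball (map_mx ratr q : 'rV[R]_n) k.+1%:R^-1 x.
  apply/ball_rowP; split => // i.
  by rewrite !mxE distrC; exact: (svalP (P i)).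
exists q, k; split => // y qy; apply: xO.
have xq : ball x (e / 2) (map_mx ratr q : 'rV[R]_n).
  by apply: ball_sym; apply: le_ball qx; exact: ltW.
have qy' : ball (map_mx ratr q : 'rV[R]_n) (e / 2) y.
  by apply: le_ball qy; exact: ltW.
by have := ball_triangle xq qy'; rewrite -splitr.
Qed.

(** Second countability through balls with rational centre and radius [1 / (k + 1)]. Indices whose
    ball lies in no set with property [P] get radius 0, that is, the empty ball. [P] serves both for
    the measurability of open sets and for unions of null open sets. *)
Lemma lindelof_balls (R : realType) (n : nat) (P : set 'rV[R]_n -> Prop)
    (O : set 'rV[R]_n) :
  (forall x, O x -> exists V, [/\ open V, V x & P V]) ->
  exists F : nat -> 'rV[R]_n * R,
    O `<=` \bigcup_k ball (F k).1 (F k).2 /\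
    forall k, 0 < (F k).2 -> exists2 V, P V & ball (F k).1 (F k).2 `<=` V.
Proof.
move=> OP; pose good (qk : 'rV[rat]_n * nat) := `[<exists2 V, P V &
  ball (map_mx ratr qk.1 : 'rV[R]_n) qk.2.+1%:R^-1 `<=` V>].
exists (fun j => if unpickle j is Some qk then
  (map_mx ratr qk.1, if good qk then qk.2.+1%:R^-1 else 0) else (0, 0)); split.
  move=> x /OP[V [oV Vx PV]]; have [q [k [qx qV]]] := rat_ball_cover oV Vx.
  exists (pickle (q, k)) => //=; rewrite pickleK /= /good asboolT//.
  by exists V.
move=> j; case: unpickle => [[q k]|] /=; last by rewrite ltxx.
by case: ifPn => [/asboolP|]; rewrite ?ltxx.
Qed.

Lemma open_lebmeasurable (R : realType) (n : nat) (O : set 'rV[R]_n) :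
  open O -> measurable (O : set (lebT R n)).
Proof.
move=> oO; have [F [OF Fsub]] := @lindelof_balls R n (eq O) O
  (fun x Ox => ex_intro _ O (And3 oO Ox erefl)).
rewrite (_ : O = \bigcup_k ball (F k).1 (F k).2).
  by apply: bigcupT_measurable => k; exact: ball_measurable.
apply/seteqP; split => // x [k _ Fx].
have [|V <-] := Fsub k; last exact.
by have /ball_rowP[] := Fx.
Qed.

Lemma closed_lebmeasurable (R : realType) (n : nat) (O : set 'rV[R]_n) :
  closed O -> measurable (O : set (lebT R n)).
Proof.
move=> cO; rewrite -(setCK O); apply: measurableC.
by apply: open_lebmeasurable; exact: closed_openC.
Qed.

Lemma leb_shift_measurable (R : realType) (n : nat) (a : 'rV[R]_n) :
  measurable_fun setT (fun x : lebT R n => (x + a : lebT R n)%R).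
Proof.
move=> _ A mA; rewrite setTI.
have {}mA : (leb_outer R n).-caratheodory A := mA.
suff : (leb_outer R n).-caratheodory [set x | A (x + a)]%R by [].
move=> X; rewrite -(leb_outer_shift (- a) X) mA.
rewrite -(leb_outer_shift (- a) (X `&` [set x | A (x + a)]%R)).
rewrite -(leb_outer_shift (- a) (X `&` ~` [set x | A (x + a)]%R)).
by congr (_ + _)%E; apply: f_equal; apply/seteqP; split => x /=; rewrite subrK.
Qed.

(** * Measure-preserving maps and unimodal sequences *)

Lemma ge0_integral_invariant d (T : measurableType d) (R : realType)
    (mu : {measure set T -> \bar R}) (h : T -> T) (f : T -> \bar R) :
  measurable_fun setT h -> (forall A, mu (h @^-1` A) = mu A) ->
  measurable_fun setT f -> (forall x, 0 <= f x)%E ->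
  (\int[mu]_x f (h x) = \int[mu]_x f x)%E.
Proof.
move=> mh muh mf f0; transitivity (\int[pushforward mu h]_x f x)%E.
  by rewrite ge0_integral_pushforward.
(* Since invariance is assumed on all sets, the pushforward and [mu] are equal as functions. *)
by congr (integral _ setT f); apply/funext => A; exact: muh.
Qed.

Lemma ge0_integral_shift (R : realType) (n : nat) (a : 'rV[R]_n) (f : lebT R n -> \bar R) :
  measurable_fun setT f -> (forall x, 0 <= f x)%E ->
  (\int[lebn R n]_x f (x + a)%R = \int[lebn R n]_x f x)%E.
Proof.
exact: (@ge0_integral_invariant _ _ _ (lebn R n) _ f (leb_shift_measurable a)
  (leb_outer_shift a)).
Qed.

(** Such a sequence cannot rise again after a fall, so its upward increments telescope to the
    running maximum. *)
Lemma unimodal_variation (R : realType) (u : nat -> R) :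
  (forall i j k, (i <= j <= k)%N -> Num.min (u i) (u k) <= u j) ->
  forall j, exists i, [/\ (i <= j)%N, forall l, (l <= j)%N -> u l <= u i &
    u 0%N + \sum_(l < j) Num.max (u l.+1 - u l) 0 = u i].
Proof.
move=> uni; elim=> [|j [i [ij umax usum]]].
  by exists 0%N; split => // [l|]; rewrite ?leqn0 ?big_ord0 ?addr0// => /eqP ->.
rewrite big_ord_recr/= addrA usum; have [ujj|ujj] := leP (u j.+1) (u j).
  exists i; split; first exact: leq_trans ij _.
    move=> l; rewrite leq_eqVlt => /predU1P[->|]; last exact: umax.
    exact: le_trans ujj (umax j _).
  by rewrite max_r ?addr0// subr_le0.
(* A rise after [j] forces [u j] to be the running maximum already: otherwise [u j] would lie
   strictly below both [u i] and [u j.+1]. *)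
have uij : u i = u j.
  apply/eqP; rewrite eq_le umax// andbT.
  by have := uni i j j.+1; rewrite ij leqnSn ge_min (leNgt (u j.+1)) ujj orbF => ->.
exists j.+1; split => // [l|].
  rewrite leq_eqVlt => /predU1P[->//|/umax ul].
  by rewrite (le_trans ul)// uij ltW.
by rewrite uij max_l ?subr_ge0 ?ltW// addrC subrK.
Qed.

Lemma ge0_integral_iter d (T : measurableType d) (R : realType)
    (mu : {measure set T -> \bar R}) (h : T -> T) (f : T -> \bar R) (j : nat) :
  measurable_fun setT h -> (forall A, mu (h @^-1` A) = mu A) ->
  measurable_fun setT f -> (forall x, 0 <= f x)%E ->
  measurable_fun setT (f \o iter j h) /\
  (\int[mu]_x f (iter j h x) = \int[mu]_x f x)%E.
Proof.
move=> mh muh mf f0; elim: j => [//|j [mj IH]]; split.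
  rewrite (_ : f \o iter j.+1 h = (f \o iter j h) \o h).
    exact: measurableT_comp.
  by apply/funext => x /=; rewrite -iterS iterSr.
rewrite -IH -(ge0_integral_invariant mh muh mj) => [|x]; last exact: f0.
by apply: eq_integral => x _; rewrite iterSr.
Qed.

(* For a unimodal sequence the sum of the upward increments is at most the maximum; summing
   along orbits of a measure-preserving map makes all increments have the same integral. *)
Lemma unimodal_orbit_integral d (T : measurableType d) (R : realType)
    (mu : {measure set T -> \bar R}) (h : T -> T) (f : T -> R) (B : T -> \bar R) (K : nat) :
  measurable_fun setT h -> (forall A, mu (h @^-1` A) = mu A) ->
  measurable_fun setT f -> (forall x, 0 <= f x) ->
  (forall x i j k, (i <= j <= k)%N ->
     Num.min (f (iter i h x)) (f (iter k h x)) <= f (iter j h x)) ->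
  measurable_fun setT B -> (forall x i, (i <= K)%N -> (f (iter i h x))%:E <= B x)%E ->
  (K%:R%:E * \int[mu]_x (Num.max (f (h x) - f x) 0)%:E <= \int[mu]_x B x)%E.
Proof.
move=> mh muh mf f0 uni mB fB.
pose g x := (Num.max (f (h x) - f x) 0)%:E.
have mg : measurable_fun setT g.
  apply/measurable_EFinP; apply: measurable_maxr => //.
  by apply: measurable_funB => //; exact: measurableT_comp.
have g0 x : (0 <= g x)%E by rewrite lee_fin le_max lexx orbT.
have giter j := ge0_integral_iter j mh muh mg g0.
apply: (@le_trans _ _ (\int[mu]_x \sum_(j < K) g (iter j h x))%E).
  rewrite ge0_integral_sum//; last first.
    by move=> j; have [] := giter j.
  rewrite (eq_bigr (fun=> \int[mu]_x g x)%E); last first.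
    by move=> j _; have [] := giter j.
  elim: K {fB} => [|K IH]; first by rewrite mul0e big_ord0.
  rewrite big_ord_recr/= -natr1 EFinD ge0_muleDl ?lee_fin// mul1e.
  by apply: leeD.
apply: ge0_le_integral => //.
- by move=> x _; exact: sume_ge0.
- by apply: emeasurable_sum => j; have [] := giter j.
- move=> x _; have [i [iK _ usum]] := unimodal_variation (uni x) K.
  apply: le_trans (fB x i iK); rewrite sumEFin lee_fin -usum lerDr.
  exact: f0.
Qed.

Lemma ge0_integral_EFinD d (T : measurableType d) (R : realType)
    (mu : {measure set T -> \bar R}) (a b : T -> R) :
  measurable_fun setT a -> measurable_fun setT b ->
  (forall x, 0 <= a x) -> (forall x, 0 <= b x) ->
  (\int[mu]_x (a x + b x)%:E = \int[mu]_x (a x)%:E + \int[mu]_x (b x)%:E)%E.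
Proof.
move=> ma mb a0 b0; under eq_integral do rewrite EFinD.
by rewrite ge0_integralD// => *; rewrite ?lee_fin//; exact/measurable_EFinP.
Qed.

Lemma ge0_le_integral_EFin d (T : measurableType d) (R : realType)
    (mu : {measure set T -> \bar R}) (a b : T -> R) :
  measurable_fun setT a -> measurable_fun setT b ->
  (forall x, 0 <= a x) -> (forall x, a x <= b x) ->
  (\int[mu]_x (a x)%:E <= \int[mu]_x (b x)%:E)%E.
Proof.
by move=> ma mb a0 ab; apply: ge0_le_integral => // *; rewrite ?lee_fin//;
  exact/measurable_EFinP.
Qed.

Lemma fatou_le d (T : measurableType d) (R : realType)
    (mu : {measure set T -> \bar R}) (F : nat -> T -> \bar R) (f : T -> \bar R)
    (e : \bar R) :
  (forall k, measurable_fun setT (F k)) -> (forall k x, 0 <= F k x)%E ->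
  (forall x, F k x @[k --> \oo] --> f x) ->
  (exists k0, forall k, (k0 <= k)%N -> (\int[mu]_x F k x <= e)%E) ->
  (\int[mu]_x f x <= e)%E.
Proof.
move=> mF F0 Ff [k0 Fe].
have := @fatou _ _ _ mu setT measurableT (fun k => F (k + k0)%N)
  (fun k => mF _) (fun k x _ => F0 _ x).
have -> : (\int[mu]_x limn_einf (fun k => F (k + k0)%N x) = \int[mu]_x f x)%E.
  apply: eq_integral => x _.
  have Fx : F (k + k0)%N x @[k --> \oo] --> f x.
    by rewrite (cvg_shiftn k0 (F ^~ x)).
  rewrite is_cvg_limn_einfE; last by apply/cvg_ex; exists (f x).
  exact: cvg_lim.
move=> /le_trans; apply; rewrite limn_einf_lim.
apply: lime_le; first exact: is_cvg_einfs.
apply: nearW => k; apply: (@le_trans _ _ (\int[mu]_x F (k + k0)%N x)%E).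
  by apply: ereal_inf_lbound; exists k => /=.
by apply: Fe; rewrite leq_addl.
Qed.

(** * Truncation and convergence in L^1 *)

Definition clamp (R : realType) (g y : R) := Num.max (- g) (Num.min g y).

(** The part of [|y|] above the level [g]. A small integral of it, uniformly along a sequence and
    with [g] integrable, expresses uniform integrability. *)
Definition excess (R : realType) (g y : R) := Num.max (`|y| - g) 0.

Lemma clamp_excess (R : realType) (g y : R) : 0 <= g ->
  `|y - clamp g y| = excess g y.
Proof.
rewrite /clamp /excess => g0.
have [y0|y0] := lerP 0 y; [rewrite (ger0_norm y0)|rewrite (ltr0_norm y0)].
  rewrite (@max_r _ _ (- g)); last by rewrite le_min; apply/andP; split; lra.
  by have [gy|gy] := leP g y; [rewrite max_l|rewrite max_r]; rewrite ?ger0_norm; lra.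
rewrite (@min_r _ _ g); last lra.
by have [gy|gy] := leP (- g) y; [rewrite max_r|rewrite max_l];
  rewrite ?subrr ?normr0 ?ltr0_norm; lra.
Qed.

Lemma clamp_le (R : realType) (g y : R) : 0 <= g -> `|clamp g y| <= g.
Proof.
move=> g0; rewrite ler_norml /clamp le_max lexx ge_max ge_min lexx /= andbT; lra.
Qed.

Lemma cvg_nonexpansive (R : realType) (phi : R -> R) (u : nat -> R) (l : R) :
  (forall y z, `|phi y - phi z| <= `|y - z|) ->
  u k @[k --> \oo] --> l -> phi (u k) @[k --> \oo] --> phi l.
Proof.
move=> lip /cvgrPdist_lt ul; apply/cvgrPdist_lt => e /ul; apply: filterS => k.
exact: le_lt_trans.
Qed.

Lemma nonexpansive_minr (R : realType) (c y z : R) :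
  `|Num.min c y - Num.min c z| <= `|y - z|.
Proof.
have h1 := ler_norm (y - z); have := ler_norm (z - y); rewrite distrC => h2.
by rewrite ler_norml; have [? | ?] := leP c y; have [? | ?] := leP c z; lra.
Qed.

Lemma nonexpansive_maxr (R : realType) (c y z : R) :
  `|Num.max c y - Num.max c z| <= `|y - z|.
Proof.
have h1 := ler_norm (y - z); have := ler_norm (z - y); rewrite distrC => h2.
by rewrite ler_norml; have [? | ?] := leP c y; have [? | ?] := leP c z; lra.
Qed.

Lemma nonexpansive_clamp (R : realType) (g y z : R) :
  `|clamp g y - clamp g z| <= `|y - z|.
Proof. exact: le_trans (nonexpansive_maxr _ _ _) (nonexpansive_minr _ _ _). Qed.

Lemma nonexpansive_excess (R : realType) (g y z : R) :
  `|excess g y - excess g z| <= `|y - z|.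
Proof.
rewrite /excess !(maxC _ 0); apply: le_trans (nonexpansive_maxr _ _ _) _.
by rewrite opprB addrA addrNK ler_dist_dist.
Qed.

Lemma excess_ge0 (R : realType) (g y : R) : 0 <= excess g y.
Proof. by rewrite /excess le_max lexx orbT. Qed.

Lemma measurable_excess d (T : measurableType d) (R : realType) (g y : T -> R) :
  measurable_fun setT g -> measurable_fun setT y ->
  measurable_fun setT (fun x => excess (g x) (y x)).
Proof.
move=> mg my; apply: measurable_maxr => //; apply: measurable_funB => //.
exact: measurableT_comp.
Qed.

Lemma measurable_clamp d (T : measurableType d) (R : realType) (g y : T -> R) :
  measurable_fun setT g -> measurable_fun setT y ->
  measurable_fun setT (fun x => clamp (g x) (y x)).
Proof.
move=> mg my; apply: measurable_maxr; last exact: measurable_minr.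
exact: measurableT_comp.
Qed.

(* Vitali-type convergence: the excess over a fixed integrable function is uniformly small,
   and the clamped sequence converges by domination. *)
Lemma excess_cvg_L1 d (T : measurableType d) (R : realType)
    (mu : {measure set T -> \bar R}) (U : set T) (D : nat -> T -> R) (G : T -> R) :
  measurable U ->
  (forall k, measurable_fun setT (D k)) -> measurable_fun setT G ->
  (forall x, U x -> D k x @[k --> \oo] --> G x) -> (forall x, ~ U x -> G x = 0) ->
  (forall e : R, 0 < e -> exists g : T -> R, [/\ measurable_fun setT g,
     (forall x, 0 <= g x), (forall x, ~ U x -> g x = 0),
     (\int[mu]_x (g x)%:E < +oo)%E &
     exists k0, forall k, (k0 <= k)%N ->
       (\int[mu]_x (excess (g x) (D k x))%:E <= e%:E)%E]) ->
  (\int[mu]_x `|G x|%:E < +oo)%E /\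
  forall e : R, 0 < e -> exists k0, forall k, (k0 <= k)%N ->
    (\int[mu]_x `|D k x - G x|%:E <= e%:E)%E.
Proof.
move=> mU mD mG DG G0 UI.
(* Fatou passes the excess bound to the limit. Convergence is known on [U] only, so the sequence is
   cut off outside [U], where [g] and [G] vanish. *)
have fatouG (e : R) (g : T -> R) : measurable_fun setT g -> (forall x, 0 <= g x) ->
    (forall x, ~ U x -> g x = 0) ->
    (exists k0, forall k, (k0 <= k)%N ->
       (\int[mu]_x (excess (g x) (D k x))%:E <= e%:E)%E) ->
    (\int[mu]_x (excess (g x) (G x))%:E <= e%:E)%E.
  move=> mg g0 gU [k0 ge].
  pose F k x := if x \in U then (excess (g x) (D k x))%:E else 0%E.
  have mE k : measurable_fun setT (fun x => (excess (g x) (D k x))%:E).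
    by apply/measurable_EFinP; exact: measurable_excess.
  have mF k : measurable_fun setT (F k).
    by apply/(measurable_restrictT _ mU); exact: measurable_funTS.
  apply: (@fatou_le _ _ _ mu F).
  - exact: mF.
  - by move=> k x; rewrite /F; case: ifP => // _; rewrite lee_fin excess_ge0.
  - move=> x; have [Ux|nUx] := pselect (U x).
      have -> : F ^~ x = fun k => (excess (g x) (D k x))%:E.
        by apply/funext => k; rewrite /F mem_set.
      apply: cvg_EFin; first exact: nearW.
      by apply: cvg_nonexpansive (DG _ Ux); exact: nonexpansive_excess.
    have -> : F ^~ x = fun=> 0%E by apply/funext => k; rewrite /F memNset.
    by rewrite G0// gU// /excess normr0 subr0 maxxx; exact: cvg_cst.
  - exists k0 => k /ge; apply: le_trans; apply: ge0_le_integral => //.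
    + by move=> x _; rewrite /F; case: ifP => // _; rewrite lee_fin excess_ge0.
    + by move=> x _; rewrite /F; case: ifP => // _; rewrite lee_fin excess_ge0.
have normE (y g : R) : 0 <= g -> `|y| <= g + excess g y.
  by move=> g0; rewrite /excess; case: (leP (`|y| - g) 0); lra.
have mN (f : T -> R) : measurable_fun setT f -> measurable_fun setT (fun x => `|f x|%:E).
  by move=> mf; apply/measurable_EFinP; exact: measurableT_comp.
have mE (g f : T -> R) : measurable_fun setT g -> measurable_fun setT f ->
    measurable_fun setT (fun x => (excess (g x) (f x))%:E).
  by move=> mg mf; apply/measurable_EFinP; exact: measurable_excess.
have mE' (g f : T -> R) : measurable_fun setT g -> measurable_fun setT f ->
    measurable_fun setT (fun x => excess (g x) (f x)).
  by move=> mg mf; exact: measurable_excess.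
have mN' (f : T -> R) : measurable_fun setT f -> measurable_fun setT (fun x => `|f x|).
  by move=> mf; exact: measurableT_comp.
split.
  have [g [mg g0 gU goo /(fatouG 1 g mg g0 gU) Ge]] := UI 1 ltr01.
  apply: (@le_lt_trans _ _ (\int[mu]_x (g x + excess (g x) (G x))%:E)%E).
    apply: ge0_le_integral_EFin => // [||x]; last exact: normE.
      exact: mN'.
    by apply: measurable_funD => //; exact: mE'.
  rewrite ge0_integral_EFinD//; last by move=> x; exact: excess_ge0.
    by rewrite lte_add_pinfty// (le_lt_trans Ge)// ltry.
  exact: mE'.
move=> e e0; have e3 : 0 < e / 3 by lra.
have [g [mg g0 gU goo gUI]] := UI _ e3.
have Ge := fatouG _ g mg g0 gU gUI.
(* Outside [U] both clamps are to the level 0, so the cut-off changes no value and makes the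
   convergence there trivial. *)
pose h k x := if x \in U then clamp (g x) (D k x) - clamp (g x) (G x) else 0.
have hE k x : h k x = clamp (g x) (D k x) - clamp (g x) (G x).
  rewrite /h; case: ifPn => // /negP nUx.
  have nU : ~ U x by move=> Ux; apply: nUx; rewrite in_setE.
  by rewrite gU// /clamp oppr0 !max_l ?subrr// ge_min lexx.
have mh k : measurable_fun setT (h k).
  rewrite (_ : h k = fun x => clamp (g x) (D k x) - clamp (g x) (G x)); last exact/funext/hE.
  by apply: measurable_funB; exact: measurable_clamp.
have hg k x : (`| `|h k x|%:E | <= (2 * g x)%:E)%E.
  rewrite /= lee_fin normr_id hE; apply: le_trans (ler_normB _ _) _.
  by rewrite mulr_natl mulr2n lerD// clamp_le.
have h0 x : `|h k x|%:E @[k --> \oo] --> (cst 0%E : T -> \bar R) x.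
  apply: cvg_EFin; first exact: nearW.
  rewrite -[X in _ --> X](@normr0 _ R); apply: cvg_norm.
  have [Ux|nUx] := pselect (U x); last first.
    have -> : h ^~ x = fun=> 0 by apply/funext => k; rewrite /h memNset.
    exact: cvg_cst.
  have -> : h ^~ x = fun k => clamp (g x) (D k x) - clamp (g x) (G x).
    by apply/funext => k; exact: hE.
  rewrite -[X in _ --> X](subrr (clamp (g x) (G x))); apply: cvgB; last exact: cvg_cst.
  by apply: cvg_nonexpansive (DG _ Ux); exact: nonexpansive_clamp.
have g2 : mu.-integrable setT (fun x => (2 * g x)%:E).
  apply/integrableP; split; first exact/measurable_EFinP/measurable_funM.
  under eq_integral do rewrite /= ger0_norm ?mulr_ge0// EFinM.
  rewrite ge0_integralZl//; last by move=> x _; rewrite lee_fin.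
    by rewrite lte_mul_pinfty.
  exact/measurable_EFinP.
have [_ hcvg _] := @dominated_convergence _ _ _ mu setT measurableT
  (fun k x => `|h k x|%:E) (cst 0%E) (fun x => (2 * g x)%:E)
  (fun k => mN _ (mh k)) (measurable_cst _)
  (aeW _ (fun x _ => h0 x)) g2 (aeW _ (fun x k _ => hg k x)).
have [k0 Dg] := gUI.
have N0 : nbhs (0%E : \bar R) [set y : \bar R | (y < (e / 3)%:E)%E].
  by apply: open_nbhs_nbhs; split; [exact: open_ereal_lt_ereal|rewrite /= lte_fin].
have [k1 _ hk1] := hcvg _ N0.
exists (maxn k0 k1) => k; rewrite geq_max => /andP[/Dg k0k /hk1 /ltW k1k].
have {}k1k : (\int[mu]_x `|h k x|%:E <= (e / 3)%:E)%E.
  apply: le_trans k1k; rewrite le_eqVlt; apply/orP; left; apply/eqP.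
  by apply: eq_integral => x _; rewrite /= ?oppr0 ?addr0 normr_id.
(* Three errors of size [e / 3]: the two excesses and the difference of the clamped functions. *)
apply: (@le_trans _ _ (\int[mu]_x (excess (g x) (D k x) + excess (g x) (G x)
   + `|h k x|)%:E)%E).
  apply: ge0_le_integral_EFin => // [||x].
  - by apply: mN'; apply: measurable_funB.
  - by apply: measurable_funD; [apply: measurable_funD; exact: mE'|exact: mN'].
  - rewrite hE -(clamp_excess (D k x) (g0 x)) -(clamp_excess (G x) (g0 x)).
    rewrite [leLHS](_ : _ = `|(D k x - clamp (g x) (D k x)) + - (G x - clamp (g x) (G x)) +
      (clamp (g x) (D k x) - clamp (g x) (G x))|); last by congr `|_|; ring.
    apply: le_trans (ler_normD _ _) _; rewrite lerD2r.
    by apply: le_trans (ler_normD _ _) _; rewrite normrN.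
rewrite ge0_integral_EFinD//; first last.
- by move=> x; rewrite addr_ge0 ?excess_ge0.
- exact: mN'.
- by apply: measurable_funD; exact: mE'.
rewrite ge0_integral_EFinD//; try exact: mE'; try by move=> x; exact: excess_ge0.
rewrite (_ : e = e / 3 + e / 3 + e / 3); last lra.
by rewrite !EFinD; apply: leeD => //; apply: leeD.
Qed.

(** * Convexity inequalities with real bounds *)

Lemma epi_convex (R : realType) (n : nat) (phi : 'rV[R]_n -> \bar R) (x y : 'rV[R]_n)
    (r s t : R) : convex_efun phi -> 0 <= t -> t <= 1 ->
  (phi x <= r%:E -> phi y <= s%:E ->
   phi ((1 - t) *: x + t *: y)%R <= ((1 - t) * r + t * s)%:E)%E.
Proof.
(* Real upper bounds avoid products of 0 with +oo, so the endpoints [t = 0] and [t = 1], which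
   [convex_efun] leaves out, can be included. *)
move=> cphi; rewrite le_eqVlt => /predU1P[<- _ xr ys|t0].
  by rewrite subr0 !scale1r !scale0r mul1r mul0r !addr0.
rewrite le_eqVlt => /predU1P[-> xr ys|t1 xr ys].
  by rewrite subrr !scale1r !scale0r mul1r mul0r !add0r.
apply: le_trans (cphi _ _ _ t0 t1) _; rewrite [leRHS]EFinD !EFinM.
by apply: leeD; apply: lee_wpmul2l => //; rewrite lee_fin; lra.
Qed.

Lemma epi_jensen (R : realType) (n : nat) (phi : 'rV[R]_n -> \bar R)
    (y : nat -> 'rV[R]_n) (r : nat -> R) (k : nat) : convex_efun phi ->
  (forall i, (i < k.+1)%N -> (phi (y i) <= (r i)%:E)%E) ->
  (phi (k.+1%:R^-1 *: \sum_(i < k.+1) y i)%R <= (k.+1%:R^-1 * \sum_(i < k.+1) r i)%:E)%E.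
Proof.
move=> cphi; elim: k => [|k IH] yr.
  by rewrite !big_ord1 invr1 scale1r mul1r yr.
have {}IH : (phi (k.+1%:R^-1 *: \sum_(i < k.+1) y i)%R <=
    (k.+1%:R^-1 * \sum_(i < k.+1) r i)%:E)%E.
  by apply: IH => i ik; apply: yr; exact: ltnW.
have t0 : 0 <= (k.+2%:R^-1 : R) by rewrite invr_ge0.
have t1 : (k.+2%:R^-1 : R) <= 1 by rewrite invf_le1// ler1n.
have := epi_convex cphi t0 t1 IH (yr k.+1 (ltnSn _)).
have E : (1 - k.+2%:R^-1) * k.+1%:R^-1 = k.+2%:R^-1 :> R.
  have k0 : (k.+1%:R : R) != 0 by rewrite pnatr_eq0.
  have k2 : (k.+2%:R : R) != 0 by rewrite pnatr_eq0.
  by apply: (mulfI k2); rewrite mulrA mulrBr mulr1 !divff// -{1}(@natr1 R k.+1) addrK divff.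
by rewrite scalerA mulrA E -scalerDr -mulrDr !(big_ord_recr k.+1).
Qed.

Lemma convex_line (R : realType) (n : nat) (phi : 'rV[R]_n -> \bar R) (z v : 'rV[R]_n)
    (r s t tau : R) : convex_efun phi -> 0 <= t -> t <= tau -> 0 < tau ->
  (phi z <= r%:E -> phi (z + tau *: v)%R <= s%:E ->
   phi (z + t *: v)%R <= (r + t / tau * (s - r))%:E)%E.
Proof.
move=> cphi t0 tt tau0 zr zs.
have h0 : 0 <= t / tau by rewrite divr_ge0// ltW.
have h1 : t / tau <= 1 by rewrite ler_pdivrMr// mul1r.
have := epi_convex cphi h0 h1 zr zs.
rewrite (_ : (1 - t / tau) *: z + _ = z + t *: v).
  by rewrite (_ : (1 - t / tau) * r + _ = r + t / tau * (s - r)) //; ring.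
rewrite scalerDr addrA -scalerDl scalerA subrK scale1r.
by rewrite divfK// gt_eqF.
Qed.

(** * Convex functions in the interior of their domain *)

Section convex_interior.
Variables (R : realType) (m : nat).
Local Notation V := 'rV[R]_m.+1.
Variable phi : V -> \bar R.
Hypotheses (cphi : convex_efun phi) (phi0 : forall x, (0 <= phi x)%E).
Local Notation U := (interior (edom phi)).
Local Notation F := (fun y => fine (phi y)).

Lemma phi_fineK x : edom phi x -> (F x)%:E = phi x.
Proof.
by move=> xoo; rewrite fineK// fin_numE -ltey xoo andbT gt_eqF// (lt_le_trans _ (phi0 x)).
Qed.

Lemma interior_edom x : U x -> edom phi x.
Proof. exact: interior_subset. Qed.

(** The displacement [z] is the mean of its coordinate displacements stretched by [m.+1]. Bounds on
    the coordinate axes through [x] thus extend to a full neighbourhood; the stretch explains the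
    divisions by [m.+1] below. *)
Lemma average_coord (x z : V) :
  x + z = m.+1%:R^-1 *: \sum_(i < m.+1) (x + (m.+1%:R * z 0 i) *: delta_mx 0 i).
Proof.
rewrite big_split/= sumr_const card_ord scalerDr -[x *+ _]scaler_nat scalerA.
rewrite mulVf ?pnatr_eq0// scale1r; congr (_ + _).
rewrite [LHS]row_sum_delta scaler_sumr; apply: eq_bigr => i _.
by rewrite scalerA mulrA mulVf ?pnatr_eq0// mul1r.
Qed.

Lemma jensen_coord (x z : V) (r : 'I_m.+1 -> R) :
  (forall i, phi (x + (m.+1%:R * z 0 i) *: delta_mx 0 i)%R <= (r i)%:E)%E ->
  (phi (x + z)%R <= (m.+1%:R^-1 * \sum_i r i)%:E)%E.
Proof.
move=> h; rewrite average_coord.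
have := @epi_jensen R _ phi
  (fun k => x + (m.+1%:R * z 0 (inord k)) *: delta_mx 0 (inord k)) (fun k => r (inord k)) m cphi.
rewrite (eq_bigr (fun i => x + (m.+1%:R * z 0 i) *: delta_mx 0 i)); last first.
  by move=> i _; rewrite inord_val.
rewrite (eq_bigr r); last by move=> i _; rewrite inord_val.
by apply => i _; exact: h.
Qed.

Lemma convex_locally_bounded x : U x ->
  exists d B : R, [/\ 0 < d, 0 <= B & forall y, `|y - x| < d -> (phi y <= B%:E)%E].
Proof.
move=> Ux; have /nbhs_ballP[d0 /= d00 xd0] := Ux.
have dn (i : 'I_m.+1) : `|delta_mx 0 i : V| <= 1.
  by apply: norm_rV_le => // j; rewrite mxE eqxx/=; case: (_ == _); rewrite ?normr1 ?normr0.
pose d := d0 / 2; have d_gt0 : 0 < d by rewrite /d; lra.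
have ed (i : 'I_m.+1) (s : R) : `|s| <= d -> edom phi (x + s *: delta_mx 0 i).
  move=> sd; apply: xd0; apply/ball_normP; rewrite opprD addNKr normrN normrZ.
  have : `|s| * `|delta_mx 0 i : V| <= d * 1 by apply: ler_pM.
  by rewrite mulr1 /d; lra.
have Fge0 y : 0 <= F y by rewrite fine_ge0.
(* A sum of nonnegative values is a common bound at the centre and at both ends of the segment. *)
pose b i := F x + F (x + d *: delta_mx 0 i) + F (x + (- d) *: delta_mx 0 i).
have b0 i : 0 <= b i by rewrite !addr_ge0.
have line (i : 'I_m.+1) (s : R) : `|s| <= d -> (phi (x + s *: delta_mx 0 i)%R <= (b i)%:E)%E.
  move=> sd; have [s0|s0] := lerP 0 s.
    have := @convex_line _ _ phi x (delta_mx 0 i) (b i) (b i) s d cphi s0 _ d_gt0.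
    rewrite subrr mulr0 addr0; apply; first by rewrite (le_trans (ler_norm _)).
      by rewrite -phi_fineK ?lee_fin /b -?addrA ?lerDl ?addr_ge0//; exact: interior_edom.
    rewrite -phi_fineK ?lee_fin; last by apply: ed; rewrite gtr0_norm.
    by rewrite /b addrAC lerDr addr_ge0.
  have s0' : 0 <= - s by lra.
  have := @convex_line _ _ phi x (- delta_mx 0 i) (b i) (b i) (- s) d cphi s0' _ d_gt0.
  rewrite subrr mulr0 addr0 !scalerN scaleNr opprK; apply.
  - by rewrite (le_trans (ler_norm _))// normrN.
  - by rewrite -phi_fineK ?lee_fin /b -?addrA ?lerDl ?addr_ge0//; exact: interior_edom.
  - rewrite -scaleNr -phi_fineK ?lee_fin; last by apply: ed; rewrite normrN gtr0_norm.
    by rewrite /b lerDr addr_ge0.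
exists (d / m.+1%:R), (m.+1%:R^-1 * \sum_i b i); split.
- by rewrite divr_gt0.
- by rewrite mulr_ge0 ?invr_ge0// sumr_ge0.
move=> y yx; rewrite -(subrK x y) addrC; apply: jensen_coord => i; apply: line.
rewrite normrM gtr0_norm ?ltr0n// mulrC -ler_pdivlMr ?ltr0n//.
by rewrite (le_trans (ler_norm_rV _ _))// ltW.
Qed.

(** The chord inequality without its term [- (t / tau) * F z], which nonnegativity of [phi] allows
    to drop: only an upper bound at the far end is required. *)
Lemma convex_slope_bound (z v : V) (t tau B : R) : 0 <= t -> t <= tau -> 0 < tau ->
  edom phi z -> (phi (z + tau *: v)%R <= B%:E)%E ->
  edom phi (z + t *: v) /\ F (z + t *: v) - F z <= t / tau * B.
Proof.
move=> t0 tt tau0 dz zB.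
have := @convex_line _ _ phi z v (F z) B t tau cphi t0 tt tau0 _ zB.
rewrite phi_fineK// => /(_ (lexx _)) h.
have d1 : edom phi (z + t *: v) by exact: le_lt_trans h (ltry _).
split=> //; move: h; rewrite -phi_fineK// lee_fin.
have : 0 <= t / tau * F z by rewrite mulr_ge0 ?fine_ge0// divr_ge0// ltW.
lra.
Qed.

(** Slopes along [v] and [- v] are bounded above on a smaller ball; the lower bound follows by going
    back from [y + t *: v] to [y]. *)
Lemma convex_locally_lipschitz x v : U x -> exists d L : R, [/\ 0 < d, 0 <= L &
  forall y t, `|y - x| < d -> `|t| < d ->
    U (y + t *: v) /\ `|F (y + t *: v) - F y| <= L * `|t| ].
Proof.
move=> Ux; have [d0 [B [d00 B0 phiB]]] := convex_locally_bounded Ux.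
(* The added 1 keeps [b] positive when [v = 0]; [tau] is such that [tau *: v] has norm at most
   [d0 / 4]. *)
pose b := `|v| + 1; have b0 : 0 < b by rewrite ltr_wpDl.
pose tau := d0 / (4 * b); have tau0 : 0 < tau by rewrite divr_gt0// mulr_gt0.
have tauv s : `|s| <= tau -> `|s *: v| <= d0 / 4.
  move=> st; rewrite normrZ (_ : d0 / 4 = tau * b).
    by apply: ler_pM => //; rewrite /b lerDl.
  by rewrite /tau; field; rewrite gt_eqF.
have Ud y : `|y - x| < d0 -> U y.
  move=> yx; have : \forall z \near y, ball x d0 z.
    apply: open_nbhs_nbhs; split; first exact: ball_open.
    by apply/ball_normP; rewrite distrC.
  apply: filterS => z /ball_normP; rewrite distrC => /phiB.
  by move=> /le_lt_trans; apply; rewrite ltry.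
have slope z w s : `|z - x| < d0 / 2 -> (w = v \/ w = - v) -> 0 <= s -> s <= tau ->
    F (z + s *: w) - F z <= s / tau * B.
  move=> zx wv s0 st; apply: (convex_slope_bound _ st tau0 _ _).2 => //.
    by apply: interior_edom; apply: Ud; lra.
  apply: phiB; rewrite -addrA addrC -addrA.
  have h : `|tau *: w| <= d0 / 4.
    have : `|tau *: v| <= d0 / 4 by apply: tauv; rewrite gtr0_norm.
    by case: wv => ->; rewrite // scalerN normrN.
  by have := ler_normD (tau *: w) (- x + z); rewrite [- x + z]addrC; lra.
have slope2 z s : `|z - x| < d0 / 2 -> `|s| <= tau ->
    F (z + s *: v) - F z <= `|s| / tau * B.
  move=> zx st; have [s0|s0] := lerP 0 s.
    by move: st; rewrite (ger0_norm s0) => st; apply: slope => //; left.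
  have := @slope z (- v) (- s) zx (or_intror erefl).
  rewrite (ltr0_norm s0) in st *; rewrite !scalerN scaleNr opprK.
  by apply => //; lra.
exists (Num.min (d0 / 4) tau), (B / tau); split.
- by rewrite lt_min tau0 andbT; lra.
- by rewrite divr_ge0// ltW.
move=> y t; rewrite !lt_min => /andP[yx _] /andP[_ tt].
have tv := tauv _ (ltW tt).
have ytx : `|y + t *: v - x| < d0 / 2.
  by rewrite addrAC; have := ler_normD (y - x) (t *: v); lra.
split; first by apply: Ud; lra.
rewrite ler_norml; apply/andP; split; last first.
  rewrite (_ : B / tau * `|t| = `|t| / tau * B); last by ring.
  by apply: slope2; [lra|exact: ltW].
have := @slope2 (y + t *: v) (- t) ytx _; rewrite normrN scaleNr addrK => /(_ (ltW tt)).
by rewrite (_ : B / tau * `|t| = `|t| / tau * B); [lra|ring].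
Qed.
End convex_interior.

(** * One-sided derivatives and differentiability of convex functions *)

Lemma dotv_linear (R : realType) (n : nat) (p : 'rV[R]_n) : linear (dotv p).
Proof.
move=> a u w; rewrite /dotv scaler_sumr -big_split/=; apply: eq_bigr => i _.
by rewrite !mxE mulrDr mulrCA.
Qed.

HB.instance Definition _ (R : realType) (n : nat) (p : 'rV[R]_n) :=
  GRing.isLinear.Build R 'rV[R]_n R _ (dotv p) (dotv_linear p).

Lemma dotv_norm_le (R : realType) (n : nat) (p z : 'rV[R]_n) :
  `|dotv p z| <= (\sum_i `|p 0 i|) * `|z|.
Proof.
apply: le_trans (ler_norm_sum _ _ _) _; rewrite mulr_suml; apply: ler_sum => i _.
by rewrite normrM ler_wpM2l// ler_norm_rV.
Qed.

Lemma dotv_continuous (R : realType) (n : nat) (p : 'rV[R]_n) : continuous (dotv p).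
Proof.
suff H (x : 'rV[R]_n) : dotv p @ x --> dotv p x by [].
apply/(@cvgrPdist_lt _ _ _ (nbhs_filter_on x)) => e e0; pose C := \sum_i `|p 0 i| + 1.
have C0 : 0 < C by rewrite ltr_wpDl// sumr_ge0.
have N : nbhs x (ball (x : 'rV[R]_n) (e / C)) by apply: nbhsx_ballx; rewrite divr_gt0.
apply: (@filterS _ (nbhs_filter_on x) _ _ _ _ N) => y /ball_normP xy; rewrite -linearB.
apply: le_lt_trans (dotv_norm_le _ _) _.
apply: (@le_lt_trans _ _ (C * `|x - y|)); first by rewrite ler_wpM2r// /C lerDl.
by rewrite mulrC -ltr_pdivlMr.
Qed.

Section directional_derivative.
Variables (R : realType) (m : nat).
Local Notation V := 'rV[R]_m.+1.
Variable phi : V -> \bar R.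
Hypotheses (cphi : convex_efun phi) (phi0 : forall x, (0 <= phi x)%E).
Local Notation U := (interior (edom phi)).
Local Notation F := (fun y => fine (phi y)).

(** The one-sided derivative phi'(x; v). The steps [1 / (k + 1)] suffice because convex quotients
    decrease with the step; for [x] in [U] the limit exists and is real. *)
Definition dirder (x v : V) : R :=
  lim (k.+1%:R * (F (x + k.+1%:R^-1 *: v) - F x) @[k --> \oo]).

Lemma convex_quotient_le (x v : V) (s t : R) : edom phi x -> 0 < s -> s <= t ->
  edom phi (x + t *: v) ->
  edom phi (x + s *: v) /\ (F (x + s *: v) - F x) / s <= (F (x + t *: v) - F x) / t.
Proof.
move=> dx s0 st dt; have t0 : 0 < t by lra.
have := @convex_line _ _ phi x v (F x) (F (x + t *: v)) s t cphi (ltW s0) st t0.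
rewrite !(phi_fineK phi0)// => /(_ (lexx _) (lexx _)) h.
have d1 : edom phi (x + s *: v) by exact: le_lt_trans h (ltry _).
split => //; move: h; rewrite -(phi_fineK phi0 d1) lee_fin => h.
rewrite ler_pdivrMr// (_ : _ / t * s = s / t * (F (x + t *: v) - F x)); last by ring.
lra.
Qed.

Lemma interior_line x v : U x -> exists2 d : R, 0 < d & forall t, `|t| < d -> edom phi (x + t *: v).
Proof.
move=> Ux; have [d [L [d0 L0 H]]] := convex_locally_lipschitz cphi phi0 v Ux.
exists d => // t td; apply: interior_edom.
by have [] := H x t _ td; rewrite ?subrr ?normr0.
Qed.

Lemma near_invS (d : R) : 0 < d -> \forall k \near \oo, (k.+1%:R^-1 : R) < d.
Proof.
move=> d0; exists (Num.truncn d^-1) => //= k /= dk.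
rewrite -[ltRHS]invrK ltf_pV2 ?posrE ?invr_gt0//.
by rewrite (lt_le_trans (truncnS_gt _))// ler_nat ltnS.
Qed.

Lemma dirder_cvg x v : U x ->
  k.+1%:R * (F (x + k.+1%:R^-1 *: v) - F x) @[k --> \oo] --> dirder x v.
Proof.
move=> Ux; have [d [L [d0 L0 H]]] := convex_locally_lipschitz cphi phi0 v Ux.
have xx : `|x - x| < d by rewrite subrr normr0.
have [N _ HN] := near_invS d0.
have invn (k : nat) : `|(k.+1%:R^-1 : R)| = k.+1%:R^-1 by rewrite ger0_norm.
pose u (k : nat) : R := k.+1%:R * (F (x + k.+1%:R^-1 *: v) - F x).
suff : cvgn (fun k => u (k + N)%N).
  by move=> /cvg_ex[l]; rewrite (cvg_shiftn N u) => ul; apply/cvg_ex; exists l.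
have Ninv k : (N <= k)%N -> `|(k.+1%:R^-1 : R)| < d by rewrite invn; exact: HN.
apply: nonincreasing_is_cvgn.
  apply/nonincreasing_seqP => k; rewrite /u.
  have [Uk _] := H x (k + N).+1%:R^-1 xx (Ninv _ (leq_addl _ _)).
  have ik : ((k.+1 + N).+1%:R^-1 : R) <= (k + N).+1%:R^-1.
    by rewrite lef_pV2 ?posrE ?ltr0n// ler_nat.
  have := (convex_quotient_le (interior_edom Ux) _ ik (interior_edom Uk)).2.
  by rewrite !invrK ![_ * (_ - _)]mulrC; apply; rewrite invr_gt0.
exists (- L) => _ [k _ <-]; rewrite /u.
have [_] := H x (k + N).+1%:R^-1 xx (Ninv _ (leq_addl _ _)).
rewrite invn ler_norml => /andP[h _].
by rewrite mulrC -ler_pdivrMr ?ltr0n// mulNr.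
Qed.

Lemma dirder_le x v t : U x -> 0 < t -> edom phi (x + t *: v) ->
  dirder x v <= (F (x + t *: v) - F x) / t.
Proof.
move=> Ux t0 dt; rewrite /dirder; apply: limr_le.
  by apply/cvg_ex; exists (dirder x v); exact: dirder_cvg.
apply: filterS (near_invS t0) => k kt.
have := (convex_quotient_le (interior_edom Ux) _ (ltW kt) dt).2.
by rewrite invrK mulrC; apply; rewrite invr_gt0.
Qed.

(** Monotonicity of the quotient turns the limit along [1 / (k + 1)] into an estimate for every
    small [t >= 0]. *)
Lemma dirder_approx x v e : U x -> 0 < e -> exists2 d : R, 0 < d &
  forall t, 0 <= t -> t < d -> edom phi (x + t *: v) /\
    t * dirder x v <= F (x + t *: v) - F x <= t * dirder x v + e * t.
Proof.
move=> Ux e0; have [d d0 Hd] := interior_line v Ux.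
have /cvgrPdist_lt /(_ _ e0) [N _ HN] := dirder_cvg (v := v) Ux.
have [N' _ HN'] := near_invS d0.
pose k := maxn N N'; exists (k.+1%:R^-1); first by rewrite invr_gt0.
move=> t; rewrite le_eqVlt => /predU1P[<- _|t0 tk].
  rewrite scale0r addr0 subrr mulr0 mul0r addr0 lexx.
  by split => //; exact: interior_edom.
have dk : edom phi (x + k.+1%:R^-1 *: v).
  by apply: Hd; rewrite ger0_norm//; apply: HN'; rewrite /= leq_max leqnn orbT.
have [dt qt] := convex_quotient_le (interior_edom Ux) t0 (ltW tk) dk.
split => //; have := dirder_le Ux t0 dt; rewrite ler_pdivlMr// mulrC => ->/=.
have := HN k (leq_maxl _ _); rewrite /= ltr_distlC => /andP[_ h].
move: qt; rewrite ler_pdivrMr// => /le_trans; apply.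
rewrite invrK [t * _]mulrC -mulrDl ler_wpM2r//; first exact: ltW.
by rewrite mulrC ltW.
Qed.

(** Symmetry gives a first-order upper bound on both sides along each axis. Averaging over the axes
    turns these into an upper bound for [F (x + z)], and convexity at the midpoint [x] of [x + z]
    and [x - z] turns the upper bound at [- z] into the lower bound at [z]. *)
Lemma directional_differentiable x : U x ->
  (forall i : 'I_m.+1, dirder x (- delta_mx 0 i) = - dirder x (delta_mx 0 i)) ->
  differentiable F x.
Proof.
move=> Ux sym; pose p : V := \row_i dirder x (delta_mx 0 i).
suff diffE : (F : V -> R^o) \o shift (x : V) =
    cst (F x : R^o) + (dotv p : V -> R^o) +o_ (0 : V) id.
  have dp := diff_unique (@dotv_continuous _ _ p) diffE.
  by apply/diff_locallyP; rewrite dp; split => //; exact: dotv_continuous.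
(* The averaging stretches each coordinate by [m.+1]; [e'] compensates for it. *)
apply/eqaddoP => e e0; pose e' := e / m.+1%:R.
have e'0 : 0 < e' by rewrite divr_gt0.
have coord (i : 'I_m.+1) : exists2 d : R, 0 < d & forall t, `|t| < d ->
    edom phi (x + t *: delta_mx 0 i) /\
    F (x + t *: delta_mx 0 i) <= F x + t * p 0 i + e' * `|t|.
  have [d1 d10 H1] := dirder_approx (delta_mx 0 i) Ux e'0.
  have [d2 d20 H2] := dirder_approx (- delta_mx 0 i) Ux e'0.
  exists (Num.min d1 d2); first by rewrite lt_min d10.
  move=> t; rewrite lt_min => /andP[t1 t2]; rewrite /p mxE.
  have [t0|t0] := lerP 0 t.
    rewrite (ger0_norm t0) in t1 *; have [dt /andP[_]] := H1 t t0 t1.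
    by rewrite lerBlDl addrA.
  rewrite (ltr0_norm t0) in t2 *; have t0' : 0 <= - t by lra.
  have := H2 _ t0' t2; rewrite sym !scalerN scaleNr opprK mulrNN => -[dt /andP[_]].
  by rewrite lerBlDl addrA.
have [d d0 Hd] : exists2 d : R, 0 < d & forall (i : 'I_m.+1) t, `|t| < d ->
    edom phi (x + t *: delta_mx 0 i) /\
    F (x + t *: delta_mx 0 i) <= F x + t * p 0 i + e' * `|t|.
  (* Stating the bound for all [s] up to [|t|] turns it into a neighbourhood property of [t], so
     that a finite intersection yields one radius for all coordinates. *)
  have near_i (i : 'I_m.+1) : \forall t \near (0 : R), forall s, `|s| <= `|t| ->
      edom phi (x + s *: delta_mx 0 i) /\
      F (x + s *: delta_mx 0 i) <= F x + s * p 0 i + e' * `|s|.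
    have [di di0 Hi] := coord i.
    have : \forall t \near (0 : R), ball 0 di t by apply: nbhsx_ballx.
    apply: filterS => t /=; rewrite -ball_normE/= sub0r normrN => tdi s st.
    exact: Hi (le_lt_trans st tdi).
  have NB : \forall t \near (0 : R), forall i : 'I_m.+1, forall s, `|s| <= `|t| ->
      edom phi (x + s *: delta_mx 0 i) /\
      F (x + s *: delta_mx 0 i) <= F x + s * p 0 i + e' * `|s|.
    exact: (filter_forall _ near_i).
  have /nbhs_ballP[d /= d0 Hd] := NB.
  exists d => // i t td; apply: (Hd t) => //.
  by rewrite -ball_normE/= sub0r normrN.
have upper z : `|z| < d / m.+1%:R ->
    edom phi (x + z) /\ F (x + z) <= F x + dotv p z + e * `|z|.
  rewrite ltr_pdivlMr ?ltr0n// => zd.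
  have zi i : `|m.+1%:R * z 0 i| < d.
    rewrite normrM gtr0_norm ?ltr0n// mulrC; apply: le_lt_trans zd.
    by rewrite ler_wpM2r// ler_norm_rV.
  pose b i := F x + (m.+1%:R * z 0 i) * p 0 i + e * `|z|.
  have xzb : (phi (x + z)%R <= (m.+1%:R^-1 * \sum_i b i)%:E)%E.
    apply: (jensen_coord cphi) => i; have [di Fi] := Hd i _ (zi i).
    rewrite -(phi_fineK phi0 di) lee_fin (le_trans Fi)// lerD2l.
    rewrite normrM gtr0_norm ?ltr0n// mulrA divfK ?pnatr_eq0// ler_wpM2l ?ler_norm_rV//.
    exact: ltW.
  have dz : edom phi (x + z) by exact: le_lt_trans xzb (ltry _).
  split=> //; move: xzb; rewrite -(phi_fineK phi0 dz) lee_fin.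
  rewrite !big_split/= !sumr_const card_ord -[F x *+ _]mulr_natl -[(e * _) *+ _]mulr_natl.
  rewrite !mulrDr !mulrA mulVf ?pnatr_eq0// !mul1r => /le_trans; apply.
  rewrite lerD2r lerD2l /dotv mulr_sumr; apply: ler_sum => i _.
  by rewrite !mulrA mulVf ?pnatr_eq0// mul1r mulrC.
have : \forall z \near (0 : V), ball 0 (d / m.+1%:R) z.
  by apply: nbhsx_ballx; rewrite divr_gt0.
apply: filterS => z /ball_normP; rewrite sub0r normrN => zd.
suff : `|F (z + x) - (F x + dotv p z)| <= e * `|z| by [].
rewrite [z + x]addrC.
have [dz uz] := upper z zd.
have [dNz uNz] : edom phi (x - z) /\ F (x - z) <= F x - dotv p z + e * `|z|.
  by have := upper (- z); rewrite normrN linearN; apply.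
have mid := epi_convex cphi (_ : 0 <= 2^-1 :> R) (_ : 2^-1 <= 1 :> R)
  (_ : phi (x + z)%R <= (F (x + z)%R)%:E)%E (_ : phi (x - z)%R <= (F (x - z)%R)%:E)%E.
have {}mid : F x <= (F (x + z) + F (x - z)) / 2.
  move: mid; rewrite !(phi_fineK phi0)// => /(_ _ _ (lexx _) (lexx _)).
  rewrite (_ : (1 - 2^-1) *: (x + z) + 2^-1 *: (x - z) = x); last first.
    rewrite scalerBr scalerDr addrACA -scalerDl -scalerBl subrK scale1r.
    rewrite (_ : 1 - 2^-1 - 2^-1 = 0 :> R) ?scale0r ?addr0//; lra.
  rewrite -(phi_fineK phi0 (interior_edom Ux)) lee_fin => h.
  have : F x <= (1 - 2^-1) * F (x + z) + 2^-1 * F (x - z) by apply: h; lra.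
  lra.
by rewrite ler_norml; apply/andP; split; lra.
Qed.

Lemma gdiff_dirder x v : gdiff phi x -> dirder x v = dotv v (grad phi x).
Proof.
move=> [Ux dF].
have -> : dotv v (grad phi x) = 'D_v (F : V -> R^o) x.
  rewrite deriveE// [in RHS](row_sum_delta v) linear_sum; apply: eq_bigr => i _.
  by rewrite linearZ mxE.
rewrite /dirder; apply/cvg_lim => //.
have dv := @diff_derivable R V R^o (F : V -> R^o) x v dF.
have inv0 : (k.+1%:R^-1 : R) @[k --> \oo] --> 0^'.
  move=> A /nbhs_ballP[d /= d0 dA]; have := near_invS d0; apply: filterS => k kd.
  by apply: dA; rewrite -?ball_normE/= ?sub0r ?normrN ?ger0_norm// invr_eq0 pnatr_eq0.
rewrite (_ : (fun k : nat => _) = (fun h : R => h^-1 *: (((F : V -> R^o) \o shift x) (h *: v) - F x))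
  \o (fun k : nat => k.+1%:R^-1)); first exact: cvg_comp inv0 dv.
by apply/funext => k; rewrite /= invrK [_ + x]addrC.
Qed.
End directional_derivative.

(** * The function f *)

Section profile.
Variables (R : realType) (alpha : R).
Hypothesis alpha0 : alpha < 0.

Definition profile (r : R) : R := (1 - alpha * r) `^ alpha^-1.

Lemma profile_base (r : R) : 0 <= r -> 1 <= 1 - alpha * r.
Proof. by move=> r0; rewrite lerDl oppr_ge0 mulr_le0_ge0// ltW. Qed.

Lemma profile_gt0 r : 0 <= r -> 0 < profile r.
Proof. by move=> /profile_base h; apply: powR_gt0; lra. Qed.

Lemma powRV_anti (u w : R) : 0 < u -> u <= w -> w `^ alpha^-1 <= u `^ alpha^-1.
Proof.
move=> u0 uw; have w0 : 0 < w by lra.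
rewrite -(opprK alpha^-1) !(powRN _ (- alpha^-1)) lef_pV2 ?posrE ?powR_gt0//.
by apply: ge0_ler_powR => //; rewrite ?nnegrE ?oppr_ge0 ?invr_le0; exact: ltW.
Qed.

Lemma profile_anti r s : 0 <= r -> r <= s -> profile s <= profile r.
Proof.
move=> r0 rs; apply: powRV_anti; first by have := profile_base r0; lra.
by rewrite lerD2l lerN2 ler_wnM2l// ltW.
Qed.

Lemma profile_le1 r : 0 <= r -> profile r <= 1.
Proof.
by move=> r0; have := profile_anti (lexx 0) r0; rewrite /profile mulr0 subr0 powR1.
Qed.

(* Bernoulli's inequality (1 + w)^(-p) >= 1 - p w with p = - 1 / alpha. *)
Lemma profile_lipschitz r s : 0 <= r -> 0 <= s -> `|profile r - profile s| <= `|r - s|.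
Proof.
wlog rs : r s / r <= s.
  move=> H r0 s0; have [/H|/ltW/H] := leP r s; first exact.
  by rewrite distrC [`|r - s|]distrC; apply.
move=> r0 s0; have pp := profile_anti r0 rs.
rewrite ger0_norm ?subr_ge0// distrC ger0_norm ?subr_ge0//.
have [u uE] : exists u, u = 1 - alpha * r by eexists.
have u1 : 1 <= u by rewrite uE; exact: profile_base.
have u0 : 0 < u by lra.
(* Chosen so that [1 - alpha * s = u * (1 + w)]. *)
pose w := - alpha * (s - r) / u.
have w0 : 0 <= w.
  apply: divr_ge0; last exact: ltW.
  by apply: mulr_ge0; rewrite ?subr_ge0// oppr_ge0 ltW.
have sE : profile s = profile r * (1 + w) `^ alpha^-1.
  rewrite /profile -uE -powRM; [|lra|lra]; congr (_ `^ _).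
  by rewrite mulrDr mulr1 /w mulrCA divff ?gt_eqF// mulr1 uE; ring.
have bern : 1 - (s - r) / u <= (1 + w) `^ alpha^-1.
  rewrite /powR gt_eqF; last by lra.
  apply: le_trans (expR_ge1Dx _); rewrite lerD2l.
  have lw : ln (1 + w) <= w by apply: le_ln1Dx; lra.
  have : alpha^-1 * w <= alpha^-1 * ln (1 + w) by rewrite ler_wnM2l// invr_le0 ltW.
  have -> : alpha^-1 * w = - ((s - r) / u).
    by rewrite /w !mulrA mulrN mulVf ?lt_eqF// mulN1r mulNr.
  lra.
have rp := profile_gt0 r0; have r1 := profile_le1 r0.
have sru : (s - r) / u <= s - r by rewrite ler_pdivrMr// ler_peMr// subr_ge0.
have sr0 : 0 <= (s - r) / u by rewrite divr_ge0 ?subr_ge0// ltW.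
rewrite sE -{1}[profile r]mulr1 -mulrBr.
apply: le_trans (_ : profile r * ((s - r) / u) <= _); first by rewrite ler_wpM2l ?(ltW rp)//; lra.
by apply: le_trans sru; rewrite ler_piMl.
Qed.

(** The chain rule along a sequence. The derivative of the profile is minus its power [1 - alpha];
    this is the origin of the weight in [mu_alpha]. *)
Lemma profile_quotient_cvg (y : nat -> R) (y0 d : R) : 0 <= y0 ->
  k.+1%:R * (y k - y0) @[k --> \oo] --> d ->
  k.+1%:R * (profile (y k) - profile y0) @[k --> \oo] --> - (profile y0 `^ (1 - alpha)) * d.
Proof.
move=> y00 yd; have u1 := profile_base y00; have u0 : 0 < 1 - alpha * y0 by lra.
(* The Caratheodory factorisation of the derivative avoids dividing by [y k - y0], which may
   vanish. *)
have /is_derive1_caratheodory[c [cE cc cu]] := @is_derive1_powR R alpha^-1 _ u0.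
have inv0 : (k.+1%:R^-1 : R) @[k --> \oo] --> 0 by exact: cvg_harmonic.
have yy : y k @[k --> \oo] --> y0.
  have h : k.+1%:R^-1 * (k.+1%:R * (y k - y0)) + y0 @[k --> \oo] --> 0 * d + y0.
    by apply: cvgD; [exact: cvgM|exact: cvg_cst].
  rewrite mul0r add0r in h; apply: cvg_trans h; apply: near_eq_cvg.
  by apply: nearW => k; rewrite mulrA mulVf ?pnatr_eq0// mul1r subrK.
have uu : 1 - alpha * y k @[k --> \oo] --> 1 - alpha * y0.
  by apply: cvgB; [exact: cvg_cst|apply: cvgM => //; exact: cvg_cst].
have cy : c (1 - alpha * y k) @[k --> \oo] --> c (1 - alpha * y0).
  by apply: continuous_cvg.
rewrite (_ : - (profile y0 `^ (1 - alpha)) * d = c (1 - alpha * y0) * (- alpha) * d).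
  rewrite (_ : (fun k : nat => _) =
    (fun k => c (1 - alpha * y k) * (- alpha) * (k.+1%:R * (y k - y0)))).
    by apply: cvgM => //; apply: cvgM => //; exact: cvg_cst.
  by apply/funext => k; rewrite /profile cE; ring.
rewrite cu /profile -powRrM mulrBr mulr1 mulVf ?lt_eqF//; congr (_ * d).
by rewrite mulrN mulrAC mulVf ?lt_eqF// mul1r.
Qed.

End profile.

Section falpha_facts.
Variables (R : realType) (m : nat) (alpha : R).
Local Notation V := 'rV[R]_m.+1.
Variable phi : V -> \bar R.
Hypotheses (alpha0 : alpha < 0) (cphi : convex_efun phi) (phi0 : forall x, (0 <= phi x)%E).
Local Notation U := (interior (edom phi)).
Local Notation F := (fun y => fine (phi y)).
Local Notation f := (falpha alpha phi).

Lemma falpha_dom x : edom phi x -> f x = profile alpha (F x).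
Proof. by rewrite /edom/= /falpha /profile; have := phi0 x; case: (phi x). Qed.

Lemma falpha_ndom x : ~ edom phi x -> f x = 0.
Proof. by rewrite /edom/= /falpha; have := phi0 x; case: (phi x) => // r _; rewrite ltry. Qed.

Lemma falpha_gt0 x : edom phi x -> 0 < f x.
Proof. by move=> dx; rewrite falpha_dom// profile_gt0// fine_ge0. Qed.

Lemma falpha_ge0 x : 0 <= f x.
Proof.
have [dx|dx] := pselect (edom phi x); last by rewrite falpha_ndom.
exact: ltW (falpha_gt0 dx).
Qed.

Lemma falpha_le1 x : f x <= 1.
Proof.
have [dx|dx] := pselect (edom phi x); last by rewrite falpha_ndom.
by rewrite falpha_dom// profile_le1// fine_ge0.
Qed.

Lemma falpha_ge x r : (phi x <= r%:E)%E -> profile alpha r <= f x.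
Proof.
move=> xr; have dx : edom phi x by exact: le_lt_trans xr (ltry _).
rewrite falpha_dom//; apply: profile_anti => //; first by rewrite fine_ge0.
by rewrite -lee_fin (phi_fineK phi0).
Qed.

Lemma falpha_quasiconcave x y t : 0 <= t -> t <= 1 ->
  Num.min (f x) (f y) <= f ((1 - t) *: x + t *: y).
Proof.
move=> t0 t1; have [dx|dx] := pselect (edom phi x); last first.
  by rewrite ge_min falpha_ndom// falpha_ge0.
have [dy|dy] := pselect (edom phi y); last first.
  by rewrite ge_min (falpha_ndom dy) falpha_ge0 orbT.
have Fx0 : 0 <= F x by exact: fine_ge0.
have Fy0 : 0 <= F y by exact: fine_ge0.
pose r := Num.max (F x) (F y).
have h : (phi ((1 - t) *: x + t *: y)%R <= r%:E)%E.
  have : (phi ((1 - t) *: x + t *: y)%R <= ((1 - t) * r + t * r)%:E)%E.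
    by apply: epi_convex => //; rewrite -(phi_fineK phi0)// lee_fin le_max lexx ?orbT.
  by rewrite -mulrDl subrK mul1r.
apply: le_trans (falpha_ge h); rewrite !falpha_dom// /r.
by have [xy|xy] := leP (F x) (F y); rewrite ge_min lexx ?orbT.
Qed.

Lemma falpha_line_unimodal (x v : V) (a b c : R) : a <= b -> b <= c ->
  Num.min (f (x + a *: v)) (f (x + c *: v)) <= f (x + b *: v).
Proof.
move=> ab bc; have [ac|ac] := leP c a.
  have -> : a = b by apply/eqP; rewrite eq_le ab (le_trans bc ac).
  by rewrite ge_min lexx.
pose t := (b - a) / (c - a).
have t0 : 0 <= t by rewrite divr_ge0; lra.
have t1 : t <= 1 by rewrite ler_pdivrMr; lra.
have := falpha_quasiconcave (x + a *: v) (x + c *: v) t0 t1.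
rewrite (_ : (1 - t) *: (x + a *: v) + t *: (x + c *: v) = x + b *: v)//.
rewrite !scalerDr addrACA -scalerDl subrK scale1r !scalerA -scalerDl; congr (x + _ *: v).
by rewrite /t; field; rewrite subr_eq0 gt_eqF.
Qed.

(** Inverting the decreasing profile makes superlevel sets of f sublevel sets of [phi]; lower
    semi-continuity then closes them and coercivity bounds them. *)
Lemma falpha_superlevel s : 0 < s ->
  [set x | s <= f x] = [set x | (phi x <= ((1 - s `^ alpha) / alpha)%:E)%E].
Proof.
move=> s0; apply/seteqP; split => x /=.
  move=> sx; have dx : edom phi x.
    by apply/not_notP => /falpha_ndom fx; move: sx; rewrite fx leNgt s0.
  rewrite -(phi_fineK phi0 dx) lee_fin; move: sx; rewrite falpha_dom// => sx.
  have b1 := profile_base alpha0 (fine_ge0 (phi0 x)).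
  have : profile alpha (F x) `^ alpha <= s `^ alpha.
    have := @powRV_anti R alpha^-1 _ s (profile alpha (F x)) s0 sx.
    by rewrite invrK; apply; rewrite invr_lt0.
  rewrite /profile -powRrM mulVf ?lt_eqF// powRr1; last lra.
  by move=> h; rewrite ler_ndivlMr//; lra.
move=> /falpha_ge; rewrite /profile mulrCA divff ?lt_eqF// mulr1 opprB addrC subrK.
by rewrite -powRrM divff ?lt_eqF// powRr1// ltW.
Qed.

Hypothesis lphi : lower_semicontinuous phi.

Lemma falpha_superlevel_closed s : 0 < s -> closed [set x | s <= f x].
Proof.
move=> s0; rewrite falpha_superlevel//; set c := (X in X%:E).
rewrite (_ : [set x | _] = ~` [set x | (c%:E < phi x)%E]).
  by apply: open_closedC; exact: (lower_semicontinuousP phi).1.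
by apply/seteqP; split => x /=; rewrite leNgt; move/negP.
Qed.

Lemma falpha_measurable : measurable_fun setT (f : lebT R m.+1 -> R).
Proof.
apply: (measurability _ (measurable_realfun.RGenCInfty.measurableE R)) => _ [_ [s ->] <-].
rewrite setTI; have [s0|s0] := leP s 0.
  rewrite (_ : _ @^-1` _ = setT)//; apply/seteqP; split => x //= _.
  by rewrite in_itv/= andbT (le_trans s0)// falpha_ge0.
rewrite (_ : _ @^-1` _ = [set x | s <= f x]); last first.
  by apply/seteqP; split => x /=; rewrite in_itv/= andbT.
by apply: closed_lebmeasurable; exact: falpha_superlevel_closed.
Qed.

Lemma falpha_locally_lipschitz x v : U x -> exists d L : R, [/\ 0 < d, 0 <= L &
  forall y t, `|y - x| < d -> `|t| < d ->
    U (y + t *: v) /\ `|f (y + t *: v) - f y| <= L * `|t| ].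
Proof.
move=> Ux; have [d [L [d0 L0 H]]] := convex_locally_lipschitz cphi phi0 v Ux.
exists d, L; split => // y t yd td; have [Uyt yL] := H y t yd td; split => //.
have dy : edom phi y.
  apply: interior_edom; have := (H y 0 yd _).1; rewrite scale0r addr0.
  by apply; rewrite normr0.
rewrite !falpha_dom//; last exact: interior_edom.
by apply: le_trans yL; apply: profile_lipschitz => //; exact: fine_ge0.
Qed.

Lemma falpha_quotient_cvg x v : U x ->
  k.+1%:R * (f (x + k.+1%:R^-1 *: v) - f x) @[k --> \oo] -->
  - (f x `^ (1 - alpha)) * dirder phi x v.
Proof.
move=> Ux; have dx := interior_edom Ux; rewrite falpha_dom//.
have := profile_quotient_cvg alpha0 (fine_ge0 (phi0 x)) (dirder_cvg cphi phi0 (v := v) Ux).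
apply: cvg_trans; apply: near_eq_cvg.
have [d d0 Hd] := interior_line cphi phi0 v Ux.
apply: filterS (near_invS d0) => k kd.
by rewrite !falpha_dom//; apply: Hd; rewrite ger0_norm.
Qed.

(** Continuity at [x] would keep [phi] below +oo on a neighbourhood and make [x] interior. Hence
    essential continuity makes the part of the domain outside [U] Hausdorff-null, and this is the
    form in which it enters the proof. *)
Lemma boundary_discontinuous x : edom phi x -> ~ U x ->
  (closure (edom phi) `\` U) x /\ ~ {for x, continuous phi}.
Proof.
move=> dx nUx; split; first by split => //; exact: subset_closure.
move=> cx; apply: nUx.
have : nbhs (phi x) [set y : \bar R | (y < +oo)%E].
  by apply: open_nbhs_nbhs; split => //; exact: open_ereal_lt_ereal.
by move/cx.
Qed.

End falpha_facts.

(** * Hausdorff-null sets and covers by balls *)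

Lemma norm_le_enorm (R : realType) (n : nat) (x : 'rV[R]_n) : `|x| <= enorm x.
Proof.
apply: norm_rV_le => [|i]; first exact: sqrtr_ge0.
rewrite -sqrtr_sqr /enorm ler_wsqrtr// /dotv (bigD1 i)//= -expr2 lerDl.
by apply: sumr_ge0 => j _; rewrite -expr2 sqr_ge0.
Qed.

Lemma expr_upper_approx (R : realType) (m : nat) (d e : R) : 0 <= d -> 0 < e ->
  exists2 r, d < r <= d + 1 & r ^+ m <= d ^+ m + e.
Proof.
move=> d0 e0; have cm : (fun r : R => r ^+ m) @ d --> d ^+ m by exact: exprn_continuous.
have /cvgrPdist_lt/(_ _ e0)/nbhs_ballP[b /= b0 Hb] := cm.
pose h := Num.min (b / 2) 1; have h0 : 0 < h by rewrite lt_min ltr01 andbT divr_gt0.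
have hb : h < b by rewrite gt_min; apply/orP; left; lra.
have h1 : h <= 1 by rewrite ge_min lexx orbT.
exists (d + h); first by apply/andP; split; lra.
have := Hb (d + h); rewrite -ball_normE/= opprD addNKr normrN gtr0_norm// => /(_ hb).
by rewrite ltr_distlC => /andP[_ /ltW].
Qed.

(* A radius 0 codes the empty ball, whose weight need not dominate 0 ^ (n-1), which is 1 for n = 1. *)
Lemma hausdorff_null_cover (R : realType) (m : nat) (N : set 'rV[R]_m.+1) (e : R) :
  hausdorff (m.+1%:R - 1) N = 0%E -> 0 < e ->
  exists (x : nat -> 'rV[R]_m.+1) (r w : nat -> R),
    [/\ N `<=` \bigcup_k ball (x k) (r k), forall k, 0 <= w k,
        forall k, 0 < r k -> r k <= 2 /\ r k ^+ m <= w k &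
        (\sum_(k <oo) (w k)%:E <= e%:E)%E].
Proof.
move=> N0 e0; have e2 : 0 < e / 2 by rewrite divr_gt0.
(* The scale 1 is enough; with an enlargement of the diameters by at most 1 it gives radii at most
   2. *)
have : (hausdorff_delta (m.+1%:R - 1) 1 N < (e / 2)%:E)%E.
  apply: (@le_lt_trans _ _ 0%E); last by rewrite lte_fin.
  by rewrite -N0; apply: ereal_sup_ubound; exists 1 => //=.
move=> /ereal_inf_lt[_ [C [NC Cd] <-] Ce].
have term k : exists z : 'rV[R]_m.+1 * R * R,
    [/\ C k `<=` ball z.1.1 z.1.2, 0 <= z.2, 0 < z.1.2 -> z.1.2 <= 2 /\ z.1.2 ^+ m <= z.2 &
     (z.2%:E <= hterm (m.+1%:R - 1) (C k) + ((e / 2) / (2 ^ k.+1)%:R)%:E)%E].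
  have eta0 : 0 < (e / 2) / (2 ^ k.+1)%:R by rewrite divr_gt0// ltr0n expn_gt0.
  rewrite /hterm; case: asboolP => [->|/eqP/set0P[x Cx]].
    exists (0, 0, 0); split => //=; first by rewrite ltxx.
    by rewrite add0e lee_fin ltW.
  have dk0 : (0 <= ediam (C k))%E by apply: ereal_sup_ubound; left.
  have dkf : ediam (C k) \is a fin_num.
    by rewrite ge0_fin_numE// (le_lt_trans (Cd k))// ltry.
  set d := fine (ediam (C k)); have d0 : 0 <= d by exact: fine_ge0.
  have d1 : d <= 1 by rewrite -lee_fin fineK// (Cd k).
  (* The radius strictly exceeds the diameter, so that the open ball about any point of [C k]
     contains [C k]; the cost is the [k]-th term of a summable slack. *)
  have [r /andP[dr r1] rm] := expr_upper_approx m d0 eta0.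
  exists (x, r, r ^+ m); split => //=.
  - move=> y Cy; apply/ball_normP; apply: le_lt_trans dr.
    apply: le_trans (norm_le_enorm _) _; rewrite -lee_fin /d fineK//.
    by apply: ereal_sup_ubound; right; exists x, y.
  - by apply: exprn_ge0; lra.
  - by move=> _; split => //; lra.
  - rewrite -EFinD lee_fin (_ : m.+1%:R - 1 = m%:R :> R); last by rewrite -natr1 addrK.
    by rewrite powR_mulrn.
have [z Hz] := choice term.
exists (fun k => (z k).1.1), (fun k => (z k).1.2), (fun k => (z k).2); split.
- by move=> y /NC[k _ Cy]; exists k => //; have [+ _ _ _] := Hz k; exact.
- by move=> k; have [] := Hz k.
- by move=> k; have [] := Hz k.
apply: (@le_trans _ _ (\sum_(k <oo) (hterm (m.+1%:R - 1) (C k) +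
    ((e / 2) / (2 ^ k.+1)%:R)%:E))%E).
  by apply: lee_nneseries => [k _ _|k _]; [rewrite lee_fin|]; have [] := Hz k.
have h0 k : (0 <= hterm (m.+1%:R - 1) (C k))%E.
  by rewrite /hterm; case: ifP => // _; rewrite lee_fin powR_ge0.
apply: le_trans (epsilon_trick xpredT h0 (ltW e2)) _.
rewrite [X in (_ <= X%:E)%E](_ : e = e / 2 + e / 2); last lra.
by rewrite EFinD leeD2r// ltW.
Qed.

Lemma hausdorff_null_lebn (R : realType) (m : nat) (N : set 'rV[R]_m.+1) :
  hausdorff (m.+1%:R - 1) N = 0%E -> lebn R m.+1 N = 0%E.
Proof.
move=> N0; apply/eqP; rewrite eq_le measure_ge0 andbT.
apply/lee_addgt0Pr => e e0; rewrite add0e.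
(* The power comes from a cube of side [2 * r k], the last factor from bounding one of its [m.+1]
   radii by 2. *)
pose c : R := 2 ^+ m.+1 * 2; have c0 : 0 < c by rewrite mulr_gt0// exprn_gt0.
have ec : 0 < e / c by rewrite divr_gt0.
have [x [r [w [Ncov w0 rw wsum]]]] := hausdorff_null_cover N0 ec.
apply: (@le_trans _ _ (leb_outer R m.+1 (\bigcup_k ball (x k) (r k)))).
  exact: le_outer_measure.
apply: le_trans (outer_measure_sigma_subadditive _ _) _.
apply: (@le_trans _ _ (\sum_(k <oo) (c%:E * (w k)%:E))%E).
  apply: lee_nneseries => [k _ _|k _]; first exact: outer_measure_ge0.
  have [r0|r0] := leP (r k) 0.
    rewrite (_ : ball _ _ = set0).
      by rewrite outer_measure0 -EFinM lee_fin mulr_ge0// ltW.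
    by rewrite -subset0 => y /ball_rowP[]; rewrite ltNge r0.
  apply: le_trans (lebn_ball_le _ (ltW r0)) _; rewrite -EFinM lee_fin.
  have [r2 rm] := rw k r0.
  rewrite exprMn /c -mulrA ler_wpM2l ?exprn_ge0// exprS.
  by apply: ler_pM => //; [exact: ltW|exact/exprn_ge0/ltW].
rewrite nneseriesZl; last by move=> k _; rewrite lee_fin.
apply: (@le_trans _ _ (c%:E * (e / c)%:E)%E); first by rewrite lee_wpmul2l// lee_fin ltW.
by rewrite -EFinM lee_fin mulrC divfK// gt_eqF.
Qed.

(** * An integrable envelope for the translates of f *)

Lemma geometric_nneseries_lt (R : realType) (K q : R) : 0 <= K -> 0 <= q -> q < 1 ->
  (\sum_(k <oo) (K * q ^+ k)%:E < +oo)%E.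
Proof.
move=> K0 q0 q1; apply: (@le_lt_trans _ _ (K / (1 - q))%:E); last exact: ltry.
have t0 k : (0 <= (K * q ^+ k)%:E)%E by rewrite lee_fin mulr_ge0// exprn_ge0.
apply: lime_le; first by apply: is_cvg_nneseries => k _ _; exact: t0.
apply: nearW => k; rewrite sumEFin lee_fin.
have := geometric_seriesE K (negbT (lt_eqF q1)).
move=> /(congr1 (fun h => h k)); rewrite /series /geometric/= => ->.
rewrite ler_wpM2r ?invr_ge0 ?subr_ge0 ?(ltW q1)// ler_piMr// lerBlDr lerDl.
exact: exprn_ge0.
Qed.

Lemma weighted_indicator_sum d (T : measurableType d) (R : realType)
    (mu : {measure set T -> \bar R}) (a : nat -> R) (B : nat -> set T) (K q : R) :
  0 <= K -> 0 <= q -> q < 1 -> (forall k, 0 <= a k) -> (forall k, measurable (B k)) ->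
  (forall k, (a k)%:E * mu (B k) <= (K * q ^+ k)%:E)%E ->
  exists E : T -> \bar R, [/\ measurable_fun setT E, forall x, (0 <= E x)%E,
    (\int[mu]_x E x < +oo)%E & forall k x, B k x -> ((a k)%:E <= E x)%E].
Proof.
move=> K0 q0 q1 a0 mB aB; pose h k x := ((a k)%:E * (\1_(B k) x)%:E)%E.
have h0 k x : (0 <= h k x)%E by rewrite /h -EFinM lee_fin mulr_ge0.
have mh k : measurable_fun setT (h k).
  by apply: measurable_funeM; apply/measurable_EFinP; exact: measurable_indic.
exists (fun x => \sum_(k <oo) h k x)%E; split.
- exact: ge0_emeasurable_sum.
- by move=> x; apply: nneseries_ge0 => *; exact: h0.
- rewrite integral_nneseries//; apply: le_lt_trans (geometric_nneseries_lt K0 q0 q1).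
  apply: lee_nneseries => [k _ _|k _]; first exact: integral_ge0.
  rewrite ge0_integralZl_EFin// ?integral_indic// ?setIT//.
  by apply/measurable_EFinP; exact: measurable_indic.
- move=> k x Bx; have -> : (a k)%:E = h k x by rewrite /h indicE mem_set// mule1.
  rewrite (@nneseriesD1 _ (h ^~ x) k xpredT) => [|j _|//]; last exact: h0.
  by rewrite leeDl// nneseries_ge0.
Qed.

Section envelope.
Variables (R : realType) (m : nat) (alpha : R).
Local Notation V := 'rV[R]_m.+1.
Variable phi : V -> \bar R.
Hypotheses (alpha0 : alpha < 0) (alphan : - (m.+1%:R)^-1 < alpha).
Hypotheses (phi0 : forall x, (0 <= phi x)%E) (coer : coercive phi).
Local Notation f := (falpha alpha phi).

Lemma falpha_decay : exists2 C : R, 1 <= C &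
  forall y (k : nat), 2 ^+ k <= `|y| -> f y <= C * (2 ^+ k) `^ alpha^-1.
Proof.
have [c [c0 [M HM]]] := coer.
(* [A] is the constant coming from coercivity, for large [2 ^+ k]; [B] makes the right side at least
   1 while [2 ^+ k < M']; the summand 1 in the witness ensures [1 <= C]. *)
pose A := (- alpha * c) `^ alpha^-1; have A0 : 0 <= A by exact: powR_ge0.
pose M' := Num.max M 1; have M'1 : 1 <= M' by rewrite le_max lexx orbT.
pose B := M' `^ (- alpha^-1); have B0 : 0 <= B by exact: powR_ge0.
exists (1 + A + B) => [|y k ky]; first lra.
pose z : R := 2 ^+ k; have z0 : 0 < z by exact: exprn_gt0.
have w0 : 0 <= z `^ alpha^-1 by exact: powR_ge0.
have [zM|Mz] := ltP z M'.
  apply: le_trans (falpha_le1 alpha0 phi0 y) _.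
  rewrite -/z mulrDl -[leLHS]add0r; apply: lerD.
    by rewrite mulr_ge0// addr_ge0.
  rewrite -(powRr0 z) -(addNr alpha^-1) powRD; last by rewrite (gt_eqF z0) implybT.
  rewrite ler_wpM2r//; apply: ge0_ler_powR; rewrite ?nnegrE; [|lra|lra|lra].
  by rewrite oppr_ge0 invr_le0 ltW.
have [dy|dy] := pselect (edom phi y); last first.
  by rewrite falpha_ndom// mulr_ge0// !addr_ge0.
have ye : `|y| <= enorm y by exact: norm_le_enorm.
have MM : M <= M' by rewrite le_max lexx.
have My : M <= enorm y by apply: (le_trans MM); apply: le_trans ye; apply: le_trans ky.
have := HM y My; rewrite -(phi_fineK phi0 dy) lee_fin => cy.
have czF : c * z <= fine (phi y).
  by apply: le_trans cy; rewrite ler_wpM2l ?(ltW c0)// (le_trans ky).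
rewrite falpha_dom//; apply: (@le_trans _ _ (profile alpha (c * z))).
  by apply: profile_anti => //; rewrite mulr_ge0// ltW.
have ac0 : 0 < - alpha * c by rewrite mulr_gt0// oppr_gt0.
apply: (@le_trans _ _ (A * z `^ alpha^-1)).
  rewrite /A -powRM ?(ltW ac0) ?(ltW z0)//; apply: powRV_anti => //.
    by rewrite mulr_gt0.
  by rewrite mulrA; lra.
by rewrite ler_wpM2r//; lra.
Qed.

(** On the dyadic shell of index [k] f is at most of order [2 ^ (k / alpha)], while the ball around
    it has volume of order [2 ^ (k * (m + 1))]. The series converges because [alpha > - 1 / (m + 1)]
    makes the exponent [m + 1 + 1 / alpha] negative. *)
Lemma falpha_envelope v : exists E : lebT R m.+1 -> \bar R,
  [/\ measurable_fun setT E, forall x, (0 <= E x)%E, (\int[lebn R m.+1]_x E x < +oo)%E &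
    forall x s, `|s| <= 1 -> ((f (x + s *: v))%:E <= E x)%E].
Proof.
have [C C1 HC] := falpha_decay.
pose b := `|v|; have b0 : 0 <= b by exact: normr_ge0.
pose a k := C * (2 ^+ k) `^ alpha^-1.
(* The summand [b] leaves room for a shift by [s *: v] with [|s| <= 1]. *)
pose rad k : R := 2 ^+ k.+1 + b.
pose q : R := 2 `^ (m.+1%:R + alpha^-1).
have q1 : q < 1.
  rewrite /q /powR gt_eqF//; have ln2 : 0 < ln (2 : R) by rewrite ln_gt0// ltr1n.
  have : m.+1%:R < - alpha^-1.
    rewrite -invrN -[ltLHS]invrK ltf_pV2 ?posrE ?oppr_gt0 ?invr_gt0//.
    by rewrite ltrNl.
  by move=> h; rewrite -[ltRHS]expR0 ltr_expR pmulr_llt0//; lra.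
pose K := C * (2 * (2 + b)) ^+ m.+1.
have a0 k : 0 <= a k by apply: mulr_ge0; [lra|exact: powR_ge0].
have aB k : ((a k)%:E * lebn R m.+1 (ball (0%R : V) (rad k)) <= (K * q ^+ k)%:E)%E.
  have z1 : 1 <= (2 ^+ k : R) by rewrite exprn_ege1// ler1n.
  have r0 : 0 <= rad k by rewrite addr_ge0// exprn_ge0.
  apply: le_trans (lee_wpmul2l _ (lebn_ball_le _ r0)) _; first by rewrite lee_fin.
  rewrite -EFinM lee_fin /a /K -[leLHS]mulrA -[leRHS]mulrA ler_wpM2l//; first by lra.
  rewrite [leRHS](_ : _ = (2 ^+ k) `^ alpha^-1 * (2 * (2 + b) * 2 ^+ k) ^+ m.+1).
    have rk : rad k <= (2 + b) * 2 ^+ k.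
      by rewrite /rad exprS [leRHS]mulrDl lerD2l ler_peMr.
    rewrite ler_wpM2l ?powR_ge0// lerXn2r ?nnegrE//.
    - by rewrite mulr_ge0.
    - by rewrite !mulr_ge0 ?exprn_ge0// addr_ge0.
    - by rewrite -mulrA ler_wpM2l.
  have -> : q ^+ k = (2 ^+ k) `^ alpha^-1 * (2 ^+ k) ^+ m.+1.
    have z0 : (2 ^+ k : R) != 0 by rewrite expf_neq0// pnatr_eq0.
    rewrite -[(2 ^+ k) ^+ m.+1]powR_mulrn ?exprn_ge0// -powRD; last by rewrite z0 implybT.
    rewrite -[(2 : R) ^+ k]powR_mulrn// -powRrM -[LHS]powR_mulrn ?powR_ge0// /q -powRrM.
    by congr (_ `^ _); ring.
  by rewrite [in RHS]exprMn; ring.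
have q0 : 0 <= q by exact: powR_ge0.
have K0 : 0 <= K by rewrite mulr_ge0 ?exprn_ge0 ?mulr_ge0 ?addr_ge0//; lra.
have [E [mE E0 iE aE]] := @weighted_indicator_sum _ _ _ (lebn R m.+1) a
  (fun k => ball (0 : V) (rad k)) K q K0 q0 q1 a0 (fun k => ball_measurable _ _) aB.
exists E; split => // x s s1; set y := x + s *: v.
have sv : `|s *: v| <= b by rewrite normrZ ler_piMl.
have xy : `|x| <= `|y| + b.
  by rewrite -[x](addrK (s *: v)) -/y (le_trans (ler_normB _ _))// lerD2l.
have [k [fk yk]] : exists k, f y <= a k /\ `|y| < 2 ^+ k.+1.
  have ex : exists k, `|y| < 2 ^+ k.+1.
    exists (Num.truncn `|y|); apply: (lt_le_trans (truncnS_gt _)).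
    by rewrite -natrX ler_nat; exact: ltnW (ltn_expl _ _).
  (* The least such [k] gives [2 ^+ k <= |y|] unless [k = 0], where [f <= 1 <= C] is used
     instead. *)
  case: (ex_minnP ex) => k yk mink; exists k; split => //.
  have [->|k0] := posnP k.
    by rewrite /a expr0 powR1 mulr1; apply: le_trans C1; exact: falpha_le1.
  apply: HC; rewrite leNgt; apply/negP => yk'.
  by have := mink k.-1; rewrite prednK// => /(_ yk'); rewrite -ltnS prednK// ltnn.
apply: (@le_trans _ _ (a k)%:E); first by rewrite lee_fin.
by apply: aE; apply/ball_normP; rewrite sub0r normrN /rad; lra.
Qed.
End envelope.

(** * Integrals of increments along a direction *)

Lemma iter_shift (R : realType) (n : nat) (a : 'rV[R]_n) (x : 'rV[R]_n) (i : nat) :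
  iter i (fun y => y + a) x = x + i%:R *: a.
Proof.
elim: i => [|i IH]; first by rewrite scale0r addr0.
by rewrite iterS IH -natr1 scalerDl scale1r addrA.
Qed.

Lemma norm_maxD (R : realType) (u w : R) :
  `|u - w| = Num.max (u - w) 0 + Num.max (w - u) 0.
Proof.
have [h|/ltW h] := leP w u.
  by rewrite ger0_norm ?subr_ge0// max_l ?subr_ge0// max_r ?subr_le0// addr0.
by rewrite ler0_norm ?subr_le0// max_r ?subr_le0// max_l ?subr_ge0// add0r opprB.
Qed.

Lemma measurable_pos_diff d (T : measurableType d) (R : realType) (a b : T -> R) :
  measurable_fun setT a -> measurable_fun setT b ->
  measurable_fun setT (fun x => Num.max (a x - b x) 0).
Proof. by move=> ma mb; apply: measurable_maxr => //; exact: measurable_funB. Qed.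

Lemma ge0_integralZl_real d (T : measurableType d) (R : realType)
    (mu : {measure set T -> \bar R}) (c : R) (a : T -> R) :
  0 <= c -> measurable_fun setT a -> (forall x, 0 <= a x) ->
  (\int[mu]_x (c * a x)%:E = c%:E * \int[mu]_x (a x)%:E)%E.
Proof.
move=> c0 ma a0; under eq_integral do rewrite EFinM.
by rewrite ge0_integralZl_EFin// => *; rewrite ?lee_fin//; exact/measurable_EFinP.
Qed.

Section increments.
Variables (R : realType) (n : nat).
Local Notation V := 'rV[R]_n.

Lemma measurable_shift_fun (g : lebT R n -> R) (a : V) :
  measurable_fun setT g -> measurable_fun setT (fun x : lebT R n => g (x + a)).
Proof. by move=> mg; exact: (measurableT_comp mg (leb_shift_measurable a)). Qed.

(** The orbit consists of [K] translations by [t *: v], and [B] dominates [g] along it. After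
    division by [K] a single increment has a small integral, whatever the regularity of [g]. *)
Lemma ge0_integral_increment (g : lebT R n -> R) (v : V) (t : R) (K : nat) (B : lebT R n -> \bar R) :
  measurable_fun setT g -> (forall x, 0 <= g x) ->
  (forall x (v : V) (a b c : R), a <= b -> b <= c ->
     Num.min (g (x + a *: v)) (g (x + c *: v)) <= g (x + b *: v)) ->
  measurable_fun setT B ->
  0 <= t -> (forall x s, `|s| <= K%:R * t -> ((g (x + s *: v))%:E <= B x)%E) ->
  (K%:R%:E * \int[lebn R n]_x (Num.max (g (x + t *: v) - g x) 0)%:E <= \int[lebn R n]_x B x)%E.
Proof.
move=> mg g0 uni mB t0 gB.
have iterE x i : iter i (fun y : lebT R n => y + t *: v : lebT R n) x = x + (i%:R * t) *: v.
  by rewrite iter_shift scalerA.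
apply: (@unimodal_orbit_integral _ _ _ (lebn R n) (fun y : lebT R n => y + t *: v : lebT R n) g B K
  (leb_shift_measurable (t *: v)) (leb_outer_shift (t *: v)) mg g0) => //.
- move=> x i j k /andP[ij jk]; rewrite !iterE; apply: uni.
    by rewrite ler_wpM2r// ler_nat.
  by rewrite ler_wpM2r// ler_nat.
- move=> x i iK; rewrite iterE; apply: gB.
  by rewrite ger0_norm ?mulr_ge0// ler_wpM2r// ler_nat.
Qed.

Lemma ge0_integral_abs_increment (g : lebT R n -> R) (v : V) (t : R) (K : nat) (B : lebT R n -> \bar R) :
  measurable_fun setT g -> (forall x, 0 <= g x) ->
  (forall x (v : V) (a b c : R), a <= b -> b <= c ->
     Num.min (g (x + a *: v)) (g (x + c *: v)) <= g (x + b *: v)) ->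
  measurable_fun setT B ->
  0 <= t -> (forall x s, `|s| <= K%:R * t -> ((g (x + s *: v))%:E <= B x)%E) ->
  (K%:R%:E * \int[lebn R n]_x (`|g (x + t *: v) - g x|)%:E <=
   \int[lebn R n]_x B x + \int[lebn R n]_x B x)%E.
Proof.
move=> mg g0 uni mB t0 gB.
have mp a : measurable_fun setT (fun x : lebT R n => Num.max (g (x + a) - g x) 0).
  exact: (measurable_pos_diff (measurable_shift_fun a mg) mg).
have mp' a : measurable_fun setT (fun x : lebT R n => Num.max (g x - g (x + a)) 0).
  exact: (measurable_pos_diff mg (measurable_shift_fun a mg)).
have p0 (y : R) : 0 <= Num.max y 0 by rewrite le_max lexx orbT.
under eq_integral do rewrite norm_maxD.
rewrite ge0_integral_EFinD// ge0_muleDr; try by apply: integral_ge0 => x _; rewrite lee_fin.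
apply: leeD; first exact: ge0_integral_increment.
(* Downward increments along [v] are upward increments along [- v] after a translation. *)
have -> : (\int[lebn R n]_x (Num.max (g x - g (x + t *: v)%R) 0)%:E =
    \int[lebn R n]_x (Num.max (g (x + t *: (- v))%R - g x) 0)%:E)%E.
  pose h (x : lebT R n) := (Num.max (g (x + t *: (- v))%R - g x) 0)%:E.
  have mh : measurable_fun setT h by apply/measurable_EFinP; exact: mp.
  have h0 x : (0 <= h x)%E by rewrite lee_fin.
  rewrite -[RHS](ge0_integral_shift (t *: v) mh h0); apply: eq_integral => x _.
  by rewrite /h scalerN addrK.
apply: ge0_integral_increment => // x s sK.
by rewrite scalerN -scaleNr; apply: gB; rewrite normrN.
Qed.
End increments.

(** Dominated convergence at the levels [1 / (k + 1)]: the low values of an integrable function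
    carry little mass. *)
Lemma integral_mine_small d (T : measurableType d) (R : realType)
    (mu : {measure set T -> \bar R}) (E : T -> \bar R) (e : R) :
  measurable_fun setT E -> (forall x, 0 <= E x)%E -> (\int[mu]_x E x < +oo)%E -> 0 < e ->
  exists2 s : R, 0 < s & (\int[mu]_x mine (E x) s%:E <= e%:E)%E.
Proof.
move=> mE E0 Eoo e0.
have mf k : measurable_fun setT (fun x => mine (E x) (k.+1%:R^-1%:E)) by exact: measurable_mine.
have iE : mu.-integrable setT E.
  apply/integrableP; split => //; under eq_integral do rewrite gee0_abs//.
  exact: Eoo.
have m0 k x : (0 <= mine (E x) (k.+1%:R^-1%:E))%E by rewrite le_min E0/= lee_fin invr_ge0.
have bE k x : (`|mine (E x) (k.+1%:R^-1%:E)| <= E x)%E.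
  by rewrite gee0_abs// ge_min lexx.
have c0 x : mine (E x) (k.+1%:R^-1%:E) @[k --> \oo] --> (cst 0%E : T -> \bar R) x.
  apply: (@squeeze_cvge _ _ _ _ (cst 0%E) _ (fun k : nat => (k.+1%:R^-1)%:E)).
  - by apply: nearW => k; rewrite m0 ge_min lexx orbT.
  - exact: cvg_cst.
  - by apply: cvg_EFin; [exact: nearW|exact: cvg_harmonic].
have [_ _ ] := @dominated_convergence _ _ _ mu setT measurableT
  (fun k x => mine (E x) (k.+1%:R^-1%:E)) (cst 0%E) E mf (measurable_cst _)
  (aeW _ (fun x _ => c0 x)) iE (aeW _ (fun x k _ => bE k x)).
rewrite integral_cst// mul0e => /(_ [set y : \bar R | (y < e%:E)%E]) [].
  by apply: open_nbhs_nbhs; split; [exact: open_ereal_lt_ereal|rewrite /= lte_fin].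
move=> k _ /(_ k (leqnn _)) /= ke; exists (k.+1%:R^-1); first by rewrite invr_gt0.
exact: ltW.
Qed.

(** * Uniform integrability of difference quotients *)

Section excess.
Variables (R : realType) (m : nat) (alpha : R).
Local Notation V := 'rV[R]_m.+1.
Variable phi : V -> \bar R.
Hypotheses (alpha0 : alpha < 0).
Hypotheses (cphi : convex_efun phi) (phi0 : forall x, (0 <= phi x)%E).
Hypotheses (lphi : lower_semicontinuous phi) (coer : coercive phi).
Hypothesis haus : hausdorff (m.+1%:R - 1)
    [set x | (closure (edom phi) `\` interior (edom phi)) x /\
             ~ {for x, continuous phi}] = 0%E.
Local Notation U := (interior (edom phi)).
Local Notation f := (falpha alpha phi).
Local Notation mu := (lebn R m.+1).

Lemma lebn_dom_boundary : mu (edom phi `\` U) = 0%E.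
Proof.
apply/eqP; rewrite eq_le measure_ge0 andbT -(hausdorff_null_lebn haus).
by apply: le_outer_measure => x [dx nUx]; exact: boundary_discontinuous.
Qed.

Lemma superlevel_compact s : 0 < s -> compact [set x | s <= f x].
Proof.
move=> s0; apply: bounded_closed_compact; last exact: falpha_superlevel_closed.
have [c [c0 [M HM]]] := coer.
pose a := (1 - s `^ alpha) / alpha.
exists (Num.max M (a / c)); split; first exact: num_real.
move=> B; rewrite gt_max => /andP[MB aB] x /= sx.
have : [set x | s <= f x] x by [].
rewrite (falpha_superlevel alpha0 phi0 s0)/= -/a => xa.
have [Mx|xM] := leP M (enorm x); last first.
  by apply: le_trans (norm_le_enorm _) _; apply/ltW/(lt_trans xM).
apply: le_trans (norm_le_enorm _) _; apply: le_trans (ltW aB).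
rewrite ler_pdivlMr// mulrC -lee_fin; exact: le_trans (HM x Mx) xa.
Qed.

Definition shift_quotient (v : V) (k : nat) (x : V) : R :=
  k.+1%:R * (f (x + k.+1%:R^-1 *: v) - f x).

Lemma measurable_falpha : measurable_fun setT (f : lebT R m.+1 -> R).
Proof. exact: falpha_measurable. Qed.

Lemma measurable_shift_quotient v k : measurable_fun setT (shift_quotient v k : lebT R m.+1 -> R).
Proof.
have h : measurable_fun setT (fun x : lebT R m.+1 => f (x + k.+1%:R^-1 *: v) - f x).
  exact: (measurable_funB (measurable_shift_fun (k.+1%:R^-1 *: v) measurable_falpha) measurable_falpha).
exact: (measurable_funM (measurable_cst _) h).
Qed.

(** Capping at [s] preserves unimodality, and [k.+1] steps of length [1 / k.+1] stay in the range
    [|t| <= 1] where [E] dominates. The bound is independent of [k] and small with [s]. *)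
Lemma truncated_increment v s k (E : lebT R m.+1 -> \bar R) : 0 < s ->
  measurable_fun setT E -> (forall x t, `|t| <= 1 -> ((f (x + t *: v))%:E <= E x)%E) ->
  (\int[mu]_x (k.+1%:R * `|Num.min s (f (x + k.+1%:R^-1 *: v)%R) - Num.min s (f x)|)%:E
   <= \int[mu]_x mine (E x) s%:E + \int[mu]_x mine (E x) s%:E)%E.
Proof.
move=> s0 mE fE; pose g (x : lebT R m.+1) := Num.min s (f x).
have mg : measurable_fun setT g by exact: (measurable_minr (measurable_cst s) measurable_falpha).
have g0 x : 0 <= g x by rewrite le_min (ltW s0)/= falpha_ge0.
have uni x (w : V) (a b c : R) : a <= b -> b <= c ->
     Num.min (g (x + a *: w)) (g (x + c *: w)) <= g (x + b *: w).
  move=> ab bc; rewrite /g.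
  have := falpha_line_unimodal alpha0 cphi phi0 x w ab bc.
  by rewrite le_min !ge_min lexx/= => /orP[->|->]; rewrite ?orbT.
have mB : measurable_fun setT (fun x => mine (E x) s%:E).
  exact: (measurable_mine mE (measurable_cst _)).
have gB x t : `|t| <= k.+1%:R * k.+1%:R^-1 -> ((g (x + t *: v))%:E <= mine (E x) s%:E)%E.
  rewrite mulfV ?pnatr_eq0// => t1; rewrite le_min; apply/andP; split.
    by apply: le_trans (fE x t t1); rewrite lee_fin ge_min lexx orbT.
  by rewrite lee_fin ge_min lexx.
have k0 : (0 : R) <= k.+1%:R^-1 by rewrite invr_ge0.
have mdg : measurable_fun setT (fun x : lebT R m.+1 => `|g (x + k.+1%:R^-1 *: v) - g x|).
  exact: (measurableT_comp (@normr_measurable R setT)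
    (measurable_funB (measurable_shift_fun (k.+1%:R^-1 *: v) mg) mg)).
have dg0 (x : lebT R m.+1) : 0 <= `|g (x + k.+1%:R^-1 *: v) - g x| by exact: normr_ge0.
have E1 := ge0_integralZl_real mu (ler0n R k.+1) mdg dg0.
by rewrite /g in E1 *; rewrite E1; exact: (ge0_integral_abs_increment mg g0 uni mB k0 gB).
Qed.
End excess.

Section uniform_excess.
Variables (R : realType) (m : nat) (alpha : R).
Local Notation V := 'rV[R]_m.+1.
Variable phi : V -> \bar R.
Hypotheses (alpha0 : alpha < 0).
Hypotheses (cphi : convex_efun phi) (phi0 : forall x, (0 <= phi x)%E).
Hypotheses (lphi : lower_semicontinuous phi) (coer : coercive phi).
Local Notation f := (falpha alpha phi).
Local Notation mu := (lebn R m.+1).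
Local Notation quot := (shift_quotient alpha phi).
Let mf : measurable_fun setT (f : lebT R m.+1 -> R) := falpha_measurable alpha0 phi0 lphi.
Let mquot v k : measurable_fun setT (quot v k : lebT R m.+1 -> R) :=
  measurable_shift_quotient alpha0 phi0 lphi v k.

(** A ball is convex, so f cut off outside it stays unimodal on lines, and the orbit bound applies
    with about [r / t] steps. *)
Lemma localized_increment v (x0 : V) (r : R) (k : nat) : 0 < r -> k.+1%:R^-1 <= r ->
  (\int[mu]_x (\1_(ball x0 r) x * `|quot v k x|)%:E <=
   (4 * (2 * (1 + 2 * `|v|)) ^+ m.+1 * r ^+ m)%:E)%E.
Proof.
move=> r0 tr; pose b := `|v|; have b0 : 0 <= b by exact: normr_ge0.
set t : R := k.+1%:R^-1; have t0 : 0 < t by rewrite invr_gt0.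
(* As [t <= r], the ball of radius [rho] contains the ball of radius [r] and its translate by
   [t *: v]. The ball of radius [rho'] contains every point that some [s *: v] with [|s| <= r] takes
   into the former. *)
pose rho := r * (1 + b); pose rho' := r * (1 + 2 * b).
pose g (x : lebT R m.+1) := \1_(ball x0 rho) x * f x.
have mind (x : V) c : measurable_fun setT (\1_(ball x c) : lebT R m.+1 -> R).
  exact: (measurable_indic (ball_measurable x c)).
have mg : measurable_fun setT g by exact: (measurable_funM (mind _ _) mf).
have ind01 (A : set V) x : \1_A x = 1 :> R \/ \1_A x = 0 :> R.
  by rewrite indicE; case: (_ \in _); [left|right].
have indT (A : set V) x : A x -> \1_A x = 1 :> R by move=> Ax; rewrite indicE mem_set.
have indF (A : set V) x : ~ A x -> \1_A x = 0 :> R by move=> Ax; rewrite indicE memNset.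
have fge0 x : 0 <= f x by exact: falpha_ge0.
have g0 x : 0 <= g x by apply: mulr_ge0 => //; case: (ind01 (ball x0 rho) x) => ->.
have uni x (w : V) (a c d : R) : a <= c -> c <= d ->
     Num.min (g (x + a *: w)) (g (x + d *: w)) <= g (x + c *: w).
  move=> ac cd; rewrite /g.
  have [xa|nxa] := pselect (ball x0 rho (x + a *: w)); last first.
    by rewrite (indF _ _ nxa) mul0r ge_min g0.
  have [xd|nxd] := pselect (ball x0 rho (x + d *: w)); last first.
    by rewrite (indF _ _ nxd) mul0r ge_min (g0 (x + c *: w)) orbT.
  suff xc : ball x0 rho (x + c *: w).
    by rewrite !indT// !mul1r; exact: falpha_line_unimodal.
  move: xa xd => /ball_normP xa /ball_normP xd; apply/ball_normP.
  have [dc|dc] := eqVneq a d.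
    suff -> : c = d by [].
    by apply/eqP; rewrite eq_le cd -dc ac.
  have ad : 0 < d - a.
    by rewrite subr_gt0 lt_neqAle dc (le_trans ac).
  have [th th0 [th1 cE]] : exists2 th : R, 0 <= th & th <= 1 /\ c = (1 - th) * a + th * d.
    exists ((c - a) / (d - a)); first by apply: divr_ge0; [rewrite subr_ge0|exact: ltW].
    split; first by rewrite ler_pdivrMr// mul1r lerD2r.
    by field; rewrite gt_eqF.
  have -> : x0 - (x + c *: w) = (1 - th) *: (x0 - (x + a *: w)) + th *: (x0 - (x + d *: w)).
    by rewrite cE; apply/rowP => i; rewrite !mxE; ring.
  apply: le_lt_trans (ler_normD _ _) _; rewrite !normrZ (ger0_norm th0) ger0_norm ?subr_ge0//.
  have [th00|thp] := eqVneq th 0.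
    by rewrite th00 subr0 mul1r mul0r addr0.
  have tp : 0 < th by rewrite lt_neqAle eq_sym thp.
  have h1 : (1 - th) * `|x0 - (x + a *: w)| <= (1 - th) * rho.
    by rewrite ler_wpM2l ?subr_ge0// ltW.
  have h2 : th * `|x0 - (x + d *: w)| < th * rho by rewrite ltr_pM2l.
  lra.
pose K := Num.truncn (r / t).
have rt : 1 <= r / t by rewrite ler_pdivlMr// mul1r.
have Kle : K%:R <= r / t by rewrite truncn_le (le_trans _ rt).
have Kge : r / t < K.+1%:R by exact: truncnS_gt.
have K1 : 1 <= K%:R :> R.
  by rewrite ler1n truncn_gt0.
have Kt : K%:R * t <= r by rewrite -ler_pdivlMr.
pose B (x : lebT R m.+1) := (\1_(ball x0 rho') x : R)%:E.
have mB : measurable_fun setT B by exact/measurable_EFinP/mind.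
have gB x s : `|s| <= K%:R * t -> ((g (x + s *: v))%:E <= B x)%E.
  move=> sK; rewrite /g /B lee_fin.
  have [xs|nxs] := pselect (ball x0 rho (x + s *: v)); last first.
    by rewrite (indF _ _ nxs) mul0r; case: (ind01 (ball x0 rho') x) => ->.
  move/ball_normP : (xs) => xs'.
  have xr : ball x0 rho' x.
    apply/ball_normP; rewrite -(addrK (s *: v) x) opprB addrA addrAC.
    apply: le_lt_trans (ler_normD _ _) _.
    have : `|s *: v| <= r * b.
      by rewrite normrZ ler_wpM2r//; exact: le_trans sK Kt.
    by move: xs'; rewrite /rho /rho'; lra.
  by rewrite !indT// mul1r; exact: falpha_le1.
have main := ge0_integral_abs_increment mg g0 uni mB (ltW t0) gB.
have rho0 : 0 <= rho' by rewrite mulr_ge0 ?(ltW r0)// addr_ge0// mulr_ge0.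
have iB : (\int[mu]_x B x <= ((2 * rho') ^+ m.+1)%:E)%E.
  have mb : measurable (ball x0 rho' : set (lebT R m.+1)) := ball_measurable x0 rho'.
  by rewrite (integral_indic _ measurableT mb) setIT; exact: lebn_ball_le.
have mdg : measurable_fun setT (fun x : lebT R m.+1 => `|g (x + t *: v) - g x|).
  exact: (measurableT_comp (@normr_measurable R setT)
    (measurable_funB (measurable_shift_fun (t *: v) mg) mg)).
apply: (@le_trans _ _ (\int[mu]_x (k.+1%:R * `|g (x + t *: v)%R - g x|)%:E)%E).
  apply: ge0_le_integral_EFin.
  - exact: (measurable_funM (mind _ _) (measurableT_comp (@normr_measurable R setT) (mquot v k))).
  - exact: (measurable_funM (measurable_cst _) mdg).
  - by move=> x; apply: mulr_ge0 => //; case: (ind01 (ball x0 r) x) => ->.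
  - move=> x; have [xr|nxr] := pselect (ball x0 r x); last first.
      by rewrite (indF _ _ nxr) mul0r mulr_ge0.
    have xr1 : ball x0 rho x.
      apply: le_ball xr; rewrite /rho ler_peMr ?(ltW r0)//; lra.
    have xr2 : ball x0 rho (x + t *: v).
      move/ball_normP : (xr) => xr'; apply/ball_normP; rewrite opprD addrA.
      apply: le_lt_trans (ler_normB _ _) _; rewrite normrZ (gtr0_norm t0).
      have : t * `|v| <= r * b by rewrite ler_wpM2r.
      rewrite /rho; lra.
    rewrite (indT _ _ xr) mul1r /shift_quotient normrM gtr0_norm ?ltr0n// /g.
    by rewrite (indT _ _ xr1) (indT _ _ xr2) !mul1r.
have dg0 (x : lebT R m.+1) : 0 <= `|g (x + t *: v) - g x| by exact: normr_ge0.
rewrite (ge0_integralZl_real mu (ler0n R k.+1) mdg dg0).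
set J := (\int[mu]_x _)%E in main *.
have J0 : (0 <= J)%E by apply: integral_ge0 => x _; rewrite lee_fin.
(* This is [r / t < K + 1 <= 2 * K], where [1 <= K] because [t <= r]. *)
have kK : (k.+1%:R : R) <= 2 / r * K%:R.
  have -> : (k.+1%:R : R) = t^-1 by rewrite invrK.
  rewrite mulrAC ler_pdivlMr// [leLHS]mulrC.
  move: Kge; rewrite -natr1 -/(r / t); lra.
apply: (@le_trans _ _ ((2 / r * K%:R)%:E * J)%E); first by rewrite lee_wpmul2r// lee_fin.
rewrite EFinM -muleA.
apply: (@le_trans _ _ ((2 / r)%:E * (((2 * rho') ^+ m.+1)%:E + ((2 * rho') ^+ m.+1)%:E))%E).
  rewrite lee_wpmul2l//; first by rewrite lee_fin divr_ge0// ltW.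
  by apply: le_trans main _; exact: leeD.
rewrite -EFinD -EFinM lee_fin /rho' le_eqVlt; apply/orP; left; apply/eqP.
rewrite [in LHS](_ : 2 * (r * (1 + 2 * b)) = (2 * (1 + 2 * b)) * r); last by ring.
rewrite exprMn [r ^+ m.+1]exprS; field.
by rewrite gt_eqF.
Qed.
End uniform_excess.

Lemma measurable_sum_ord d (T : measurableType d) (R : realType) (J : nat) (a : nat -> T -> R) :
  (forall j, measurable_fun setT (a j)) ->
  measurable_fun setT (fun x => \sum_(j < J) a j x).
Proof. by move=> ma; exact: (@measurable_sum _ _ _ setT _ _ (fun j : 'I_J => a j)). Qed.

Lemma ge0_integral_sum_EFin d (T : measurableType d) (R : realType)
    (mu : {measure set T -> \bar R}) (J : nat) (a : nat -> T -> R) :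
  (forall j, measurable_fun setT (a j)) -> (forall j x, 0 <= a j x) ->
  (\int[mu]_x (\sum_(j < J) a j x)%:E = \sum_(j < J) \int[mu]_x (a j x)%:E)%E.
Proof.
move=> ma a0; under eq_integral do rewrite -sumEFin.
by rewrite ge0_integral_sum// => *; rewrite ?lee_fin//; exact/measurable_EFinP.
Qed.

(** The part of a number above the cap, [a - min s a], is nonexpansive in [a]. *)
Lemma excess_over_minr_le (R : realType) (s a c : R) :
  `|a - c - (Num.min s a - Num.min s c)| <= `|a - c|.
Proof.
have n1 := ler_norm (a - c); have n2 := ler_norm (- (a - c)).
rewrite normrN in n2; rewrite ler_norml.
by have [?|?] := leP s a; have [?|?] := leP s c; lra.
Qed.

Section uniformly_small_excess.
Variables (R : realType) (m : nat) (alpha : R).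
Local Notation V := 'rV[R]_m.+1.
Variable phi : V -> \bar R.
Hypotheses (alpha0 : alpha < 0) (alphan : - (m.+1%:R)^-1 < alpha).
Hypotheses (cphi : convex_efun phi) (phi0 : forall x, (0 <= phi x)%E).
Hypotheses (lphi : lower_semicontinuous phi) (coer : coercive phi).
Hypothesis haus : hausdorff (m.+1%:R - 1)
    [set x | (closure (edom phi) `\` interior (edom phi)) x /\
             ~ {for x, continuous phi}] = 0%E.
Local Notation U := (interior (edom phi)).
Local Notation f := (falpha alpha phi).
Local Notation mu := (lebn R m.+1).
Local Notation quot := (shift_quotient alpha phi).
Let mf : measurable_fun setT (f : lebT R m.+1 -> R) := falpha_measurable alpha0 phi0 lphi.
Let mquot v k : measurable_fun setT (quot v k : lebT R m.+1 -> R) :=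
  measurable_shift_quotient alpha0 phi0 lphi v k.

Lemma near_all_lt (J : nat) (P : nat -> nat -> Prop) :
  (forall j, (j < J)%N -> \forall k \near \oo, P j k) ->
  \forall k \near \oo, forall j, (j < J)%N -> P j k.
Proof.
elim: J => [|J IH] H; first by apply: nearW => k j.
have h1 := IH (fun j jJ => H j (ltnW jJ)); have h2 := H J (ltnSn J).
apply: filterS2 h1 h2 => k h1 h2 j; rewrite ltnS leq_eqVlt => /predU1P[->//|]; exact: h1.
Qed.

(** The set on the left is compact, and the near-covering form of compactness directly returns a
    bound on the indices. Finitely many balls are wanted so that one step size can be small against
    all their radii. *)
Lemma superlevel_boundary_cover s (x : nat -> V) (r : nat -> R) : 0 < s ->
  edom phi `\` U `<=` \bigcup_k ball (x k) (r k) ->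
  exists J : nat, [set y | s <= f y] `\` U `<=` [set y | exists2 j, (j < J)%N & ball (x j) (r j) y].
Proof.
move=> s0 cov.
have cK : compact ([set y | s <= f y] `\` U).
  rewrite setDE; apply: compact_closedI; last first.
    by apply: open_closedC; exact: open_interior.
  exact: superlevel_compact.
have /compact_near_coveringP/(_ nat \oo (fun J y => exists2 j, (j < J)%N & ball (x j) (r j) y)) := cK.
case.
  move=> y [sy nUy]; have dy : edom phi y.
    by apply/not_notP => /(falpha_ndom alpha phi0) fy; move: sy; rewrite /= fy leNgt s0.
  have [j _ jy] := cov y (conj dy nUy).
  exists (ball (x j) (r j), [set J | (j < J)%N]) => /=.
    split; first by apply: open_nbhs_nbhs; split => //; exact: ball_open.
    by exists j.+1.
  by move=> [y' J] [/= y'j jJ]; exists j.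
by move=> J _ /(_ J (leqnn J)) HJ; exists J => y /HJ.
Qed.

(** A single integer plays the Lipschitz constant and bounds the admissible step, so that the
    property is eventual in [k] and the near-covering form of compactness applies at infinity. *)
Lemma compact_lipschitz (W : set V) v : compact W -> W `<=` U ->
  exists k1 : nat, forall y t, W y -> `|t| <= k1.+1%:R^-1 ->
    U (y + t *: v) /\ `|f (y + t *: v) - f y| <= k1%:R * `|t|.
Proof.
move=> cW WU.
have /compact_near_coveringP/(_ nat \oo (fun k y => forall t, `|t| <= k.+1%:R^-1 ->
    U (y + t *: v) /\ `|f (y + t *: v) - f y| <= k%:R * `|t|)) := cW.
case.
  move=> y /WU Uy.
  have [d [L [d0 L0 H]]] := falpha_locally_lipschitz alpha0 cphi phi0 v Uy.
  have [N _ HN] := near_invS d0.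
  exists (ball y d, [set k | (maxn N (Num.truncn L).+1 <= k)%N]) => /=.
    split; first by apply: open_nbhs_nbhs; split; [exact: ball_open|exact: ballxx].
    by exists (maxn N (Num.truncn L).+1).
  move=> [y' k] [/= /ball_normP yy']; rewrite geq_max => /andP[Nk Lk] t tk.
  have [] := H y' t _ _; first by rewrite distrC.
    exact: le_lt_trans tk (HN k Nk).
  move=> Ut ft; split => //; apply: le_trans ft _; rewrite ler_wpM2r//.
  by apply: ltW; apply: lt_le_trans (truncnS_gt L) _; rewrite ler_nat.
by move=> k _ /(_ k (leqnn k)) Hk; exists k => y t Wy; exact: (Hk y Wy).
Qed.

(** The quotient is that of [min s f] plus a rest. The former has a small integral over the whole
    space. Near the finitely many balls covering the bad boundary points the localized bound applies
    to the full quotient. Elsewhere the rest vanishes, both values being at most [s], or is bounded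
    by the Lipschitz constant on the compact set [W]; [g] is that constant on a bounded part of
    [U]. *)
Lemma excess_small v e : 0 < e -> exists g : lebT R m.+1 -> R, [/\ measurable_fun setT g,
     (forall x, 0 <= g x), (forall x, ~ U x -> g x = 0),
     (\int[mu]_x (g x)%:E < +oo)%E &
     exists k0, forall k, (k0 <= k)%N ->
       (\int[mu]_x (excess (g x) (quot v k x))%:E <= e%:E)%E].
Proof.
move=> e0; pose b := `|v|; have b0 : 0 <= b by exact: normr_ge0.
have [E [mE E0 Eoo fE]] := falpha_envelope alpha0 alphan phi0 coer v.
have e4 : 0 < e / 4 by rewrite divr_gt0.
have [s s0 sE] := integral_mine_small mE E0 Eoo e4.
(* The constant of [localized_increment] for balls of doubled radius, whence the factor [2 ^+ m]. *)
pose C := 4 * (2 * (1 + 2 * b)) ^+ m.+1 * 2 ^+ m.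
have C0 : 0 < C.
  by rewrite !mulr_gt0 ?exprn_gt0// mulr_gt0// ltr_wpDr// mulr_ge0.
have eC : 0 < e / 2 / C by rewrite !divr_gt0.
have [x [r [w [cov w0 rw wsum]]]] := hausdorff_null_cover haus eC.
have cov' : edom phi `\` U `<=` \bigcup_k ball (x k) (r k).
  by move=> y [dy nUy]; apply: cov; exact: boundary_discontinuous.
have [J HJ] := superlevel_boundary_cover s0 cov'.
pose V0 : set V := \bigcup_(j in [set j | (j < J)%N]) ball (x j) (r j).
pose W := [set y | s <= f y] `\` V0.
have cA := superlevel_compact alpha0 phi0 lphi coer s0.
have cW : compact W.
  rewrite /W setDE; apply: compact_closedI; first exact: cA.
  by apply: open_closedC; apply: bigcup_open => j _; exact: ball_open.
have WU : W `<=` U.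
  move=> y [sy nV]; apply/not_notP => nUy; apply: nV.
  by have [j jJ jy] := HJ y (conj sy nUy); exists j.
have [k1 Hk1] := compact_lipschitz v cW WU.
have [rho0 rho00 Hrho] : exists2 rho : R, 0 < rho & forall y, s <= f y -> `|y| < rho.
  have [M [_ HM]] := compact_bounded cA.
  exists (`|M| + 2) => [|y sy]; first by rewrite ltr_wpDl.
  have := HM (`|M| + 1) _ y sy; have := ler_norm M => h /(_ _)/le_lt_trans; apply; lra.
(* Room for a shift: [y] may lie outside [W] while [y + t *: v] lies in it. *)
pose rho := rho0 + b.
pose D : set (lebT R m.+1) := U `&` ball (0 : V) rho.
have mD : measurable D.
  apply: measurableI; last exact: ball_measurable.
  by apply: open_lebmeasurable; exact: open_interior.
pose g (y : lebT R m.+1) : R := k1%:R * \1_D y.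
have mI : measurable_fun setT (\1_D : lebT R m.+1 -> R) := measurable_indic mD.
have mg : measurable_fun setT g := measurable_funM (measurable_cst _) mI.
have g0 y : 0 <= g y by rewrite mulr_ge0// indicE.
have I0 (y : lebT R m.+1) : 0 <= \1_D y :> R by rewrite indicE.
exists g; split => //.
- by move=> y nUy; rewrite /g indicE memNset ?mulr0// => -[].
- rewrite (ge0_integralZl_real mu (ler0n R k1) mI I0) (integral_indic _ measurableT mD) setIT.
  apply: (@le_lt_trans _ _ (k1%:R%:E * ((2 * rho) ^+ m.+1)%:E)%E); last by rewrite -EFinM ltry.
  rewrite lee_wpmul2l ?lee_fin//.
  apply: (@le_trans _ _ (mu (ball (0%R : V) rho))).
    by apply: le_outer_measure => y [].
  by apply: lebn_ball_le; rewrite addr_ge0// ltW.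
(* One threshold serves all [J] balls: a point whose translate falls into ball [j] then lies in the
   doubled ball, and the step is short enough for [localized_increment] there. *)
have near_r : \forall k \near \oo, forall j, (j < J)%N -> 0 < r j ->
    (k.+1%:R^-1 : R) * b < r j /\ (k.+1%:R^-1 : R) <= 2 * r j.
  apply: near_all_lt => j _; have [r0|r0] := leP (r j) 0.
    by apply: nearW => k.
  have d0 : 0 < Num.min (r j / (b + 1)) (2 * r j).
    by rewrite lt_min divr_gt0 ?mulr_gt0// ltr_wpDl.
  apply: filterS (near_invS d0) => k; rewrite lt_min => /andP[k2 k3] _; split; last exact: ltW.
  rewrite ltr_pdivlMr ?ltr_wpDl// in k2; apply: le_lt_trans k2.
  by rewrite ler_wpM2l// lerDl.
have [k2 _ Hk2] := near_r.
exists (maxn k1 k2) => k; rewrite geq_max => /andP[kk1 kk2].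
set t : R := k.+1%:R^-1; have t0 : 0 < t by rewrite invr_gt0.
have t1 : t <= 1 by rewrite invf_le1// ler1n.
have tk1 : t <= k1.+1%:R^-1 by rewrite lef_pV2 ?posrE// ler_nat ltnS.
have tbb : t * b <= b by rewrite ler_piMl.
pose T1 (y : lebT R m.+1) : R := k.+1%:R * `|Num.min s (f (y + t *: v)) - Num.min s (f y)|.
pose T2 j (y : lebT R m.+1) : R := \1_(ball (x j) (2 * r j)) y * `|quot v k y|.
have T10 y : 0 <= T1 y by rewrite mulr_ge0.
have T20 j y : 0 <= T2 j y by rewrite mulr_ge0// indicE.
have kt : k.+1%:R * t = 1 by rewrite mulfV// pnatr_eq0.
(* If what the quotient of [min s f] leaves over is at most [g], the excess over [g] is charged to
   [T1]. *)
have far y : `|quot v k y - k.+1%:R * (Num.min s (f (y + t *: v)) - Num.min s (f y))| <= g y ->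
    excess (g y) (quot v k y) <= T1 y.
  move=> h; rewrite /excess ge_max T10 andbT lerBlDr addrC /T1.
  rewrite -[X in _ <= _ + X * _](@ger0_norm _ k.+1%:R)// -normrM.
  rewrite -[X in `|X| <= _](subrK (k.+1%:R * (Num.min s (f (y + t *: v)) - Num.min s (f y)))).
  by apply: le_trans (ler_normD _ _) _; rewrite lerD2r.
have diffle y : f y <= s -> f (y + t *: v) <= s ->
    excess (g y) (quot v k y) <= T1 y.
  move=> h1 h2; apply: far; rewrite /shift_quotient -/t.
  by rewrite !min_r// subrr normr0.
have lipcase y : D y -> `|f (y + t *: v) - f y| <= k1%:R * t ->
    excess (g y) (quot v k y) <= T1 y.
  move=> Dy h; apply: far; rewrite /shift_quotient -/t /g indicE mem_set// mulr1.
  rewrite -mulrBr normrM ger0_norm//.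
  have : `|f (y + t *: v) - f y - (Num.min s (f (y + t *: v)) - Num.min s (f y))|
      <= `|f (y + t *: v) - f y|.
    exact: excess_over_minr_le.
  move=> /le_trans/(_ h) h2.
  apply: (@le_trans _ _ (k.+1%:R * (k1%:R * t))); first by rewrite ler_wpM2l.
  by rewrite mulrCA kt mulr1.
have pointwise y : excess (g y) (quot v k y) <= T1 y + \sum_(j < J) T2 j y.
  have S0 : 0 <= \sum_(j < J) T2 j y by apply: sumr_ge0 => j _.
  have [[j jJ jy]|nQ] := pselect (exists2 j, (j < J)%N & ball (x j) (2 * r j) y).
    apply: (@le_trans _ _ (T2 j y)); last first.
      rewrite (bigD1 (Ordinal jJ))//= addrCA lerDl addr_ge0//; exact: sumr_ge0.
    rewrite /T2 indicE mem_set// mul1r /excess ge_max normr_ge0 andbT lerBlDr lerDl.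
    exact: g0.
  apply: (@le_trans _ _ (T1 y)); last by rewrite lerDl.
  have [fy|sy] := leP (f y) s; last first.
    have Wy : W y.
      split; first exact: ltW.
      move=> [j /= jJ jy]; apply: nQ; exists j => //; have /ball_rowP[rj _] := jy.
      by apply: le_ball jy; rewrite ler_peMl ?(ltW rj)// ler1n.
    have tn : `|t| <= k1.+1%:R^-1 by rewrite gtr0_norm.
    have [_ ft] := Hk1 y t Wy tn; rewrite (gtr0_norm t0) in ft.
    apply: lipcase.
      split; first exact: WU.
      apply/ball_normP; rewrite sub0r normrN /rho.
      by have := Hrho y (ltW sy); lra.
    exact: ft.
  (* Here [f y <= s]. If the translate exceeds [s], it lies in [W] and the Lipschitz bound is
     applied from it back to [y]. *)
  have [fty|sty] := leP (f (y + t *: v)) s; first exact: diffle.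
  have tv : `|t *: v| = t * b by rewrite normrZ gtr0_norm.
  have Wy : W (y + t *: v).
    split; first exact: ltW.
    move=> [j /= jJ jy]; apply: nQ; exists j => //; have /ball_rowP[rj _] := jy.
    have [tb _] := Hk2 k kk2 j jJ rj.
    move/ball_normP : jy => jy; apply/ball_normP.
    rewrite -(addrK (t *: v) y) opprB addrA addrAC.
    apply: le_lt_trans (ler_normD _ _) _; rewrite tv -/t in tb *; lra.
  have tN : `|- t| <= k1.+1%:R^-1 by rewrite normrN gtr0_norm.
  have [Uy ft] := Hk1 (y + t *: v) (- t) Wy tN.
  rewrite scaleNr addrK in Uy ft; rewrite normrN (gtr0_norm t0) distrC in ft.
  apply: lipcase => //; split => //; apply/ball_normP; rewrite sub0r normrN /rho.
  rewrite -(addrK (t *: v) y); apply: le_lt_trans (ler_normB _ _) _.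
  by have := Hrho _ (ltW sty); rewrite tv; lra.
have mT1 : measurable_fun setT T1.
  have mg1 : measurable_fun setT (fun y : lebT R m.+1 => Num.min s (f y)) :=
    measurable_minr (measurable_cst s) mf.
  exact: (measurable_funM (measurable_cst _) (measurableT_comp (@normr_measurable R setT)
    (measurable_funB (measurable_shift_fun (t *: v) mg1) mg1))).
have mT2 j : measurable_fun setT (T2 j).
  exact: (measurable_funM (measurable_indic (ball_measurable (x j) (2 * r j)))
    (measurableT_comp (@normr_measurable R setT) (mquot v k))).
have mS : measurable_fun setT (fun y : lebT R m.+1 => \sum_(j < J) T2 j y).
  exact: (measurable_sum_ord J mT2).
have S0 y : 0 <= \sum_(j < J) T2 j y by apply: sumr_ge0.
apply: (@le_trans _ _ (\int[mu]_y (T1 y + \sum_(j < J) T2 j y)%:E)%E).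
  apply: (ge0_le_integral_EFin mu (measurable_excess mg (mquot v k)) (measurable_funD mT1 mS)) => // y.
  exact: excess_ge0.
rewrite (ge0_integral_EFinD mu mT1 mS T10 S0).
have I1 : (\int[mu]_y (T1 y)%:E <= (e / 2)%:E)%E.
  apply: le_trans (truncated_increment alpha0 cphi phi0 lphi k s0 mE fE) _.
  rewrite (_ : e / 2 = e / 4 + e / 4); last lra.
  by rewrite EFinD; apply: leeD.
have I2 : (\int[mu]_y (\sum_(j < J) T2 j y)%:E <= (e / 2)%:E)%E.
  have -> : (\int[mu]_y (\sum_(j < J) T2 j y)%:E = \sum_(j < J) \int[mu]_y (T2 j y)%:E)%E.
    exact: ge0_integral_sum_EFin.
  apply: (@le_trans _ _ (\sum_(j < J) (C * w j)%:E)%E).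
    apply: lee_sum => j _.
    have [r0|r0] := leP (r j) 0.
      rewrite integral0_eq; first by rewrite lee_fin mulr_ge0 ?(ltW C0).
      move=> y _; rewrite /T2 indicE memNset ?mul0r//.
      by move=> /ball_rowP[]; rewrite pmulr_rgt0// ltNge r0.
    have r20 : 0 < 2 * r j by rewrite mulr_gt0.
    have [_ tr] := Hk2 k kk2 j (ltn_ord j) r0.
    apply: le_trans (localized_increment alpha0 cphi phi0 lphi v (x j) r20 tr) _.
    have -> : 4 * (2 * (1 + 2 * `|v|)) ^+ m.+1 * (2 * r j) ^+ m = C * r j ^+ m.
      by rewrite /C -[RHS]mulrA -exprMn.
    have [_ rm] := rw j r0.
    by rewrite lee_fin; exact: (ler_wpM2l (ltW C0) rm).
  have sumC : (\sum_(j < J) (C * w j)%:E <= C%:E * (e / 2 / C)%:E)%E.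
    under eq_bigr do rewrite EFinM.
    rewrite -ge0_sume_distrr; last by move=> j _; rewrite lee_fin.
    rewrite lee_wpmul2l ?lee_fin ?(ltW C0)//; apply: le_trans wsum.
    rewrite -(big_mkord xpredT (fun j => (w j)%:E)).
    by apply: nneseries_lim_ge => j _ _; rewrite lee_fin.
  apply: le_trans sumC _; rewrite -EFinM lee_fin.
  by rewrite mulrC divfK// gt_eqF.
apply: le_trans (leeD I1 I2) _; rewrite -EFinD lee_fin; lra.
Qed.

End uniformly_small_excess.

(** * Densities, pushforwards and vanishing integrals *)

Section density.
Import HBNNSimple.
Local Open Scope ereal_scope.
Context d (X : measurableType d) (R : realType).
Variables (mu nu : {measure set X -> \bar R}) (w : X -> R).
Hypotheses (mw : measurable_fun setT w) (w0 : forall x, (0 <= w x)%R).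
Hypothesis nuE : forall A, measurable A -> nu A = \int[mu]_(x in A) (w x)%:E.

Let mwE : measurable_fun setT (EFin \o w).
Proof. exact/measurable_EFinP. Qed.

Lemma integral_density_nnsfun (h : {nnsfun X >-> R}) :
  \int[nu]_x (h x)%:E = \int[mu]_x ((h x)%:E * (w x)%:E).
Proof.
rewrite integralT_nnsfun sintegralE.
transitivity (\int[mu]_x \sum_(y \in range h) (y%:E * (\1_(h @^-1` [set y]) x * w x)%:E)).
  have mi y : measurable_fun setT (fun x => (\1_(h @^-1` [set y]) x * w x)%:E).
    by apply/measurable_EFinP/measurable_funM => //; exact: measurable_indic.
  have i0 (y : R) x : 0 <= (\1_(h @^-1` [set y]) x * w x)%:E by rewrite lee_fin mulr_ge0.
  have y0 y : y \in range h -> (0 <= y)%R by rewrite inE => -[x _ <-].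
  have neg (y : R) : (0 <= y)%R \/ h @^-1` [set y] = set0.
    by have [|yn] := leP 0%R y; [left|right; exact: preimage_nnfun0].
  have ty0 y x : 0 <= y%:E * (\1_(h @^-1` [set y]) x * w x)%:E.
    have [yp|->] := neg y; first by rewrite mule_ge0.
    by rewrite indic0 mul0r mule0.
  rewrite ge0_integral_fsum//; last by move=> y; exact: measurable_funeM.
  apply: eq_fsbigr => y yh; rewrite ge0_integralZl_EFin//; last exact: y0.
  rewrite nuE//; congr (_ * _); rewrite integral_mkcond; apply: eq_integral => x _.
  by rewrite epatch_indic/= EFinM muleC.
apply: eq_integral => x _; rewrite (fimfunE h x) -fsumEFin// ge0_mule_fsuml.
  by apply: eq_fsbigr => y _; rewrite !EFinM muleA.
by move=> y; exact: nnfun_muleindic_ge0.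
Qed.

Lemma integral_density (k : X -> \bar R) : measurable_fun setT k -> (forall x, 0 <= k x) ->
  \int[nu]_x k x = \int[mu]_x (k x * (w x)%:E).
Proof.
move=> mk k0; pose h := nnsfun_approx measurableT mk.
have hk x : EFin \o h ^~ x @ \oo --> k x by apply: cvg_nnsfun_approx.
have nd x m n : (m <= n)%N -> (h m x)%:E <= (h n x)%:E.
  by move=> mn; rewrite lee_fin; exact/lefP/nd_nnsfun_approx.
have mh n : measurable_fun setT (EFin \o h n) by exact/measurable_EFinP.
have h0 n x : 0 <= (h n x)%:E by rewrite lee_fin.
have L : \int[nu]_x (h n x)%:E @[n --> \oo] --> \int[nu]_x k x.
  have := @cvg_monotone_convergence _ _ _ nu setT measurableT (fun n => EFin \o h n)
    mh (fun n x _ => h0 n x) (fun x _ m n => nd x m n).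
  under eq_integral => x _.
    rewrite (_ : limn _ = k x); last by apply/cvg_lim => //; exact: hk.
    over.
  by [].
have M : \int[mu]_x ((h n x)%:E * (w x)%:E) @[n --> \oo] --> \int[mu]_x (k x * (w x)%:E).
  have hw0 n x : 0 <= (h n x)%:E * (w x)%:E by rewrite mule_ge0 ?lee_fin.
  have mhw n : measurable_fun setT (fun x => (h n x)%:E * (w x)%:E).
    exact: (emeasurable_funM (mh n) mwE).
  have ndw x m n : (m <= n)%N -> (h m x)%:E * (w x)%:E <= (h n x)%:E * (w x)%:E.
    by move=> mn; rewrite lee_wpmul2r ?lee_fin//; exact/lefP/nd_nnsfun_approx.
  have := @cvg_monotone_convergence _ _ _ mu setT measurableT
    (fun n x => (h n x)%:E * (w x)%:E) mhw (fun n x _ => hw0 n x) (fun x _ m n => ndw x m n).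
  under eq_integral => x _.
    rewrite (_ : limn _ = k x * (w x)%:E); last first.
      by apply/cvg_lim => //; apply: cvgeZr => //; exact: hk.
    over.
  by [].
have E : (fun n => \int[nu]_x (h n x)%:E) = (fun n => \int[mu]_x ((h n x)%:E * (w x)%:E)).
  by apply/funext => n; exact: integral_density_nnsfun.
by rewrite E in L; exact: (cvg_unique _ L M).
Qed.
End density.

(** The equality with [N] is one of functions on all sets, so a measure can replace the raw set
    function inside integrals and supports. *)
Lemma pushforward_density d1 d2 (X : measurableType d1) (Y : measurableType d2) (R : realType)
    (mu : {measure set X -> \bar R}) (D : set X) (w : X -> R) (T : X -> Y) :
  measurable D -> measurable_fun D T -> measurable_fun D w -> (forall x, 0 <= w x) ->
  exists N : {measure set Y -> \bar R},
    (fun A : set Y => \int[mu]_(x in [set x | D x /\ A (T x)]) (w x)%:E)%E = N /\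
    forall h : Y -> \bar R, measurable_fun setT h -> (forall y, 0 <= h y)%E ->
      (\int[N]_y h y = \int[mu]_(x in D) (h (T x) * (w x)%:E))%E.
Proof.
(* Outside [D] the map takes a default value, harmless because the weight is 0 there. *)
move=> mD mT mw w0; pose w' := w \_ D; pose T' := T \_ D.
have mw' : measurable_fun setT w' by apply/(measurable_restrictT _ mD).
have mT' : measurable_fun setT T' by apply/(measurable_restrictT _ mD).
have w'0 x : 0 <= w' x by rewrite /w' patchE; case: ifP.
have mwE : measurable_fun setT (EFin \o w') by exact/measurable_EFinP.
have wE0 x : (0 <= (EFin \o w') x)%E by rewrite /= lee_fin.
pose nu0 := fun A : set X => (\int[mu]_(x in A) (EFin \o w') x)%E.
have nu00 : nu0 set0 = 0%E by rewrite /nu0 integral_set0.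
have nu0_ge0 A : (0 <= nu0 A)%E by apply: integral_ge0 => x _; exact: wE0.
pose nuM := isMeasure.Build _ X R nu0 nu00 nu0_ge0
  (@semi_sigma_additive_nng_induced _ X R mu _ mwE wE0).
pose nu : {measure set X -> \bar R} := HB.pack nu0 nuM.
have push A : pushforward nu T' A = (\int[mu]_(x in [set x | D x /\ A (T x)]) (w x)%:E)%E.
  rewrite /pushforward /= /nu0 integral_mkcond [RHS]integral_mkcond.
  apply: eq_integral => x _; rewrite !patchE /= /w' /T' patchE.
  have [Dx|nDx] := boolP (x \in D); last first.
    rewrite (@memNset _ [set x | D x /\ A (T x)]); first by case: ifP.
    by move=> [Dx _]; move/negP : nDx; apply; exact: mem_set.
  congr (if _ then _ else _); apply/idP/idP => /set_mem/= h; apply/mem_set => /=.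
    by move: h; rewrite patchE Dx; split => //; exact: set_mem.
  by rewrite patchE Dx; case: h.
pose N : {measure set Y -> \bar R} :=
  measure_function_pushforward__canonical__measure_function_Measure nu mT'.
exists N; split; first by apply/funext => A; rewrite -push.
move=> h mh h0.
have hT0 x : (0 <= h (T' x))%E by exact: h0.
have mhT : measurable_fun setT (h \o T') by exact: measurableT_comp.
transitivity (\int[pushforward nu T']_y h y)%E; first by [].
rewrite ge0_integral_pushforward//.
rewrite preimage_setT (integral_density (mu := mu) mw' w'0)//.
rewrite [RHS]integral_mkcond; apply: eq_integral => x _.
rewrite patchE /= /w' /T' !patchE; case: ifP => //= _; exact: mule0.
Qed.

Lemma integral_eq0_of_L1 d (T : measurableType d) (R : realType)
    (mu : {measure set T -> \bar R}) (D : nat -> T -> R) (G : T -> R) :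
  (forall k, mu.-integrable setT (EFin \o D k)) ->
  (forall k, \int[mu]_x (D k x)%:E = 0)%E ->
  measurable_fun setT G -> (\int[mu]_x `|G x|%:E < +oo)%E ->
  (forall e : R, 0 < e -> exists k0, forall k, (k0 <= k)%N ->
    (\int[mu]_x `|D k x - G x|%:E <= e%:E)%E) ->
  (\int[mu]_x (G x)%:E = 0)%E.
Proof.
move=> iD D0 mG Goo DG.
have iG : mu.-integrable setT (EFin \o G).
  by apply/integrableP; split => //; exact/measurable_EFinP.
apply/eqP; rewrite -abse_eq0 eq_le abse_ge0 andbT.
apply/lee_addgt0Pr => e e0; rewrite add0e; have [k0 /(_ k0 (leqnn _)) h] := DG e e0.
have -> : (\int[mu]_x (G x)%:E = - \int[mu]_x ((D k0 x)%:E - (G x)%:E))%E.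
  by rewrite (integralB_EFin measurableT (iD k0) iG) D0 sub0e oppeK.
rewrite abseN; apply: le_trans h; apply: le_trans (le_abse_integral mu measurableT _) _.
  apply: emeasurable_funB; first exact: measurable_int (iD k0).
  exact: measurable_int iG.
by under eq_integral do rewrite -EFinB abse_EFin.
Qed.

Lemma integral_increment0 d (T : measurableType d) (R : realType)
    (mu : {measure set T -> \bar R}) (h : T -> T) (f : T -> R) (c : R) :
  measurable_fun setT h -> (forall A, mu (h @^-1` A) = mu A) ->
  measurable_fun setT f -> (forall x, 0 <= f x) -> (\int[mu]_x (f x)%:E < +oo)%E ->
  mu.-integrable setT (EFin \o (fun x => c * (f (h x) - f x))) /\
  (\int[mu]_x (c * (f (h x) - f x))%:E = 0)%E.
Proof.
move=> mh muh mf f0 foo.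
have mfh : measurable_fun setT (fun x => f (h x)) by exact: measurableT_comp.
have mEf : measurable_fun setT (EFin \o f) by exact/measurable_EFinP.
have inv := ge0_integral_invariant mh muh mEf (fun x => f0 x : (0 <= (EFin \o f) x)%E).
have i1 : mu.-integrable setT (EFin \o f).
  apply/integrableP; split => //; under eq_integral do rewrite /= ger0_norm//.
  exact: foo.
have i2 : mu.-integrable setT (EFin \o (fun x => f (h x))).
  apply/integrableP; split; first exact/measurable_EFinP.
  by under eq_integral do rewrite /= ger0_norm//; rewrite [X in (X < _)%E]inv.
have i3 : mu.-integrable setT (fun x => ((f (h x))%:E - (f x)%:E)%E).
  exact: integrableB.
split.
  rewrite (_ : EFin \o _ = fun x => (c%:E * ((f (h x))%:E - (f x)%:E))%E).
    exact: integrableZl.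
  by apply/funext => x /=; rewrite EFinM EFinB.
under eq_integral do rewrite EFinM EFinB.
rewrite integralZl// (integralB_EFin measurableT i2 i1) [X in (X - _)%E]inv subee ?mule0//.
exact: integrable_fin_num.
Qed.

(** The change over [K] steps telescopes, and by invariance every step has the same integral. *)
Lemma integral_abs_iter d (T : measurableType d) (R : realType)
    (mu : {measure set T -> \bar R}) (h : T -> T) (f : T -> R) (K : nat) :
  measurable_fun setT h -> (forall A, mu (h @^-1` A) = mu A) -> measurable_fun setT f ->
  (\int[mu]_x `|f (iter K h x) - f x|%:E <= \int[mu]_x (K%:R * `|f (h x) - f x|)%:E)%E.
Proof.
move=> mh muh mf; pose g x := `|f (h x) - f x|.
have mg : measurable_fun setT g.
  by apply: measurableT_comp => //; apply: measurable_funB => //; exact: measurableT_comp.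
have mEg : measurable_fun setT (EFin \o g) by exact/measurable_EFinP.
have miter j : measurable_fun setT (fun x => f (iter j h x)).
  apply: measurableT_comp => //; elim: j => [|j IH]; first exact: measurable_id.
  exact: measurableT_comp.
have gi j := ge0_integral_iter j mh muh mEg (fun x => normr_ge0 _ : (0 <= (EFin \o g) x)%E).
have mgi j : measurable_fun setT (fun x => g (iter j h x)).
  by apply/measurable_EFinP; exact: (gi j).1.
apply: (@le_trans _ _ (\int[mu]_x (\sum_(j < K) g (iter j h x))%:E)%E).
  apply: ge0_le_integral_EFin => //.
  - by apply: measurableT_comp => //; exact: measurable_funB.
  - exact: measurable_sum_ord mgi.
  - move=> x; elim: K => [|K IH]; first by rewrite subrr normr0 big_ord0.
    rewrite big_ord_recr/= -(subrK (f (iter K h x)) (f (h _))) -addrA addrC.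
    by apply: le_trans (ler_normD _ _) _; rewrite lerD2r.
rewrite (@ge0_integral_sum_EFin _ _ _ mu K (fun j x => g (iter j h x)) mgi (fun j x => normr_ge0 _)).
rewrite (ge0_integralZl_real mu (ler0n R K) mg (fun x => normr_ge0 _)).
rewrite (eq_bigr (fun=> \int[mu]_x (g x)%:E)%E); last by move=> j _; exact: (gi j).2.
have g0 : (0 <= \int[mu]_x (g x)%:E)%E by apply: integral_ge0 => x _; rewrite lee_fin normr_ge0.
elim: K => [|K IH]; first by rewrite big_ord0 mul0e.
rewrite big_ord_recr/= -natr1 EFinD ge0_muleDl ?lee_fin// mul1e.
by apply: leeD.
Qed.

Lemma npos_integral0_ae d (T : measurableType d) (R : realType)
    (mu : {measure set T -> \bar R}) (H : T -> R) :
  mu.-integrable setT (EFin \o H) -> (forall x, H x <= 0) -> (\int[mu]_x (H x)%:E = 0)%E ->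
  mu.-negligible [set x | H x != 0].
Proof.
move=> iH H0 iH0; have mH := measurable_int mu iH.
have aH : (\int[mu]_x `|(EFin \o H) x| = 0)%E.
  transitivity (\int[mu]_x (- (EFin \o H) x))%E.
    by apply: eq_integral => x _; rewrite /= ler0_norm ?EFinN.
  by rewrite integralN ?[X in (- X)%E]iH0 ?oppe0//; exact: integrable_add_def.
have [N [mN N0 HN]] := (ae_eq_integral_abs mu measurableT mH).1 aH.
by exists N; split => // x /= /eqP Hx; apply: HN => /= /(_ I) [].
Qed.

(** * Directional derivatives and differentiability *)

Section slope.
Variables (R : realType) (m : nat) (alpha : R).
Local Notation V := 'rV[R]_m.+1.
Variable phi : V -> \bar R.
Hypotheses (alpha0 : alpha < 0) (alphan : - (m.+1%:R)^-1 < alpha).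
Hypotheses (cphi : convex_efun phi) (phi0 : forall x, (0 <= phi x)%E).
Hypotheses (lphi : lower_semicontinuous phi) (coer : coercive phi).
Hypothesis haus : hausdorff (m.+1%:R - 1)
    [set x | (closure (edom phi) `\` interior (edom phi)) x /\
             ~ {for x, continuous phi}] = 0%E.
Hypothesis int_fin : (\int[lebn R m.+1]_x (falpha alpha phi x)%:E < +oo)%E.
Local Notation U := (interior (edom phi)).
Local Notation F := (fun y => fine (phi y)).
Local Notation f := (falpha alpha phi).
Local Notation mu := (lebn R m.+1).
Local Notation quot := (shift_quotient alpha phi).
Let mf : measurable_fun setT (f : lebT R m.+1 -> R) := falpha_measurable alpha0 phi0 lphi.
Let mquot v k : measurable_fun setT (quot v k : lebT R m.+1 -> R) :=
  measurable_shift_quotient alpha0 phi0 lphi v k.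
Let mU : measurable (U : set (lebT R m.+1)) := open_lebmeasurable (@open_interior _ _).

Lemma dirder_sum_ge0 x v : U x -> 0 <= dirder phi x v + dirder phi x (- v).
Proof.
move=> Ux; rewrite leNgt; apply/negP => neg.
(* A quarter of the defect, so that the two errors together leave half of it negative. *)
pose e := - (dirder phi x v + dirder phi x (- v)) / 4.
have e0 : 0 < e by rewrite divr_gt0// oppr_gt0.
have [d1 d10 H1] := dirder_approx cphi phi0 v Ux e0.
have [d2 d20 H2] := dirder_approx cphi phi0 (- v) Ux e0.
pose t := Num.min d1 d2 / 2.
have min0 : 0 < Num.min d1 d2 by rewrite lt_min d10.
have t0 : 0 < t by rewrite divr_gt0.
have tm : t < Num.min d1 d2 by rewrite /t; lra.
have [td1 td2] : t < d1 /\ t < d2 by move: tm; rewrite lt_min => /andP.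
have [dx1 /andP[_ h1]] := H1 t (ltW t0) td1.
have [dx2 /andP[_ h2]] := H2 t (ltW t0) td2.
have := @epi_convex _ _ phi (x + t *: v) (x + t *: - v) (F (x + t *: v)) (F (x + t *: - v)) 2^-1 cphi.
rewrite !(phi_fineK phi0)// => /(_ _ _ (lexx _) (lexx _)).
have -> : (1 - 2^-1) *: (x + t *: v) + 2^-1 *: (x + t *: - v) = x.
  by apply/rowP => i; rewrite !mxE; field.
rewrite -(phi_fineK phi0 (interior_edom Ux)) lee_fin => h3.
have {}h3 : F x <= (1 - 2^-1) * F (x + t *: v) + 2^-1 * F (x + t *: - v) by apply: h3; lra.
have : t * (dirder phi x v + dirder phi x (- v) + 2 * e) < 0.
  by rewrite pmulr_rlt0// /e; lra.
lra.
Qed.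

Definition slope (v : V) : lebT R m.+1 -> R :=
  (fun x => - (f x `^ (1 - alpha)) * dirder phi x v) \_ U.

Lemma slope_in v x : U x -> slope v x = - (f x `^ (1 - alpha)) * dirder phi x v.
Proof. by move=> Ux; rewrite /slope patchE mem_set. Qed.

Lemma slope_out v x : ~ U x -> slope v x = 0.
Proof. by move=> Ux; rewrite /slope patchE memNset. Qed.

Lemma slope_cvg v x : U x -> quot v k x @[k --> \oo] --> slope v x.
Proof. by move=> Ux; rewrite slope_in//; exact: falpha_quotient_cvg. Qed.

Lemma measurable_slope v : measurable_fun setT (slope v).
Proof.
have mh k : measurable_fun setT ((quot v k : lebT R m.+1 -> R) \_ (U : set (lebT R m.+1))).
  by apply/(measurable_restrictT _ mU); exact: (measurable_funTS (mquot v k)).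
apply: (measurable_fun_cvg mh) => x _; have [Ux|nUx] := pselect (U x).
  rewrite (_ : (fun k => _) = (fun k => quot v k x)); first exact: slope_cvg.
  by apply/funext => k; rewrite patchE mem_set.
rewrite slope_out// (_ : (fun k => _) = (fun=> 0)); first exact: cvg_cst.
by apply/funext => k; rewrite patchE memNset.
Qed.

Lemma slope_L1 v : (\int[mu]_x `|slope v x|%:E < +oo)%E /\
  forall e : R, 0 < e -> exists k0, forall k, (k0 <= k)%N ->
    (\int[mu]_x `|quot v k x - slope v x|%:E <= e%:E)%E.
Proof.
exact: (excess_cvg_L1 mU (mquot v) (measurable_slope v) (@slope_cvg v) (@slope_out v)
  (excess_small alpha0 alphan cphi phi0 lphi coer haus v)).
Qed.

Lemma integral_slope v : (\int[mu]_x (slope v x)%:E = 0)%E.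
Proof.
have inc k := integral_increment0 k.+1%:R (leb_shift_measurable (k.+1%:R^-1 *: v))
  (leb_outer_shift (k.+1%:R^-1 *: v) : forall A, mu ((fun x : lebT R m.+1 => x + _ : lebT R m.+1) @^-1` A) = mu A)
  mf (falpha_ge0 alpha0 phi0) int_fin.
exact: (integral_eq0_of_L1 (fun k => (inc k).1) (fun k => (inc k).2) (measurable_slope v)
  (slope_L1 v).1 (slope_L1 v).2).
Qed.

Lemma dirder_opp_ae v : mu.-negligible [set x : lebT R m.+1 |
  U x /\ dirder phi x (- v) != - dirder phi x v].
Proof.
pose H x := slope v x + slope (- v) x.
have is_ w : mu.-integrable setT (EFin \o slope w).
  apply/integrableP; split; first exact/measurable_EFinP/measurable_slope.
  exact: (slope_L1 w).1.
have mH : measurable_fun setT H := measurable_funD (measurable_slope v) (measurable_slope (- v)).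
have iH : (\int[mu]_x (H x)%:E = 0)%E.
  transitivity (\int[mu]_x ((slope v x)%:E + (slope (- v) x)%:E))%E; first by [].
  by rewrite (integralD_EFin measurableT (is_ v) (is_ (- v))) !integral_slope adde0.
have iHi : mu.-integrable setT (EFin \o H).
  rewrite (_ : EFin \o H = ((EFin \o slope v) \+ (EFin \o slope (- v)))%E).
    exact: (integrableD measurableT (is_ v) (is_ (- v))).
  by apply/funext => x.
have Hle0 x : H x <= 0.
  rewrite /H; have [Ux|nUx] := pselect (U x); last by rewrite !slope_out// addr0.
  rewrite !slope_in// -mulrDr mulNr oppr_le0 mulr_ge0 ?powR_ge0//.
  exact: dirder_sum_ge0.
apply: negligibleS (npos_integral0_ae iHi Hle0 iH) => x [Ux dx] /=.
(* The weight is positive on [U], so [H] vanishes only where the two one-sided derivatives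
   cancel. *)
rewrite /H !slope_in// -mulrDr mulf_eq0 oppr_eq0 powR_eq0.
rewrite (gt_eqF (falpha_gt0 alpha0 phi0 (interior_edom Ux)))/=.
by apply: contra dx => /eqP h; apply/eqP; lra.
Qed.

End slope.

(** * The gradient as a measurable map *)

Lemma measurable_row d (T : measurableType d) (R : realType) (n : nat) (h : 'I_n -> T -> R) :
  (forall i, measurable_fun setT (h i)) ->
  measurable_fun setT (fun x => (\row_i h i x : borelT R n)).
Proof.
move=> mh; apply: (@measurability _ _ T (borelT R n) setT _ (@open 'rV[R]_n) erefl).
move=> _ [W oW <-]; rewrite setTI.
have [B [OB Bsub]] := @lindelof_balls R n (eq W) W
  (fun x Wx => ex_intro _ W (And3 oW Wx erefl)).
rewrite (_ : _ @^-1` W = \bigcup_k [set x | ball (B k).1 (B k).2 (\row_i h i x : 'rV[R]_n)]).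
  apply: bigcupT_measurable => k; have [r0|r0] := leP (B k).2 0.
    rewrite (_ : [set x | _] = set0); first exact: measurable0.
    by rewrite -subset0 => x /ball_rowP[]; rewrite ltNge r0.
  rewrite (_ : [set x | _] = \bigcap_(i in [set: 'I_n])
     (h i @^-1` `](B k).1 0 i - (B k).2, (B k).1 0 i + (B k).2[%classic)).
    apply: fin_bigcap_measurable => // i _; rewrite -[X in measurable X]setTI.
    exact: mh.
  apply/seteqP; split => x /=.
    by move=> /ball_rowP[_ hx] i _ /=; have := hx i; rewrite in_itv/= -ltr_distl distrC mxE.
  move=> hx; apply/ball_rowP; split => // i; have := hx i I.
  by rewrite /= in_itv/= -ltr_distl distrC mxE.
apply/seteqP; split => x /=; first exact: OB.
move=> [k _ Bx]; have [|W' <-] := Bsub k; last exact.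
by have /ball_rowP[] := Bx.
Qed.

Lemma borel_coord_measurable (R : realType) (n : nat) (i : 'I_n) :
  measurable_fun setT (fun y : borelT R n => y 0 i).
Proof.
apply: (measurability _ (measurable_realfun.RGenOpens.measurableE R)) => _ [_ [a [b ->]] <-].
rewrite setTI; apply: sub_sigma_algebra.
by apply: open_comp; [move=> x _; exact: coord_continuous|exact: interval_open].
Qed.

Lemma enorm_le_sum (R : realType) (n : nat) (y : 'rV[R]_n) : enorm y <= \sum_i `|y 0 i|.
Proof.
have S0 : 0 <= \sum_i `|y 0 i| by apply: sumr_ge0.
rewrite -[leRHS]ger0_norm// -sqrtr_sqr /enorm ler_wsqrtr// /dotv expr2 mulr_suml.
apply: ler_sum => i _; apply: (@le_trans _ _ (`|y 0 i| * `|y 0 i|)).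
  by rewrite -normrM ler_norm.
by rewrite ler_wpM2l// (bigD1 i)//= lerDl sumr_ge0.
Qed.

Lemma borel_enorm_measurable (R : realType) (n : nat) :
  measurable_fun setT (fun y : borelT R n => enorm y).
Proof.
have md : measurable_fun setT (fun y : borelT R n => dotv y y).
  by apply: measurable_sum => i; apply: measurable_funM; exact: borel_coord_measurable.
exact: (measurableT_comp (continuous_measurable_fun (@sqrt_continuous R)) md).
Qed.

Lemma ae_integral_setT d (T : measurableType d) (R : realType)
    (mu : {measure set T -> \bar R}) (D : set T) (g : T -> R) :
  measurable D -> measurable_fun setT g -> mu.-negligible [set x | ~ D x /\ g x != 0] ->
  (\int[mu]_(x in D) (g x)%:E = \int[mu]_x (g x)%:E)%E.
Proof.
move=> mD mg [A [mA A0 gA]]; rewrite integral_mkcond; apply: ae_eq_integral => //.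
- by apply/(measurable_restrictT _ mD)/measurable_funTS; exact/measurable_EFinP.
- exact/measurable_EFinP.
exists A; split => // x /= nx; apply: gA; split => [Dx|]; last apply/eqP => gx; apply: nx => _.
  by rewrite patchE mem_set.
by rewrite patchE gx; case: ifP.
Qed.

Section barycenter.
Variables (R : realType) (m : nat) (alpha : R).
Local Notation V := 'rV[R]_m.+1.
Variable phi : V -> \bar R.
Hypotheses (alpha0 : alpha < 0) (alphan : - (m.+1%:R)^-1 < alpha).
Hypotheses (cphi : convex_efun phi) (phi0 : forall x, (0 <= phi x)%E).
Hypotheses (lphi : lower_semicontinuous phi) (coer : coercive phi).
Hypothesis haus : hausdorff (m.+1%:R - 1)
    [set x | (closure (edom phi) `\` interior (edom phi)) x /\
             ~ {for x, continuous phi}] = 0%E.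
Hypothesis int_fin : (\int[lebn R m.+1]_x (falpha alpha phi x)%:E < +oo)%E.
Local Notation U := (interior (edom phi)).
Local Notation f := (falpha alpha phi).
Local Notation mu := (lebn R m.+1).
Let mf : measurable_fun setT (f : lebT R m.+1 -> R) := falpha_measurable alpha0 phi0 lphi.
Let mU : measurable (U : set (lebT R m.+1)) := open_lebmeasurable (@open_interior _ _).

Local Notation w := (fun x => f x `^ (1 - alpha)).
Local Notation slope := (slope alpha phi).

Let mslope v : measurable_fun setT (slope v) := measurable_slope alpha0 cphi phi0 lphi v.

Lemma gdiff_ae : mu.-negligible (U `\` gdiff phi).
Proof.
(* Symmetry on the coordinate axes suffices. The union runs over all naturals, read as coordinates
   through [inord], to match countable unions of null sets. *)
apply: (@negligibleS _ _ _ _ (\bigcup_k [set x : lebT R m.+1 |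
    U x /\ dirder phi x (- delta_mx 0 (inord k : 'I_m.+1)) !=
      - dirder phi x (delta_mx 0 (inord k : 'I_m.+1))])).
  move=> x [Ux ngx]; apply/not_notP => nex; apply: ngx; split => //.
  apply: (directional_differentiable cphi phi0 Ux) => i; apply/eqP/negPn/negP => di.
  by apply: nex; exists i => //=; rewrite inord_val.
apply: negligible_bigcup => k.
exact: (dirder_opp_ae alpha0 alphan cphi phi0 lphi coer haus int_fin).
Qed.

(** Completeness of the Caratheodory measure makes the null part of [U] without gradient
    measurable. *)
Lemma gdiff_measurable : measurable (gdiff phi : set (lebT R m.+1)).
Proof.
have mn : measurable (U `\` gdiff phi : set (lebT R m.+1)).
  exact: (@measure_is_complete_caratheodory R (boxT R m.+1) (leb_outer R m.+1)) gdiff_ae.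
rewrite (_ : gdiff phi = U `\` (U `\` gdiff phi)); first exact: measurableD.
apply/seteqP; split => x; first by move=> gx; split; [exact: gx.1|case].
by move=> [Ux nn]; apply/not_notP => ngx; apply: nn.
Qed.

(** The gradient rebuilt from the slopes along the axes by dividing out the weight. It is measurable
    on the whole space and agrees with [grad phi] on [gdiff phi]. *)
Definition mgrad (x : lebT R m.+1) : borelT R m.+1 :=
  \row_i (- slope (delta_mx 0 i) x * f x `^ (- (1 - alpha))).

Lemma measurable_mgrad : measurable_fun setT mgrad.
Proof.
apply: measurable_row => i; apply: measurable_funM.
  exact: (measurableT_comp (@oppr_measurable R setT) (mslope _)).
exact: (measurableT_comp (@measurable_powR R (- (1 - alpha))) mf).
Qed.

Lemma slope_gdiff v x : gdiff phi x -> slope v x = - (w x) * dotv v (grad phi x).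
Proof. by move=> gx; rewrite slope_in ?(gdiff_dirder _ gx)//; exact: gx.1. Qed.

Lemma weight_gt0 x : edom phi x -> 0 < w x.
Proof. by move=> dx; apply: powR_gt0; exact: falpha_gt0. Qed.

Lemma mgradE x : gdiff phi x -> mgrad x = grad phi x.
Proof.
move=> gx; apply/rowP => i; rewrite mxE (slope_gdiff _ gx) !mulNr opprK powRN mulrAC.
rewrite divff ?gt_eqF ?weight_gt0//; last exact: interior_edom gx.1.
rewrite mul1r /dotv (bigD1 i)//= big1 ?addr0; first by rewrite mxE !eqxx mul1r.
by move=> j ji; rewrite mxE (negbTE ji) andbF mul0r.
Qed.

Lemma integral_gdiff (g : lebT R m.+1 -> R) : measurable_fun setT g ->
  (forall x, ~ U x -> g x = 0) ->
  (\int[mu]_(x in gdiff phi) (g x)%:E = \int[mu]_x (g x)%:E)%E.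
Proof.
move=> mg gU; apply: (ae_integral_setT gdiff_measurable mg).
apply: negligibleS gdiff_ae => x [ngx gx]; split => //.
by apply/not_notP => nUx; move: gx; rewrite gU// eqxx.
Qed.
End barycenter.

Lemma ge0_subset_integral_EFin d (T : measurableType d) (R : realType)
    (mu : {measure set T -> \bar R}) (D : set T) (g : T -> R) :
  measurable D -> measurable_fun setT g -> (forall x, 0 <= g x) ->
  (\int[mu]_(x in D) (g x)%:E <= \int[mu]_x (g x)%:E)%E.
Proof.
move=> mD mg g0; apply: ge0_subset_integral => //; first exact/measurable_EFinP.
by move=> x _; rewrite lee_fin.
Qed.

Lemma ge0_le_integral_in d (T : measurableType d) (R : realType)
    (mu : {measure set T -> \bar R}) (D : set T) (g h : T -> R) :
  measurable D -> measurable_fun setT g -> measurable_fun setT h ->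
  (forall x, 0 <= g x) -> (forall x, D x -> g x <= h x) ->
  (\int[mu]_(x in D) (g x)%:E <= \int[mu]_(x in D) (h x)%:E)%E.
Proof.
move=> mD mg mh g0 gh; apply: ge0_le_integral => //.
- by move=> x _; rewrite lee_fin.
- exact/measurable_EFinP/measurable_funTS.
- exact/measurable_EFinP/measurable_funTS.
Qed.

(** * The moment measure *)

Section moment_measure.
Variables (R : realType) (m : nat) (alpha : R).
Local Notation V := 'rV[R]_m.+1.
Variable phi : V -> \bar R.
Hypotheses (alpha0 : alpha < 0) (alphan : - (m.+1%:R)^-1 < alpha).
Hypotheses (cphi : convex_efun phi) (phi0 : forall x, (0 <= phi x)%E).
Hypotheses (lphi : lower_semicontinuous phi) (coer : coercive phi).
Hypothesis haus : hausdorff (m.+1%:R - 1)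
    [set x | (closure (edom phi) `\` interior (edom phi)) x /\
             ~ {for x, continuous phi}] = 0%E.
Hypothesis int_fin : (\int[lebn R m.+1]_x (falpha alpha phi x)%:E < +oo)%E.
Local Notation f := (falpha alpha phi).
Local Notation mu := (lebn R m.+1).
Local Notation w := (fun x => f x `^ (1 - alpha)).
Local Notation slope := (slope alpha phi).
Local Notation mgrad := (mgrad alpha phi).
Let mf : measurable_fun setT (f : lebT R m.+1 -> R) := falpha_measurable alpha0 phi0 lphi.

Let mw : measurable_fun setT (w : lebT R m.+1 -> R) :=
  measurableT_comp (@measurable_powR R (1 - alpha)) mf.
Let mslope v : measurable_fun setT (slope v) := measurable_slope alpha0 cphi phi0 lphi v.
Let mgdiff : measurable (gdiff phi : set (lebT R m.+1)) :=
  gdiff_measurable alpha0 alphan cphi phi0 lphi coer haus int_fin.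
Let mmgrad : measurable_fun setT mgrad := measurable_mgrad alpha0 cphi phi0 lphi.
Let w0 x : 0 <= w x := powR_ge0 _ _.
Let gdU x : gdiff phi x -> edom phi x.
Proof. by move=> gx; exact: interior_edom gx.1. Qed.

Lemma mgrad_coord x i : gdiff phi x -> mgrad x 0 i * w x = - slope (delta_mx 0 i) x.
Proof.
move=> gx; rewrite mxE powRN -mulrA mulVf ?mulr1// gt_eqF//.
by apply: powR_gt0; apply: falpha_gt0 => //; exact: gdU.
Qed.

Lemma mu_alpha_measure : exists N : {measure set (borelT R m.+1) -> \bar R},
  mu_alpha alpha phi = N /\
  forall h : borelT R m.+1 -> \bar R, measurable_fun setT h -> (forall y, 0 <= h y)%E ->
    (\int[N]_y h y = \int[mu]_(x in gdiff phi) (h (mgrad x) * (w x)%:E))%E.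
Proof.
have [N [NE Nint]] := pushforward_density mu mgdiff (measurable_funTS mmgrad)
  (measurable_funTS mw) w0.
exists N; split => //; rewrite -NE; apply/funext => A; rewrite /mu_alpha.
congr (integral mu _ _); apply/seteqP; split => x /= [gx Ax]; split => //.
  by rewrite (mgradE alpha0 phi0 gx).
by rewrite -(mgradE alpha0 phi0 gx).
Qed.

Lemma slope_L1_fin v : (\int[mu]_x `|slope v x|%:E < +oo)%E.
Proof. exact: (slope_L1 alpha0 alphan cphi phi0 lphi coer haus v).1. Qed.

(** Multiplied by the weight, the coordinates of the gradient are slopes up to sign, and slopes are
    integrable. *)
Lemma first_moment (N : {measure set (borelT R m.+1) -> \bar R}) :
  (forall h : borelT R m.+1 -> \bar R, measurable_fun setT h -> (forall y, 0 <= h y)%E ->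
    (\int[N]_y h y = \int[mu]_(x in gdiff phi) (h (mgrad x) * (w x)%:E))%E) ->
  (\int[N]_y (enorm y)%:E < +oo)%E.
Proof.
move=> Nint; have e0 (y : borelT R m.+1) : 0 <= enorm y by exact: sqrtr_ge0.
have me : measurable_fun setT (fun y : borelT R m.+1 => (enorm y)%:E).
  by apply/measurable_EFinP; exact: borel_enorm_measurable.
rewrite Nint//; pose S (x : lebT R m.+1) := \sum_(i < m.+1) `|slope (delta_mx 0 (inord i)) x|.
have mabs v : measurable_fun setT (fun x => `|slope v x|) :=
  measurableT_comp (@normr_measurable R setT) (mslope v).
have mS : measurable_fun setT S := measurable_sum_ord m.+1 (fun j => mabs (delta_mx 0 (inord j))).
have S0 x : 0 <= S x by apply: sumr_ge0.
apply: (@le_lt_trans _ _ (\int[mu]_x (S x)%:E)%E).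
  apply: (le_trans _ (ge0_subset_integral_EFin mu mgdiff mS S0)).
  change (\int[mu]_(x in gdiff phi) (enorm (mgrad x) * w x)%:E <=
          \int[mu]_(x in gdiff phi) (S x)%:E)%E.
  apply: ge0_le_integral_in mgdiff _ mS _ _.
  - apply: measurable_funM; last exact: mw.
    exact: (measurableT_comp (@borel_enorm_measurable R m.+1) mmgrad).
  - by move=> x; rewrite mulr_ge0.
  - move=> x gx.
    apply: (@le_trans _ _ ((\sum_i `|mgrad x 0 i|) * w x)).
      by rewrite ler_wpM2r// enorm_le_sum.
    rewrite mulr_suml /S; apply: ler_sum => i _.
    rewrite inord_val -[X in _ * X](ger0_norm (w0 x)) -normrM mgrad_coord// normrN.
    exact: lexx.
rewrite (@ge0_integral_sum_EFin _ _ _ mu m.+1 (fun j x => `|slope (delta_mx 0 (inord j)) x|)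
  (fun j => mabs _) (fun j x => normr_ge0 _)).
by apply: lte_sum_pinfty => i _; exact: slope_L1_fin.
Qed.

Lemma barycenter0 (N : {measure set (borelT R m.+1) -> \bar R}) (i : 'I_m.+1) :
  (forall h : borelT R m.+1 -> \bar R, measurable_fun setT h -> (forall y, 0 <= h y)%E ->
    (\int[N]_y h y = \int[mu]_(x in gdiff phi) (h (mgrad x) * (w x)%:E))%E) ->
  (\int[N]_y (y 0 i)%:E = 0)%E.
Proof.
move=> Nint; pose c (y : borelT R m.+1) := (y 0 i)%:E.
have mc : measurable_fun setT c by apply/measurable_EFinP; exact: borel_coord_measurable.
pose g (x : lebT R m.+1) := - slope (delta_mx 0 i) x.
have mg : measurable_fun setT g := measurableT_comp (@oppr_measurable R setT) (mslope _).
(* The change of variables is available for nonnegative functions, hence is applied to the positive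
   and negative parts separately. *)
have pos : (\int[N]_y (c^\+ y) = \int[mu]_(x in gdiff phi) ((EFin \o g)^\+ x))%E.
  rewrite Nint; [|exact: measurable_funepos|exact: funepos_ge0].
  apply: eq_integral => x /set_mem gx; rewrite !funeposE /c /= /g -mgrad_coord//.
  by rewrite -EFin_max -EFinM -EFin_max maxr_pMl// mul0r.
have neg : (\int[N]_y (c^\- y) = \int[mu]_(x in gdiff phi) ((EFin \o g)^\- x))%E.
  rewrite Nint; [|exact: measurable_funeneg|exact: funeneg_ge0].
  apply: eq_integral => x /set_mem gx; rewrite !funenegE /c /= /g -mgrad_coord//.
  by rewrite -EFin_max -EFinM -EFin_max maxr_pMl// mul0r mulNr.
rewrite (integralE N setT c) pos neg -integralE.
rewrite (integral_gdiff alpha0 alphan cphi phi0 lphi coer haus int_fin mg).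
  have ig : mu.-integrable setT (EFin \o slope (delta_mx 0 i)).
    by apply/integrableP; split; [exact/measurable_EFinP|exact: slope_L1_fin].
  rewrite (integralN (integrable_add_def measurableT ig)).
  by rewrite (integral_slope alpha0 alphan cphi phi0 lphi coer haus int_fin) oppe0.
by move=> x nUx; rewrite /g slope_out// oppr0.
Qed.
End moment_measure.

(** * The support and hyperplanes *)

Lemma locally_null_negligible (R : realType) (n : nat)
    (N : {measure set (borelT R n) -> \bar R}) (O : set 'rV[R]_n) :
  (forall y, O y -> exists V : set 'rV[R]_n, [/\ open V, V y & N V = 0%E]) ->
  N.-negligible (O : set (borelT R n)).
Proof.
(* Countably many balls, each inside a null open set, cover [O]. *)
move=> loc; have [F [OF Fnull]] := @lindelof_balls R n
  (fun V => open V /\ N V = 0%E) O (fun y Oy =>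
    let: ex_intro V (And3 oV Vy NV) := loc y Oy in ex_intro _ V (And3 oV Vy (conj oV NV))).
apply: (@negligibleS _ _ _ N (\bigcup_k (ball (F k).1 (F k).2 : set (borelT R n))) O OF).
apply: negligible_bigcup => k.
have [r0|r0] := ltP 0 (F k).2; last by rewrite le0_ball0//; exact: negligible_set0.
have [V [oV NV] sub] := Fnull k r0;
exists V; split => //; exact: sub_sigma_algebra.
Qed.

Lemma ge0_ae_eq_integral_EFin d (T : measurableType d) (R : realType)
    (mu : {measure set T -> \bar R}) (g h : T -> R) :
  measurable_fun setT g -> measurable_fun setT h -> mu.-negligible [set x | g x != h x] ->
  (\int[mu]_x (g x)%:E = \int[mu]_x (h x)%:E)%E.
Proof.
move=> mg mh [A [mA A0 gh]]; apply: ae_eq_integral => //; try exact/measurable_EFinP.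
exists A; split => // x /= ngh; apply: gh => /=; apply/eqP => ghx; apply: ngh => _.
by rewrite ghx.
Qed.

Lemma npos_ae_integral0_ae d (T : measurableType d) (R : realType)
    (mu : {measure set T -> \bar R}) (H : T -> R) :
  mu.-integrable setT (EFin \o H) -> mu.-negligible [set x | 0 < H x] ->
  (\int[mu]_x (H x)%:E = 0)%E -> mu.-negligible [set x | H x != 0].
Proof.
move=> iH H0 iH0; have /measurable_EFinP mH := measurable_int mu iH.
(* The truncation agrees with [H] almost everywhere and is nonpositive at every point. *)
pose G x := Num.min (H x) 0.
have mG : measurable_fun setT G by apply: measurable_minr.
have nGH : mu.-negligible [set x | G x != H x].
  apply: negligibleS H0 => x /=; apply: contraNT; rewrite -leNgt => Hx.
  by rewrite /G min_l.
have iG : mu.-integrable setT (EFin \o G).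
  apply: le_integrable iH => //; first exact/measurable_EFinP.
  move=> x _ /=; rewrite lee_fin /G; case: (leP (H x) 0) => // _.
  by rewrite normr0.
have iG0 : (\int[mu]_x (G x)%:E = 0)%E by rewrite (ge0_ae_eq_integral_EFin mG mH nGH).
have G0 x : G x <= 0 by rewrite /G ge_min lexx orbT.
apply: negligibleS (negligibleU nGH (npos_integral0_ae iG G0 iG0)) => x /= Hx.
by have [GH|GH] := eqVneq (G x) (H x); [right; rewrite GH|left].
Qed.

Lemma ge0_integral0_negligible d (T : measurableType d) (R : realType)
    (mu : {measure set T -> \bar R}) (D : set T) (g : T -> R) :
  measurable D -> measurable_fun setT g -> (forall x, 0 <= g x) ->
  (\int[mu]_(x in D) (g x)%:E = 0)%E -> mu.-negligible [set x | D x /\ g x != 0].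
Proof.
move=> mD mg g0 ig; have mDg : measurable_fun D (EFin \o g).
  exact/measurable_EFinP/measurable_funTS.
have [A [mA A0 HA]] := (ae_eq_integral_abs mu mD mDg).1 (etrans (eq_integral _ _
  (fun x _ => congr1 EFin (ger0_norm (g0 x)))) ig).
by exists A; split => // x /= [Dx /eqP gx]; apply: HA => /= /(_ Dx) [].
Qed.

(** A set of outer measure 0 satisfies the Caratheodory condition by monotonicity, hence is
    measurable. *)
Lemma lebn_null_negligible (R : realType) (n : nat) (A : set (lebT R n)) :
  lebn R n A = 0%E -> (lebn R n).-negligible A.
Proof.
move=> A0; exists A; split => //.
have /= : (leb_outer R n).-caratheodory A; last by [].
apply: le_caratheodory_measurable => X.
have h1 : (leb_outer R n (X `&` A) <= 0)%E.
  by rewrite -A0; exact: (le_outer_measure (leb_outer R n) _ _ (@subIsetr _ X A)).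
have h2 := le_outer_measure (leb_outer R n) _ _ (@subIsetl _ X (~` A)).
by apply: le_trans (leeD h1 h2) _; rewrite add0e.
Qed.

Lemma dotvZl (R : realType) (n : nat) (t : R) (v y : 'rV[R]_n) :
  dotv (t *: v) y = t * dotv v y.
Proof. by rewrite /dotv mulr_sumr; apply: eq_bigr => i _; rewrite mxE mulrA. Qed.

Section degenerate_direction.
Variables (R : realType) (m : nat) (alpha : R).
Local Notation V := 'rV[R]_m.+1.
Variable phi : V -> \bar R.
Hypotheses (alpha0 : alpha < 0) (alphan : - (m.+1%:R)^-1 < alpha).
Hypotheses (cphi : convex_efun phi) (phi0 : forall x, (0 <= phi x)%E).
Hypotheses (lphi : lower_semicontinuous phi) (coer : coercive phi).
Hypothesis haus : hausdorff (m.+1%:R - 1)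
    [set x | (closure (edom phi) `\` interior (edom phi)) x /\
             ~ {for x, continuous phi}] = 0%E.
Hypothesis int_fin : (\int[lebn R m.+1]_x (falpha alpha phi x)%:E < +oo)%E.
Local Notation U := (interior (edom phi)).
Local Notation f := (falpha alpha phi).
Local Notation mu := (lebn R m.+1).
Local Notation quot := (shift_quotient alpha phi).
Local Notation w := (fun x => f x `^ (1 - alpha)).
Local Notation slope := (slope alpha phi).
Local Notation mgrad := (mgrad alpha phi).
Let mf : measurable_fun setT (f : lebT R m.+1 -> R) := falpha_measurable alpha0 phi0 lphi.
Let mquot v k : measurable_fun setT (quot v k : lebT R m.+1 -> R) :=
  measurable_shift_quotient alpha0 phi0 lphi v k.

Let mw : measurable_fun setT (w : lebT R m.+1 -> R) :=
  measurableT_comp (@measurable_powR R (1 - alpha)) mf.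
Let mslope v : measurable_fun setT (slope v) := measurable_slope alpha0 cphi phi0 lphi v.
Let mgdiff : measurable (gdiff phi : set (lebT R m.+1)) :=
  gdiff_measurable alpha0 alphan cphi phi0 lphi coer haus int_fin.
Let mmgrad : measurable_fun setT mgrad := measurable_mgrad alpha0 cphi phi0 lphi.
Let w0 x : 0 <= w x := powR_ge0 _ _.
Let gdU x : gdiff phi x -> edom phi x.
Proof. by move=> gx; exact: interior_edom gx.1. Qed.

(** The points [x + k%:R *: v] eventually leave each superlevel set of positive level, since these
    are bounded. *)
Lemma falpha_escape v x : v != 0 -> f (x + k%:R *: v) @[k --> \oo] --> 0.
Proof.
move=> v0; have nv : 0 < `|v| by rewrite normr_gt0.
apply/cvgrPdist_lt => e e0.
have [M [_ HM]] := compact_bounded (superlevel_compact alpha0 phi0 lphi coer e0).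
near=> k; rewrite sub0r normrN (ger0_norm (falpha_ge0 alpha0 phi0 _)) ltNge.
apply/negP => /(HM (M + 1) (ltr_pwDr ltr01 (lexx M))) /=; apply/negP; rewrite -ltNge.
have kM : (M + 1 + `|x|) / `|v| < k%:R by near: k; exact: nbhs_infty_gtr.
have {}kM : M + 1 + `|x| < `|k%:R *: v| by rewrite normrZ normr_nat -ltr_pdivrMr.
rewrite -(ltrD2r `|x|); apply: lt_le_trans kM _.
by have := ler_normB (x + k%:R *: v) x; rewrite addrAC subrr add0r.
Unshelve. all: by end_near. Qed.

(** The open set [O] misses the support, so it is covered by null open sets and null itself. Its
    mass is the integral of a positive weight over the points with gradient in [O], which are
    therefore negligible. *)
Lemma negligible_slope v c (N : {measure set (borelT R m.+1) -> \bar R}) :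
  (forall h : borelT R m.+1 -> \bar R, measurable_fun setT h -> (forall y, 0 <= h y)%E ->
    (\int[N]_y h y = \int[mu]_(x in gdiff phi) (h (mgrad x) * (w x)%:E))%E) ->
  msupport N `<=` [set y | dotv v y = c] ->
  mu.-negligible [set x | U x /\ dotv v (grad phi x) != c].
Proof.
move=> Nint sup; pose O := [set y : 'rV[R]_m.+1 | dotv v y != c].
have oO : open O.
  rewrite (_ : O = dotv v @^-1` [set t | t != c]) //; apply: open_comp; last exact: open_neq.
  by move=> y _; exact: dotv_continuous.
have mO : measurable (O : set (borelT R m.+1)) by exact: sub_sigma_algebra.
have NO : N O = 0%E.
  apply/negligibleP => //; apply: locally_null_negligible => y Oy.
  have /existsNP[V /not_implyP[oV /not_implyP[Vy nV]]] : ~ msupport N y.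
    by move=> /sup /eqP; apply/negP.
  exists V; split => //; apply/eqP; rewrite eq_le measure_ge0 andbT leNgt; exact/negP.
have mi : measurable_fun setT (\1_O : borelT R m.+1 -> R) by exact: measurable_indic.
have mg : measurable_fun setT (fun x => \1_O (mgrad x) * w x).
  exact: measurable_funM (measurableT_comp mi mmgrad) mw.
have g0 x : 0 <= \1_O (mgrad x) * w x by rewrite mulr_ge0.
have ig : (\int[mu]_(x in gdiff phi) (\1_O (mgrad x) * w x)%:E = 0)%E.
  have : (\int[N]_y (\1_O y)%:E = 0)%E by rewrite integral_indic// setIT.
  rewrite Nint//; first exact/measurable_EFinP.
have ng := ge0_integral0_negligible mgdiff mg g0 ig.
have nU := gdiff_ae alpha0 alphan cphi phi0 lphi coer haus int_fin.
apply: negligibleS (negligibleU nU ng) => x [Ux dx].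
have [gx|ngx] := pselect (gdiff phi x); last by left.
right; split => //; rewrite mulf_neq0//; last by rewrite gt_eqF// weight_gt0//; exact: gdU.
by rewrite (mgradE alpha0 phi0 gx) indicE mem_set// oner_neq0.
Qed.

(** The increment along [v] is a sum of [k.+1] increments along [v / k.+1], so its integral is at
    most that of [|quot v k|], which tends to 0 when the L^1 limit [slope v] vanishes. *)
Lemma integral_translate v : mu.-negligible [set x | slope v x != 0] ->
  (\int[mu]_x `|f (x + v) - f x|%:E <= 0)%E.
Proof.
move=> sv0; apply/lee_addgt0Pr => e e0; rewrite add0e.
have [k0 /(_ k0 (leqnn _)) hk] :=
  (slope_L1 alpha0 alphan cphi phi0 lphi coer haus v).2 e e0.
have mabs g : measurable_fun setT (g : lebT R m.+1 -> R) -> measurable_fun setT (fun x => `|g x|).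
  exact: measurableT_comp (@normr_measurable R setT).
apply: le_trans hk; pose a := k0.+1%:R^-1 *: v.
have K0 : k0.+1%:R != 0 :> R by rewrite pnatr_eq0.
rewrite (_ : (\int[mu]_x `|quot v k0 x - slope v x|%:E = \int[mu]_x `|quot v k0 x|%:E)%E).
  have := integral_abs_iter k0.+1 (leb_shift_measurable a) (leb_outer_shift a :
    forall A, mu ((fun x : lebT R m.+1 => x + a : lebT R m.+1) @^-1` A) = mu A) mf.
  under eq_integral do rewrite iter_shift scalerA mulfV// scale1r.
  by under [X in (_ <= X)%E]eq_integral do rewrite -[X in X * _]normr_nat -normrM.
apply: ge0_ae_eq_integral_EFin; [|exact: mabs (mquot v k0)|].
  exact: mabs (measurable_funB (mquot v k0) (mslope v)).
apply: negligibleS sv0 => x /=; apply: contra => /eqP ->; by rewrite subr0.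
Qed.

Lemma support_not_in_hyperplane v c (N : {measure set (borelT R m.+1) -> \bar R}) :
  (forall h : borelT R m.+1 -> \bar R, measurable_fun setT h -> (forall y, 0 <= h y)%E ->
    (\int[N]_y h y = \int[mu]_(x in gdiff phi) (h (mgrad x) * (w x)%:E))%E) ->
  (0 < \int[mu]_x (f x)%:E)%E -> v != 0 ->
  ~ (msupport N `<=` [set y | dotv v y = c]).
Proof.
move=> Nint int_pos v0 sup; have nc := negligible_slope Nint sup.
have nU := gdiff_ae alpha0 alphan cphi phi0 lphi coer haus int_fin.
have nUc := negligibleU nU nc.
(* Along [c *: v] the slope is [- (w x * c ^+ 2)] almost everywhere on [U], nonpositive for either
   sign of [c]. Its integral is 0, so [c != 0] would make f vanish almost everywhere. *)
have c0 : c = 0.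
  apply/eqP/negPn/negP => cn0; have := int_pos; apply/negP; rewrite -leNgt.
  have is_ : mu.-integrable setT (EFin \o slope (c *: v)).
    by apply/integrableP; split; [exact/measurable_EFinP|exact: slope_L1_fin].
  have sE x : gdiff phi x -> dotv v (grad phi x) = c -> slope (c *: v) x = - (w x * c ^+ 2).
    by move=> gx gc; rewrite (slope_gdiff _ _ gx) dotvZl gc mulNr expr2.
  have np : mu.-negligible [set x | 0 < slope (c *: v) x].
    apply: negligibleS nUc => x /=.
    have [Ux|nUx] := pselect (U x); last by rewrite slope_out// ltxx.
    have [gx|ngx] := pselect (gdiff phi x); last by left.
    have [gc|gc] := eqVneq (dotv v (grad phi x)) c; last by right.
    by rewrite sE// oppr_gt0 ltNge mulr_ge0// sqr_ge0.
  have n0 := npos_ae_integral0_ae is_ np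
    (integral_slope alpha0 alphan cphi phi0 lphi coer haus int_fin (c *: v)).
  have nf : mu.-negligible [set x | f x != 0].
    (* f is positive also at domain points outside [U], but these form a null set. *)
    have nb := lebn_null_negligible (lebn_dom_boundary haus).
    apply: negligibleS (negligibleU nb (negligibleU nUc n0)) => x /= fx.
    have dx : edom phi x by apply/not_notP => ndx; move: fx; rewrite falpha_ndom// eqxx.
    have [Ux|nUx] := pselect (U x); last by left.
    right; have [gx|ngx] := pselect (gdiff phi x); last by left; left.
    have [gc|gc] := eqVneq (dotv v (grad phi x)) c; last by left; right.
    right; rewrite /= sE// oppr_eq0 mulf_neq0// ?expf_neq0//.
    by rewrite gt_eqF// weight_gt0.
  have m0 : measurable_fun setT (fun _ : lebT R m.+1 => 0 : R) by exact: measurable_cst.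
  by rewrite (ge0_ae_eq_integral_EFin mf m0 nf) integral0.
have ns t : mu.-negligible [set x | slope (t *: v) x != 0].
  apply: negligibleS nUc => x /=; have [Ux|nUx] := pselect (U x); last by rewrite slope_out// eqxx.
  have [gx|ngx] := pselect (gdiff phi x); last by left.
  have [gc|gc] := eqVneq (dotv v (grad phi x)) c; last by right.
  by rewrite (slope_gdiff _ _ gx) dotvZl gc c0 !mulr0 eqxx.
have := int_pos; apply/negP; rewrite -leNgt.
(* The integrals of [|f (x + k%:R *: v) - f x|] all vanish while the integrands tend to [f x], so by
   Fatou f has integral 0. *)
apply: (@fatou_le _ _ _ mu (fun k x => `|f (x + k%:R *: v) - f x|%:E)).
- move=> k; apply/measurable_EFinP; apply: (measurableT_comp (@normr_measurable R setT)).
  exact: measurable_funB (measurable_shift_fun (k%:R *: v) mf) mf.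
- by move=> k x; rewrite lee_fin.
- move=> x; apply: cvg_EFin; first exact: nearW.
  have : `|f (x + k%:R *: v) - f x| @[k --> \oo] --> `|0 - f x|.
    by apply: cvg_norm; apply: cvgB (falpha_escape x v0) _; exact: cvg_cst.
  by rewrite sub0r normrN (ger0_norm (falpha_ge0 alpha0 phi0 x)).
- by exists 0 => k _; exact: integral_translate.
Qed.
End degenerate_direction.

Theorem theorem4p3 (R : realType) (n : nat) (alpha : R)
    (phi : 'rV[R]_n -> \bar R) :
  - (n%:R)^-1 < alpha -> alpha < 0 ->
  Conv phi -> (forall x, (0 <= phi x)%E) -> coercive phi ->
  essentially_continuous phi ->
  (0 < \int[lebn R n]_x (falpha alpha phi x)%:E)%E ->
  (\int[lebn R n]_x (falpha alpha phi x)%:E < +oo)%E ->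
  (* finite first moment *)
  (\int[mu_alpha alpha phi]_y (enorm y)%:E < +oo)%E /\
  (* barycenter at the origin *)
  (forall i : 'I_n, (\int[mu_alpha alpha phi]_y (y 0 i)%:E = 0)%E) /\
  (* support not contained in any affine hyperplane *)
  (forall (v : 'rV[R]_n) (c : R), v != 0 ->
     ~ (msupport (mu_alpha alpha phi) `<=` [set y | dotv v y = c])).
Proof.
case: n phi => [|m] phi.
  (* For [n = 0] the inverse of 0 is 0, so the two bounds on [alpha] contradict each other. *)
  by rewrite invr0 oppr0 => /lt_trans/[apply]; rewrite ltxx.
move=> alphan alpha0 [_ [cphi lphi]] phi0 coer [_ haus] int_pos int_fin.
have [N [-> Nint]] := mu_alpha_measure alpha0 alphan cphi phi0 lphi coer haus int_fin.
split; [|split].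
- exact: (first_moment alpha0 alphan cphi phi0 lphi coer haus int_fin Nint).
- by move=> i; exact: (barycenter0 alpha0 alphan cphi phi0 lphi coer haus int_fin i Nint).
- move=> v c v0.
  exact: (support_not_in_hyperplane alpha0 alphan cphi phi0 lphi coer haus int_fin Nint int_pos v0).
Qed.
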